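(* Let $\sigma=(f,g)$ be a normal sequence of homogeneous polynomials in $\kappa[x_0,\ldots,x_3]$ of degrees $d_f+1$ and $d_g+1$ respectively, and set $d=d_f+d_g$ and $m_0=d_f^2+d_g^2+d_fd_g$. Then: (a) $\operatorname{indeg}(\mathcal{T}_\sigma)\le d_f+d_g$; (b) $m(\sigma)\le m_0$; (c) the following are equivalent: (1) $m(\sigma)=m_0$; (2) $\operatorname{indeg}(\mathcal{T}_\sigma)=0$; (3) $\sigma$ is compressible; (4) $\mathcal{T}_\sigma\simeq\mathcal{O}_{\mathbb{P}^3}\oplus\mathcal{O}_{\mathbb{P}^3}(-d)$.
   Context: Let $\kappa$ be an algebraically closed field of characteristic zero, $R=\kappa[x_0,\ldots,x_3]$ and $\mathbb{P}^3=\operatorname{Proj}R$. A sequence $\sigma=(f,g)$ is an algebraically independent pair of homogeneous polynomials in $R$ with $\deg f=d_f+1$, $\deg g=d_g+1$. Its $2\times4$ Jacobian matrix (rows the gradients of $f$ and $g$) defines a morphism $\nabla\sigma:\mathcal{O}_{\mathbb{P}^3}^{\oplus4}\to\mathcal{O}_{\mathbb{P}^3}(d_f)\oplus\mathcal{O}_{\mathbb{P}^3}(d_g)$. Write $\mathcal{T}_\sigma=\ker(\nabla\sigma)$ (the logarithmic tangent sheaf, reflexive of rank 2) and $\mathcal{Q}_\sigma=\operatorname{coker}(\nabla\sigma)$. The sequence is normal if $\operatorname{Supp}\mathcal{Q}_\sigma$ has codimension at least 2 in $\mathbb{P}^3$. For normal $\sigma$, the Hilbert polynomial has the form $\chi(\mathcal{Q}_\sigma(t))=m(\sigma)\,t+\text{const}$,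 which defines the integer $m(\sigma)\ge0$. The initial degree is $\operatorname{indeg}(\mathcal{T}_\sigma)=\min\{l\in\mathbb{Z}: H^0(\mathcal{T}_\sigma(l))\ne0\}$. The sequence $\sigma$ is compressible if, after a linear change of coordinates of $\mathbb{P}^3$, there is a variable $x_i$ on which neither $f$ nor $g$ depends. *)

(* Defs.v *)
From mathcomp Require Import all_boot all_order all_algebra.
From mathcomp Require Import fraction.
From mathcomp.multinomials Require Import mpoly.

Set Implicit Arguments.
Unset Strict Implicit.
Unset Printing Implicit Defensive.

Import GRing.Theory.
Local Open Scope ring_scope.

Section ProjectiveSpace.
Variable K : fieldType.

Local Notation R := {mpoly K[4]}.
Local Notation F := {fraction {mpoly K[4]}}.

(* P^3 = Proj R: homogeneous primes not containing the irrelevant ideal. *)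
Record point := Point {
  prime_of :> R -> Prop;
  point0 : prime_of 0;
  pointD : forall a b, prime_of a -> prime_of b -> prime_of (a + b);
  pointMl : forall a b, prime_of b -> prime_of (a * b);
  point_proper : ~ prime_of 1;
  point_prime : forall a b, prime_of (a * b) -> prime_of a \/ prime_of b;
  point_homog : forall a k, prime_of a -> prime_of (pihomog mdeg k a);
  point_relevant : exists i : 'I_4, ~ prime_of 'X_i
}.

Implicit Types (p q : point) (U V : point -> Prop) (n t : int).

Definition whole : point -> Prop := fun=> True.

(* Zariski topology: the sets D_+(h), h homogeneous, form a basis. *)
Definition zopen U : Prop :=
  forall p, U p -> exists h k,
    [/\ h \is k.-homog, ~ p h & forall q, ~ q h -> U q].

Definition strict_generization q p : Prop :=
  (forall a, q a -> p a) /\ (exists2 a, p a & ~ q a).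

(* dim O_{X,p} >= k, via chains of irreducible closed subsets containing p. *)
Fixpoint height_ge (k : nat) p : Prop :=
  if k is k'.+1 then exists2 q, strict_generization q p & height_ge k' q
  else True.

Definition codim_ge (k : nat) (Z : point -> Prop) : Prop :=
  forall p, Z p -> height_ge k p.

(* The stalk O(n)_p, inside the constant sheaf F of fractions of R. *)
Definition stalkO n p (r : F) : Prop :=
  exists k l (a b : R),
    [/\ a \is k.-homog, b \is l.-homog, ~ p b, k%:Z = l%:Z + n
      & r = tofrac a / tofrac b].

(* Since P^3 is integral, for U nonempty O(n)(U) is the intersection of the
   stalks O(n)_p, p in U, and restriction maps are inclusions. *)
Definition sectO n U (r : F) : Prop := forall p, U p -> stalkO n p r.

(* Stalks and sections of the direct sum of the O(a i), i < r. *)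
Definition stalk_sum r (a : 'I_r -> int) p (w : 'cV[F]_r) : Prop :=
  forall i, stalkO (a i) p (w i 0).
Definition sect_sum r (a : 'I_r -> int) U (w : 'cV[F]_r) : Prop :=
  forall i, sectO (a i) U (w i 0).

(* Isomorphisms of O-modules, for subsheaves A, B of the constant sheaves
   F^r, F^s given by their sections over nonempty opens. *)
Definition sheaf_iso r s (A : (point -> Prop) -> 'cV[F]_r -> Prop)
    (B : (point -> Prop) -> 'cV[F]_s -> Prop) : Prop :=
  exists phi : (point -> Prop) -> 'cV[F]_r -> 'cV[F]_s,
    (forall U, zopen U -> (exists p, U p) ->
      [/\ forall x, A U x -> B U (phi U x),
          forall x y, A U x -> A U y -> phi U (x + y) = phi U x + phi U y,
          forall c x, sectO 0 U c -> A U x -> phi U (c *: x) = c *: phi U x,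
          forall x y, A U x -> A U y -> phi U x = phi U y -> x = y
        & forall z, B U z -> exists2 x, A U x & phi U x = z]) /\
    (forall U V, zopen U -> zopen V -> (exists p, V p) ->
      (forall p, V p -> U p) -> forall x, A U x -> phi V x = phi U x).

Section JacobianSheaves.
Variables (f g : R) (df dg : nat).

Definition alg_independent : Prop :=
  forall P : {mpoly K[2]}, P \mPo [tuple f; g] = 0 -> P = 0.

Definition jacobian : 'M[F]_(2, 4) :=
  \matrix_(i < 2, j < 4) tofrac (mderiv j (if i == 0 then f else g)).

(* Degrees of the summands of O(t)^4 and O(df + t) (+) O(dg + t). *)
Definition src_deg t : 'I_4 -> int := fun=> t.
Definition tgt_deg t : 'I_2 -> int :=
  fun i => (if i == 0 then df%:Z else dg%:Z) + t.

(* T_sigma(t), the kernel of the Jacobian on O(t)^4. *)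
Definition sectT t U (v : 'cV[F]_4) : Prop :=
  sect_sum (src_deg t) U v /\ jacobian *m v = 0.

Definition is_indeg (l : int) : Prop :=
  let nonzeroH0 k := exists2 v, sectT k whole v & v != 0 in
  nonzeroH0 l /\ forall k, nonzeroH0 k -> (l <= k)%R.

(* Image of the Jacobian on stalks at p; Q_sigma(t)_p is the quotient of
   O(df + t)_p (+) O(dg + t)_p by it. *)
Definition stalk_im t p (w : 'cV[F]_2) : Prop :=
  exists2 v, stalk_sum (src_deg t) p v & w = jacobian *m v.

Definition suppQ p : Prop :=
  exists2 w, stalk_sum (tgt_deg 0) p w & ~ stalk_im 0 p w.

Definition normal : Prop := codim_ge 2 suppQ.

(* A section over U of the cokernel sheaf Q_sigma(t) is a family of germs,
   s p representing a class in Q_sigma(t)_p, which is locally the class of a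
   section of O(df + t) (+) O(dg + t); two families are the same section when
   they satisfy eqQ, so values outside U are irrelevant. *)
Definition sectQ t U (s : point -> 'cV[F]_2) : Prop :=
  forall p, U p -> exists V w,
    [/\ zopen V, V p, sect_sum (tgt_deg t) V w
      & forall q, U q -> V q -> stalk_im t q (s q - w)].
Definition eqQ t U (s s' : point -> 'cV[F]_2) : Prop :=
  forall q, U q -> stalk_im t q (s q - s' q).

(* Cohomology of Q_sigma(t) as ordered Cech cohomology for the standard affine
   cover: the simplices i_0 < .. < i_n are the sets I with n + 1 elements. *)
Definition cover (I : {set 'I_4}) : point -> Prop :=
  fun p => forall i, i \in I -> ~ p 'X_i.

Definition cochain := {set 'I_4} -> point -> 'cV[F]_2.

Definition cech_cochain t (n : nat) (c : cochain) : Prop :=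
  forall I : {set 'I_4}, #|I| = n.+1 -> sectQ t (cover I) (c I).

Definition cech_d (c : cochain) : cochain := fun I q =>
  \sum_(i in I) (-1) ^+ #|[set j in I | (j < i)%N]| *: c (I :\ i) q.

Definition cech_cocycle t (n : nat) (c : cochain) : Prop :=
  cech_cochain t n c /\
  forall I : {set 'I_4}, #|I| = n.+2 -> eqQ t (cover I) (cech_d c I) (fun=> 0).

Definition cech_coboundary t (n : nat) (c : cochain) : Prop :=
  if n is k.+1 then
    exists2 b, cech_cochain t k b &
      forall I : {set 'I_4}, #|I| = n.+1 -> eqQ t (cover I) (c I) (cech_d b I)
  else forall I : {set 'I_4}, #|I| = 1%N -> eqQ t (cover I) (c I) (fun=> 0).

Definition scalar (c : K) : F := tofrac (mpolyC 4 c).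

(* dim_K H^n(P^3, Q_sigma(t)) = N: some N cocycles form a basis modulo
   coboundaries. *)
Definition dimH t (n N : nat) : Prop :=
  exists e : 'I_N -> cochain,
    (forall k, cech_cocycle t n (e k)) /\
    forall c, cech_cocycle t n c ->
      exists! a : 'rV[K]_N,
        cech_coboundary t n
          (fun I q => c I q - \sum_(k < N) scalar (a 0 k) *: e k I q).

Definition euler_charQ t (x : int) : Prop :=
  exists h : 'I_4 -> nat,
    (forall i : 'I_4, dimH t i (h i)) /\ x = \sum_(i < 4) (-1) ^+ i * (h i)%:Z.

(* m is m(sigma), the slope of the Hilbert polynomial chi(Q_sigma(t)). *)
Definition is_mult (m : int) : Prop :=
  exists c : int, forall t, euler_charQ t (m * t + c).

Definition linear_subst (A : 'M[K]_4) (h : R) : R :=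
  h \mPo [tuple \sum_(k < 4) A j k *: ('X_k : R) | j < 4].

Definition free_of (i : 'I_4) (h : R) : Prop :=
  forall m, m \in msupp h -> m i = 0%N.

Definition compressible : Prop :=
  exists2 A : 'M[K]_4, A \in unitmx & exists i,
    free_of i (linear_subst A f) /\ free_of i (linear_subst A g).

End JacobianSheaves.
End ProjectiveSpace.

(* Main.v *)
(** Let [J] be the Jacobian matrix over [R = K[x_0, .., x_3]], [S] its graded kernel
    and [N(t) = dim R_t].  By Serre vanishing [chi(Q(t))] is the dimension of
    [coker J] in degree [t] for large [t], so that
      [m t + c = N(df + t) + N(dg + t) - 4 N(t) + dim S_t].
    Normality makes the 2 x 2 minors of [J] coprime.  Hence, if [A] is the
    bivector of complementary minors and [s] an element of [S] of least degree
    [e], every [v] in [S] satisfies [s /\ v = p A] for some [p] in [R], and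
    [v |-> p] has kernel [R s]; the columns of [A] lie in [S], so [e <= d].
    Counting dimensions, [dim S_t <= N(t - e) + N(t + e - d)], that is
    [m <= m0 - e (d - e)].

    If [m = m0], then [e = 0] or [e = d].  In the case [e = d] the ideal [I] of
    the [p] above has bounded codimension in every degree, so it contains a
    nonzero binary form in each pair of variables.  As no nonzero class modulo
    [I] is killed by a regular sequence of three linear forms, splitting the
    binary forms into linear factors gives [1] in [I]: there is [v] in [S] with
    [s /\ v = A], and its component of degree [0] shows [e = 0].

    A section of degree [0] is a constant vector annihilating the gradients of
    [f] and [g], which is compressibility; completing it by a column of [A]
    splits the sheaf. *)

Require Import Defs.
From HB Require Import structures.
From mathcomp Require Import all_boot all_order all_algebra.
From mathcomp Require Import fraction.
From mathcomp.multinomials Require Import mpoly.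
From mathcomp Require classical_sets.
From mathcomp Require Import boolp ring zify.

Set Implicit Arguments.
Unset Strict Implicit.
Unset Printing Implicit Defensive.

Import Order.TTheory GRing.Theory Num.Theory.
Local Open Scope ring_scope.

(** Germs live at homogeneous primes, and a section of the cokernel is only a family of germs, so
    graded algebra is reached through the projective Nullstellensatz [point_avoiding]: homogeneous
    elements whose common zeros all lie on [y = 0] generate an ideal containing a power of [y]. It
    yields finite subcovers, common denominators and partitions of unity. Serre vanishing is proved
    by shifting dimensions along syzygies, down to line bundles, whose Cech complexes are contracted
    one multidegree at a time. The number [m0] comes from the shifts [df], [dg], [- e], [e - d] of
    four Hilbert functions: they sum to zero, so only their squares enter the slope. Behind the case
    [e = d] is the fact that the zero scheme of such a section of a reflexive sheaf of rank 2 has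
    pure codimension 2, while equality of slopes makes it finite, hence empty. Both halves are made
    elementary: purity becomes the statement on three linear forms, and finiteness becomes a count,
    as the binary forms of degree [b] fill a space of dimension [b + 1], which outgrows any bounded
    codimension. *)

(** Induction on the number of coordinates: witnesses [B] for the first [n] coordinates serve every
    element whose last coordinate is at least the maximum [k] over [B], and each of the [k] slices
    below it has finitely many witnesses of its own. *)
Lemma dickson (T : eqType) (c : nat -> T -> nat) n (L : T -> Prop) :
  exists2 B : seq T, (forall b, b \in B -> L b) &
  forall m, L m -> exists2 b, b \in B &
    forall i, (i < n)%N -> (c i b <= c i m)%N.
Proof.
elim: n L => [|n IHn] L.
  have [[x Lx]|nL] := EM (exists x, L x).
    by exists [:: x] => [b|m _]; [rewrite inE => /eqP-> | exists x; rewrite ?inE].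
  by exists [::] => // m Lm; case: nL; exists m.
have [B LB hB] := IHn L.
pose k := (\max_(b <- B) c n b)%N.
have /choice[E hE] : forall j, exists B' : seq T,
    (forall b, b \in B' -> L b /\ c n b = j) /\
    forall m, L m /\ c n m = j -> exists2 b, b \in B' &
      forall i, (i < n)%N -> (c i b <= c i m)%N.
  by move=> j; have [B' h1 h2] := IHn (fun x => L x /\ c n x = j); exists B'.
exists (B ++ flatten [seq E j | j <- iota 0 k]) => [b|m Lm].
  rewrite mem_cat => /orP[/LB//|/flattenP[s /mapP[j _ ->]]].
  by case: (hE j) => h _ /h[].
have [lek|ltk] := leqP k (c n m).
  have [b bB hb] := hB m Lm; exists b; first by rewrite mem_cat bB.
  move=> i; rewrite ltnS leq_eqVlt => /predU1P[->|/hb//].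
  by apply: leq_trans lek; apply: leq_bigmax_seq.
have [_ /(_ m (conj Lm erefl))[b bE hb]] := hE (c n m).
exists b.
  rewrite mem_cat; apply/orP; right; apply/flattenP; exists (E (c n m)) => //.
  by apply/mapP; exists (c n m); rewrite ?mem_iota.
move=> i; rewrite ltnS leq_eqVlt => /predU1P[->|/hb//].
by have [/(_ b bE)[_ ->]] := hE (c n m).
Qed.

Inductive rspan (A : pzRingType) (V : lmodType A) (X : V -> Prop) : V -> Prop :=
| rspan0 : rspan X 0
| rspanZD a x v : X x -> rspan X v -> rspan X (a *: x + v).

Definition lspan (A : pzRingType) (V : lmodType A) (B : seq V) :=
  rspan (fun x => x \in B).

(** * Noetherianity of polynomial modules *)

Section Span.
Variables (A : pzRingType) (V : lmodType A).
Implicit Types (X Y : V -> Prop) (u v : V).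

Lemma rspan_gen X v : X v -> rspan X v.
Proof. by move=> Xv; rewrite -[v]addr0 -{1}[v]scale1r; apply: rspanZD (rspan0 _). Qed.

Lemma rspanD X u v : rspan X u -> rspan X v -> rspan X (u + v).
Proof.
by elim=> [|a x w Xx _ IH] Xv; rewrite ?add0r // -addrA; apply: rspanZD (IH Xv).
Qed.

Lemma rspanZ X a v : rspan X v -> rspan X (a *: v).
Proof.
elim=> [|b x w Xx _ IH]; first by rewrite scaler0; apply: rspan0.
by rewrite scalerDr scalerA; apply: rspanZD.
Qed.

Lemma rspan_trans X Y v : (forall x, X x -> rspan Y x) -> rspan X v -> rspan Y v.
Proof.
move=> XY; elim=> [|a x w /XY Yx _ IH]; first exact: rspan0.
by apply: rspanD IH; apply: rspanZ.
Qed.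

Lemma rspan_fin X v : rspan X v ->
  exists2 B : seq V, (forall b, b \in B -> X b) & lspan B v.
Proof.
elim=> [|a x w Xx _ [B XB Bw]]; first by exists [::] => //; apply: rspan0.
exists (x :: B) => [b|]; first by rewrite inE => /predU1P[->|/XB].
apply: rspanZD; first by rewrite /= inE eqxx.
by apply: rspan_trans Bw => y yB; apply: rspan_gen; rewrite inE yB orbT.
Qed.

Lemma rspan_seq (B : seq V) v :
  lspan B v -> exists c : 'I_(size B) -> A, v = \sum_i c i *: B`_i.
Proof.
elim=> [|a x w xB _ [c ->]].
  by exists (fun=> 0); rewrite big1 // => i _; rewrite scale0r.
have iB : (index x B < size B)%N by rewrite index_mem.
exists (fun i => c i + (if i == Ordinal iB then a else 0)).
rewrite [RHS](eq_bigr (fun i => c i *: B`_i +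
    (if i == Ordinal iB then a else 0) *: B`_i)); last first.
  by move=> i _; rewrite /= scalerDl.
rewrite big_split /= addrC; congr (_ + _).
rewrite (bigD1 (Ordinal iB)) //= eqxx nth_index // big1 ?addr0 // => i.
by move/negPf ->; rewrite scale0r.
Qed.

End Span.

Section Noetherian.
Variables (K : fieldType) (n r : nat).
Local Notation R := {mpoly K[n]}.
Implicit Types G X : 'cV[R]_r -> Prop.

(* The witnesses of Dickson's lemma for the leading monomials of the first
   nonzero entries generate G. *)
Lemma submodule_fg G :
  (forall u v, G u -> G v -> G (u + v)) -> (forall a v, G v -> G (a *: v)) ->
  exists2 B : seq 'cV[R]_r, (forall b, b \in B -> G b) &
    forall v, G v -> lspan B v.
Proof.
move=> GD GZ.
pose first (i : 'I_r) (v : 'cV[R]_r) := [/\ G v, forall k : 'I_r, (k < i)%N -> v k 0 = 0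
  & v i 0 != 0].
have /choice[E hE] : forall i : 'I_r, exists B : seq 'cV[R]_r,
    (forall b, b \in B -> first i b) /\
    forall m, first i m -> exists2 b : 'cV[R]_r, b \in B &
    forall j, (j < n)%N ->
      (nth 0 (mlead (b i ord0)) j <= nth 0 (mlead (m i ord0)) j)%N.
  move=> i; have [B h1 h2] := dickson
    (fun j (v : 'cV[R]_r) => nth 0%N (mlead (v i ord0)) j) n (first i).
  by exists B.
pose B := flatten [seq E i | i <- enum 'I_r].
have EB i v : v \in E i -> v \in B.
  by move=> vE; apply/flattenP; exists (E i) => //; apply: map_f; rewrite mem_enum.
exists B => [b /flattenP[s /mapP[i _ ->]]|].
  by case: (hE i) => h _ /h[].
have GB u v : G u -> G v -> G (u - v).
  by move=> Gu Gv; rewrite -scaleN1r; apply: GD => //; apply: GZ.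
(* The induction runs over the number [k] of trailing entries that may be nonzero. *)
suff main k v : (k <= r)%N -> G v ->
    (forall i : 'I_r, (i < r - k)%N -> v i 0 = 0) -> lspan B v.
  by move=> v Gv; apply: (main r) => // i; rewrite subnn.
elim: k v => [|k IHk] v lekr Gv v0.
  suff -> : v = 0 by apply: rspan0.
  by apply/matrixP => i j; rewrite ord1 mxE v0 // subn0.
have ir : (r - k.+1 < r)%N by rewrite ltn_subrL; case: (r) lekr.
pose i := Ordinal ir.
have step w : G w -> (forall j : 'I_r, (j < i)%N -> w j 0 = 0) ->
    w i 0 = 0 -> lspan B w.
  move=> Gw w0 wi0; apply: IHk (ltnW lekr) Gw _ => j; rewrite -subSS subSn //.
  rewrite ltnS leq_eqVlt => /predU1P[eji|/w0//].
  by rewrite (_ : j = i) //; apply: val_inj.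
suff H m w : G w -> (forall j : 'I_r, (j < i)%N -> w j 0 = 0) ->
    mlead (w i 0) = m -> lspan B w by apply: (H (mlead (v i 0)) v).
elim/(well_founded_ind (@ltom_wf n)): m w => m0 IHm {}v {}Gv {}v0 vm0.
have [vi0|vi0] := eqVneq (v i 0) 0; first exact: step.
have [hE1 /(_ v)[//|b bE hb]] := hE i.
have [Gb b0 bi0] := hE1 b bE.
pose p := v i 0; pose q := b i 0.
have le_qp : (mlead q <= mlead p)%MM.
  by apply/mnm_lepP => j; rewrite !(mnm_nth 0%N); apply: hb.
(* Multiplier of a Groebner reduction step: [c *: b] cancels the leading term of the entry [i] of
   [v]. *)
pose c : R := (mleadc p / mleadc q) *: 'X_[mlead p - mlead q].
rewrite -[v](subrK (c *: b)) addrC.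
apply: rspanZD; first exact: EB bE.
set w := v - _.
have Gw : G w by apply: GB => //; apply: GZ.
have w0 (j : 'I_r) : (j < i)%N -> w j 0 = 0.
  by move=> ji; rewrite !mxE v0 // b0 // mulr0 subr0.
have [wi0|wi0] := eqVneq (w i 0) 0; first exact: step.
have c0 : mleadc p / mleadc q != 0.
  by rewrite mulf_neq0 // ?invr_neq0 // mleadc_eq0.
have cn0 : c != 0 by rewrite -mleadc_eq0 mleadcZE mulf_neq0 // mleadXm mcoeffX eqxx oner_neq0.
have mcb : mlead (c * q) = mlead p.
  by rewrite mleadM // mleadZ // mleadXm submK.
have wE : w i 0 = p - c * q by rewrite !mxE.
apply: (IHm (mlead (w i 0))) => //; rewrite -vm0 lt_neqAle.
apply/andP; split; last first.
  by rewrite wE; apply: le_trans (mleadB_le _ _) _; rewrite mcb joinxx.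
apply: contra_neq wi0 => E1; apply/eqP; rewrite -mleadc_eq0 E1 wE mcoeffB.
rewrite -{2}mcb mleadM // mleadcM mleadcZE mleadXm mcoeffX eqxx mulr1.
rewrite divfK ?subrr //.
by rewrite mleadc_eq0.
Qed.

(** Each of the finitely many generators of the span of [X] involves finitely many elements of [X].
    Taking the generators from [X] itself is what later makes them homogeneous. *)
Lemma subset_fg X : exists2 B : seq 'cV[R]_r, (forall b, b \in B -> X b) &
  forall v, X v -> lspan B v.
Proof.
have [B0 h1 h2] := @submodule_fg (rspan X) (@rspanD _ _ X) (@rspanZ _ _ X).
have [E hE] : {E : 'cV[R]_r -> seq 'cV[R]_r & forall b, b \in B0 ->
    (forall x, x \in E b -> X x) /\ lspan (E b) b}.
  suff /choice : forall b, exists E : seq 'cV[R]_r, b \in B0 ->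
    (forall x, x \in E -> X x) /\ lspan E b by [].
  move=> b; have [bB|_] := boolP (b \in B0); last by exists [::].
  by have [E] := rspan_fin (h1 b bB); exists E.
exists (flatten [seq E b | b <- B0]) => [b /flattenP[s /mapP[b0 b0B ->]]|v Xv].
  by have [h _] := hE _ b0B; apply: h.
apply: rspan_trans (h2 v (rspan_gen Xv)) => b bB.
have [_] := hE b bB; apply: rspan_trans => x xE; apply: rspan_gen.
by apply/flattenP; exists (E b) => //; apply: map_f.
Qed.

End Noetherian.

(** * Unique factorization *)

Section Factorial.
Variable D : idomainType.
Implicit Types a b c p : D.

Definition divides a b := exists c, b = c * a.

Definition prime_elt p := [/\ p != 0, p \isn't a GRing.unit
  & forall a b, divides p (a * b) -> divides p a \/ divides p b].

(** Asking for prime rather than irreducible factors builds uniqueness into the definition. *)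
Definition factorial_domain := forall a, a != 0 -> exists u s,
  [/\ u \is a GRing.unit, forall p, p \in s -> prime_elt p
    & a = u * \prod_(p <- s) p].

Lemma divides0 a : divides a 0.
Proof. by exists 0; rewrite mul0r. Qed.

Lemma dividesM a b c : divides a b -> divides a (c * b).
Proof. by move=> [x ->]; exists (c * x); rewrite mulrA. Qed.

Lemma dividesD a b c : divides a b -> divides a c -> divides a (b + c).
Proof. by move=> [x ->] [y ->]; exists (x + y); rewrite mulrDl. Qed.

Lemma dividesB a b c : divides a b -> divides a c -> divides a (b - c).
Proof. by move=> [x ->] [y ->]; exists (x - y); rewrite mulrBl. Qed.

Lemma divides_sum a (I : finType) (P : pred I) (F : I -> D) :
  (forall i, P i -> divides a (F i)) -> divides a (\sum_(i | P i) F i).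
Proof.
move=> h; apply: (big_ind (divides a)) => //; first exact: divides0.
by move=> x y; apply: dividesD.
Qed.

Lemma divides_trans a b c : divides a b -> divides b c -> divides a c.
Proof. by move=> ab [x ->]; apply: dividesM. Qed.

Definition coprime_family (I : Type) (w : I -> D) :=
  forall p, prime_elt p -> exists i, ~ divides p (w i).

(** The prime factors of [b] are cancelled one at a time: each fails to divide some [w i], hence
    divides [a]. *)
Lemma divides_coprime_family (I : Type) (w : I -> D) a b :
  factorial_domain -> coprime_family w -> b != 0 ->
  (forall i, divides b (a * w i)) -> divides b a.
Proof.
move=> facD cow b0; have [u [s [uu ps ->]]] := facD b b0.
elim: s ps a => [|p s IHs] ps a h.
  by rewrite big_nil mulr1; exists (a / u); rewrite divrK.
have pp : prime_elt p by apply: ps; rewrite inE eqxx.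
have [p0 pu pM] := pp; have [i npw] := cow p pp.
have [[a' aE]|//] : divides p a \/ divides p (w i).
  apply: pM; apply: divides_trans (h i).
  by exists (u * \prod_(j <- s) j); rewrite big_cons mulrCA mulrC.
have [|x xE] := IHs (fun q qs => ps q (mem_behead (s := p :: s) qs)) a'.
  move=> j; have [x] := h j; rewrite aE big_cons => E; exists x.
  by apply: (mulIf p0); rewrite mulrAC E; ring.
by exists x; rewrite aE xE big_cons; ring.
Qed.

End Factorial.

(** * Gauss's lemma and factoriality of polynomial rings *)

Section GaussLemma.
Variable D : idomainType.
Hypothesis facD : factorial_domain D.
Local Notation P := {poly D}.
Implicit Types (f g h r : P) (a c p : D).

Let primitive f := forall p, prime_elt p -> ~ divides p%:P f.

Lemma divides_polyC p f : divides p%:P f <-> forall i, divides p f`_i.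
Proof.
split=> [[g ->] i|/choice[c hc]].
  by rewrite coefMC; exists g`_i.
exists (\poly_(i < size f) c i); apply/polyP => i.
rewrite coefMC coef_poly; case: ltnP => [_|hi]; first exact: hc.
by rewrite nth_default // mul0r.
Qed.

(** If [p] divides neither factor, let [i] and [j] be the indices of their first coefficients not
    divisible by [p]: in the coefficient of degree [i + j] of the product all terms but one are
    divisible. *)
Lemma prime_polyC p : prime_elt p -> prime_elt p%:P.
Proof.
move=> [p0 pu pM]; split; first by rewrite polyC_eq0.
  by rewrite poly_unitE coefC /= negb_and pu orbT.
move=> f g dfg; have [|nf] := EM (divides p%:P f); first by left.
have [|ng] := EM (divides p%:P g); first by right.
have ex h : ~ divides p%:P h -> exists i, `[< ~ divides p h`_i >].
  move=> nh; apply: contrapT => H; apply: nh; apply/divides_polyC => i.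
  by apply: contrapT => Hi; apply: H; exists i; apply/asboolP.
have [i /asboolP fi mi] := ex_minnP (ex f nf).
have [j /asboolP gj mj] := ex_minnP (ex g ng).
have lti k : (k < i)%N -> divides p f`_k.
  by move=> ki; apply: contrapT => /asboolP/mi; rewrite leqNgt ki.
have ltj k : (k < j)%N -> divides p g`_k.
  by move=> kj; apply: contrapT => /asboolP/mj; rewrite leqNgt kj.
have ij : (i < (i + j).+1)%N by rewrite ltnS leq_addr.
have /divides_polyC/(_ (i + j)%N) := dfg.
rewrite coefM (bigD1 (Ordinal ij)) //= addKn => dsum.
suff : divides p (f`_i * g`_j) by move/pM => [].
rewrite -[_ * _](addrK (\sum_(k < (i + j).+1 | k != Ordinal ij)
  f`_k * g`_(i + j - k))).
apply: dividesB dsum _; apply: divides_sum => k ki.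
have [lt|ge] := ltnP k i; first by rewrite mulrC; apply/dividesM/lti.
apply/dividesM/ltj; have : (i < k)%N by rewrite ltn_neqAle ge eq_sym andbT.
by case: k {ki ge} => k /= hk; lia.
Qed.

(** The prime factors of [a] stay prime as constants and, [r] being primitive, each of them divides
    the cofactor of [r]. *)
Lemma primitive_dividesM r a f :
  primitive r -> a != 0 -> divides r (a%:P * f) -> divides r f.
Proof.
move=> pr a0; have [u [s [uu ps ->]]] := facD a0.
elim: s ps f => [|p s IHs] ps f.
  rewrite big_nil mulr1 => -[q E]; exists ((u^-1)%:P * q).
  by rewrite -mulrA -E mulrA -polyCM mulVr // mul1r.
have pp : prime_elt p by apply: ps; rewrite inE eqxx.
have [p0 _ pM] := prime_polyC pp.
rewrite big_cons mulrCA polyCM -mulrA => -[q E].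
have [|[q' qE]|/(pr p pp)//] := pM q r.
  by exists ((u * \prod_(j <- s) j)%:P * f); rewrite -E mulrC.
apply: IHs => [q0 q0s|]; first by apply: ps; rewrite inE q0s orbT.
exists q'; apply: (mulfI p0); rewrite E qE; rewrite mulrA; congr (_ * _).
exact: mulrC.
Qed.

(** Induction on the number of prime factors of the leading coefficient: a prime dividing [f] is
    associate to one of them, and division by it removes that factor. *)
Lemma primitive_part f : f != 0 ->
  exists a g, [/\ a != 0, primitive g & f = a%:P * g].
Proof.
move=> f0; have l0 : lead_coef f != 0 by rewrite lead_coef_eq0.
have [u [s [uu ps lE]]] := facD l0.
have [n] := ubnP (size s); elim: n => // n IHn in f f0 u s uu ps lE l0 *.
rewrite ltnS => sn.
have [pf|] := EM (primitive f).
  by exists 1, f; rewrite oner_neq0 polyC1 mul1r.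
move=> /existsNP[p /not_implyP[pp /contrapT[g fE]]].
have [p0 pu pM] := pp.
have g0 : g != 0 by apply: contra_neq f0 => g0; rewrite fE g0 mul0r.
have lcE : lead_coef f = p * lead_coef g by rewrite fE lead_coefM lead_coefC mulrC.
have lg0 : lead_coef g != 0 by rewrite lead_coef_eq0.
have : divides p (\prod_(q <- s) q).
  have : divides p (u * \prod_(q <- s) q) by exists (lead_coef g); rewrite -lE lcE mulrC.
  move/pM => [[v uE]|//]; case/negP: pu.
  by move: uu; rewrite uE unitrM => /andP[].
move=> dps.
have [q [qs dpq]] : exists q, q \in s /\ divides p q.
  elim: (s) dps => [|q s' IH].
    by rewrite big_nil => -[v] E; case/negP: pu; apply/unitrP; exists v; rewrite [p * v]mulrC -E.
  rewrite big_cons => /pM[dq|/IH[q' [q's dq']]].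
    by exists q; rewrite inE eqxx.
  by exists q'; rewrite inE q's orbT.
have [v qE] := dpq; have [q0 qu qM] := ps q qs.
have vu : v \is a GRing.unit.
  have : divides q (v * p) by exists 1; rewrite mul1r.
  case/qM=> [[w vE]|[w pE]].
    exfalso; case/negP: pu; apply/unitrP; exists w.
    have v0 : v != 0 by apply: contra_neq q0 => v0; rewrite qE v0 mul0r.
    suff E : w * p = 1 by rewrite [p * w]mulrC.
    by apply: (mulIf v0); rewrite mul1r [RHS]vE qE [v * p]mulrC mulrA.
  apply/unitrP; exists w; suff E : w * v = 1 by rewrite [v * w]mulrC.
  by apply: (mulIf p0); rewrite mul1r [RHS]pE qE mulrA.
have lgE : lead_coef g = (u * v) * \prod_(j <- rem q s) j.
  apply: (mulfI p0); rewrite -lcE lE (big_rem q) //= qE.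
  by rewrite !mulrA; congr (_ * _); rewrite [p * u]mulrC -!mulrA [p * v]mulrC.
have uvu : u * v \is a GRing.unit by rewrite unitrM uu vu.
have ps' j : j \in rem q s -> prime_elt j by move/mem_rem/ps.
have sn' : (size (rem q s) < n)%N.
  by rewrite size_rem //; apply: leq_trans sn; case: (s) qs.
have [a [h [a0 ph gE]]] := IHn g g0 (u * v) (rem q s) uvu ps' lgE lg0 sn'.
exists (a * p), h; rewrite mulf_neq0 //; split=> //.
by rewrite fE gE polyCM mulrAC.
Qed.

Lemma primitive_divides f g : primitive f -> divides g f -> primitive g.
Proof. by move=> pf gf p pp pg; apply: (pf p pp); apply: divides_trans gf. Qed.

Lemma primitive_const a : a != 0 -> primitive a%:P -> a \is a GRing.unit.
Proof.
move=> a0 pa; have [u [[|p s] [uu ps aE]]] := facD a0.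
  by rewrite aE big_nil mulr1.
case: (pa p); first by apply: ps; rewrite inE eqxx.
exists (u * \prod_(j <- s) j)%:P; rewrite -polyCM aE big_cons mulrCA.
by congr (_%:P); rewrite mulrC.
Qed.

(* A nonzero element of least degree in the ideal (f, g), made primitive,
   divides both f and g. *)
Lemma irreducible_primitive_prime f : primitive f -> (1 < size f)%N ->
  (forall g h, f = g * h -> (size g <= 1)%N \/ (size h <= 1)%N) -> prime_elt f.
Proof.
move=> pf sf irr; have f0 : f != 0 by rewrite -size_poly_gt0 ltnW.
split=> //; first by rewrite poly_unitE gtn_eqF.
move=> g h dfgh.
pose J (x : P) := exists a b : P, x = a * f + b * g.
have JM (c x : P) : J x -> J (c * x).
  by move=> [a [b ->]]; exists (c * a), (c * b); rewrite mulrDr !mulrA.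
have JB x y : J x -> J y -> J (x - y).
  move=> [a [b ->]] [a' [b' ->]]; exists (a - a'), (b - b').
  by rewrite !mulrBl addrACA opprD.
have exn : exists n, `[< exists r, [/\ J r, r != 0 & size r = n] >].
  exists (size f); apply/asboolP; exists f; split=> //.
  by exists 1, 0; rewrite mul1r mul0r addr0.
have [n /asboolP[r [Jr r0 sr]] nmin] := ex_minnP exn.
have [c [r1 [c0 pr1 rE]]] := primitive_part r0.
(* Pseudo-division by [r] introduces the constant [k], which is cancelled because [r1] is
   primitive. *)
have r1J x : J x -> divides r1 x.
  move=> Jx; have := Pdiv.Idomain.divp_eq x r.
  set k := lead_coef r ^+ _ => E.
  have k0 : k != 0 by rewrite expf_neq0 // lead_coef_eq0.
  have m0 : x %% r = 0.
    apply/eqP/contraT => m0; suff : (n <= size (x %% r)%R)%N.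
      by rewrite -sr leqNgt ltn_modp r0.
    apply: nmin; apply/asboolP; exists (x %% r); split=> //.
    rewrite -[x %% r](addKr (x %/ r * r)) -E addrC -mul_polyC.
    by apply: JB; apply: JM.
  apply: (@primitive_dividesM _ k) => //.
  rewrite mul_polyC E m0 addr0 {2}rE; exists (x %/ r * c%:P).
  by rewrite mulrA.
have [h1 fE] : divides r1 f by apply: r1J; exists 1, 0; rewrite mul1r mul0r addr0.
have dg : divides r1 g by apply: r1J; exists 0, 1; rewrite mul1r mul0r add0r.
(* By irreducibility one factor of [f = h1 * r1] is constant. If it is [h1], it is a unit and [f]
   divides [g]; if it is [r1], the ideal contains a nonzero constant, so [f] divides a constant
   multiple of [h]. *)
have [/size1_polyC h1E|/size1_polyC r1E] := irr _ _ fE.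
  left; apply: divides_trans dg.
  have hn0 : h1`_0 != 0.
    by apply: contra_neq f0 => E; rewrite fE h1E E mul0r.
  have hu : h1`_0 \is a GRing.unit.
    apply: primitive_const hn0 _; rewrite -h1E; apply: primitive_divides pf _.
    by exists r1; rewrite mulrC.
  exists (h1`_0)^-1%:P; rewrite fE {2}h1E mulrA -polyCM mulVr // mul1r //.
right; have [a [b rJ]] := Jr.
have e0 : c * r1`_0 != 0.
  by apply: contra_neq r0 => E; rewrite rE r1E -polyCM E.
apply: (@primitive_dividesM _ (c * r1`_0)) => //.
rewrite polyCM -r1E -rE rJ mulrDl; apply: dividesD.
  by exists (a * h); rewrite mulrAC.
by rewrite -mulrA; apply: dividesM.
Qed.

Lemma factorial_poly : factorial_domain P.
Proof.
move=> f f0; have [a [g [a0 pg fE]]] := primitive_part f0.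
suff [u [s [uu ps gE]]] : exists u s, [/\ u \is a GRing.unit,
    forall p : P, p \in s -> prime_elt p & g = u * \prod_(p <- s) p].
  have [u' [s' [uu' ps' aE]]] := facD a0.
  exists (u'%:P * u), ([seq p%:P | p <- s'] ++ s); split.
  - by rewrite unitrM uu andbT; apply: (rmorph_unit (@polyC D)).
  - by move=> p; rewrite mem_cat => /orP[/mapP[q /ps' qp ->]|/ps//]; apply: prime_polyC.
  - by rewrite fE gE aE big_cat big_map /= polyCM rmorph_prod /= mulrACA.
have g0 : g != 0 by apply: contra_neq f0 => E; rewrite fE E mulr0.
have [n] := ubnP (size g); elim: n g pg g0 {f f0 a a0 fE} => // n IHn f pf f0.
rewrite ltnS => sf; have [s1|s1] := leqP (size f) 1.
  exists f, [::]; rewrite big_nil mulr1; split=> //.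
  have fE := size1_polyC s1; have c0 : f`_0 != 0.
    by apply: contra_neq f0 => E; rewrite fE E.
  rewrite poly_unitE (primitive_const c0) -?fE // andbT.
  by rewrite eqn_leq s1 size_poly_gt0.
have [[g [h [fE sg sh]]]|irr] := EM (exists g h,
    [/\ f = g * h, (1 < size g)%N & (1 < size h)%N]); last first.
  exists 1, [:: f]; rewrite unitr1 big_seq1 mul1r; split=> // p.
  rewrite inE => /eqP->; apply: irreducible_primitive_prime => // g h fE.
  have [|sg] := leqP (size g) 1; first by left.
  have [|sh] := leqP (size h) 1; first by right.
  by case: irr; exists g, h.
have g0 : g != 0 by rewrite -size_poly_gt0 ltnW.
have h0 : h != 0 by rewrite -size_poly_gt0 ltnW.
have sE : size f = (size g + size h).-1 by rewrite fE size_mul.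
have pg : primitive g by apply: primitive_divides pf _; exists h; rewrite mulrC.
have ph : primitive h by apply: primitive_divides pf _; exists g.
have [u [s [uu ps gE]]] := IHn g pg g0 ltac:(lia).
have [u' [s' [uu' ps' hE]]] := IHn h ph h0 ltac:(lia).
exists (u * u'), (s ++ s'); rewrite unitrM uu uu' big_cat fE gE hE mulrACA.
by split=> // p; rewrite mem_cat => /orP[/ps|/ps'].
Qed.

End GaussLemma.

(** Factoriality is a property of the multiplicative monoid, so a multiplicative bijection
    transports it. *)
Lemma factorial_bij (D D' : idomainType) (phi : D -> D') :
  phi 1 = 1 -> {morph phi : x y / x * y} ->
  injective phi -> (forall y, exists x, phi x = y) ->
  factorial_domain D' -> factorial_domain D.
Proof.
move=> phi1 phiM inj /choice[psi psiK] facD' a a0.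
have phi0 : phi 0 = 0.
  have /eqP := phiM 0 (psi 0); rewrite mul0r psiK mulr0.
  by move/eqP.
have [|u [s [uu ps E]]] := facD' (phi a).
  by apply: contra_neq a0 => E; apply: inj; rewrite E phi0.
exists (psi u), (map psi s); split.
- apply/unitrP; exists (psi u^-1); split; apply: inj; rewrite phiM !psiK.
    by rewrite mulVr.
  by rewrite mulrV.
- move=> _ /mapP[p /ps[p0 pu pM] ->].
  have div x y : divides (phi x) (phi y) -> divides x y.
    by move=> [c E']; exists (psi c); apply: inj; rewrite phiM psiK.
  split.
  + by apply: contra_neq p0 => E'; rewrite -[p]psiK E' phi0.
  + apply: contra pu => /unitrP[v [E1 E2]]; apply/unitrP; exists (phi v).
    by rewrite -[p]psiK -!phiM E1 E2.
  + move=> x y [c E']; rewrite -[p]psiK in pM.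
    have [|/div|/div] := pM (phi x) (phi y); [|by left|by right].
    by exists (phi c); rewrite -phiM E' phiM.
- apply: inj; rewrite E phiM psiK big_map (big_morph phi phiM phi1).
  by rewrite [in RHS](eq_bigr id) // => i _; rewrite psiK.
Qed.

Lemma muni_mwiden n (K : fieldType) (p : {mpoly K[n]}) : muni (mwiden p) = p%:P.
Proof.
rewrite [in LHS](mpolyE p) [in RHS](mpolyE p).
rewrite (raddf_sum (@mwiden n K)) (raddf_sum (@muni n K)) (raddf_sum (@polyC _)).
apply: eq_bigr => m _ /=.
rewrite mwidenZ mwidenX muniZ muniE msuppX big_seq1 mcoeffX eqxx scale1r.
rewrite mnmwiden_ordmax expr0 alg_polyC -mul_polyC -polyCM mul_mpolyC.
congr (_ *: _)%:P; congr 'X_[_]; apply/mnmP => i.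
by rewrite mnmE mnmwiden_widen.
Qed.

(** [muni] reads a polynomial as one in the last variable over the ring in the others; it is
    bijective, so induction on [n] reduces to one variable. *)
Lemma factorial_mpoly n (K : fieldType) : factorial_domain {mpoly K[n]}.
Proof.
elim: n => [|n IHn].
  move=> a a0; exists a, [::]; rewrite big_nil mulr1; split=> //.
  have aE := nvar0_mpolyC a; rewrite aE.
  apply: (rmorph_unit (@mpolyC 0 K)); rewrite unitfE.
  by apply: contra_neq a0 => E; rewrite aE E.
apply: (@factorial_bij _ _ (@muni n K) (muni1 n K) (@muniM n K)); last exact: factorial_poly.
  apply: raddf_inj => p p0; apply/mpolyP => m; rewrite mcoeff0.
  pose m' := [multinom m (widen_ord (leqnSn n) i) | i < n].
  have E : ((muni p)`_(m ord_max))@_m' = 0 by rewrite p0 coef0 mcoeff0.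
  rewrite -E muniE coef_sum (raddf_sum (mcoeff m')).
  rewrite [in LHS](mpolyE p) (raddf_sum (mcoeff m)); apply: eq_bigr => k _ /=.
  rewrite !mcoeffZ coefZ coefXn mcoeffX.
  case: (k =P m) => [->|ne]; first by rewrite !eqxx !mulr1 mcoeffZ mcoeffX eqxx mulr1.
  case: eqP => [e1|_]; last by rewrite !mulr0 mcoeff0.
  rewrite mulr1 mulr0 mcoeffZ mcoeffX; case: eqP => [e2|_]; last by rewrite mulr0.
  case: ne; apply/mnmP => i.
  have [j ->|->] := unliftP ord_max i => //.
  have := congr1 (fun f : 'X_{1..n} => f j) e2; rewrite !mnmE.
  by rewrite (_ : widen_ord _ _ = lift ord_max j) //; apply: val_inj; rewrite /= /bump leqNgt ltn_ord.
move=> q; exists (\sum_(i < size q) mwiden q`_i * 'X_ord_max ^+ i).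
rewrite rmorph_sum /= -[RHS](coefK q) poly_def; apply: eq_bigr => i _.
rewrite rmorphM rmorphXn /= muni_mwiden -mul_polyC; congr (_ * _ ^+ _).
rewrite muniE msuppX big_seq1 mcoeffX eqxx scale1r mnm1E eqxx expr1.
suff -> : [multinom (U_(ord_max) (widen_ord (leqnSn n) i0))%MM | i0 < n] = 0%MM :> 'X_{1..n}.
  by rewrite mpolyX0 scale1r.
by apply/mnmP => j; rewrite mnmE mnm1E mnm0E eqE /= gtn_eqF.
Qed.

(** * Homogeneous polynomials and points of projective space *)

Section Homogeneous.
Variable K : fieldType.
Local Notation R := {mpoly K[4]}.
Local Notation F := {fraction {mpoly K[4]}}.
Implicit Types (p q a b c h : R) (n k l t : int).

(** Degrees are integers, so that twists and differences of degrees can be used freely; zero is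
    homogeneous of every degree, and alone so in negative ones. *)
Definition homZ n p := all (fun m : 'X_{1..4} => (mdeg m)%:Z == n) (msupp p).

Lemma homZP n p :
  reflect (forall m, m \in msupp p -> (mdeg m)%:Z = n) (homZ n p).
Proof. by apply: (iffP allP) => h m /h /eqP. Qed.

Arguments homZP {n p}.

Lemma homZ_nat (k : nat) p : homZ k%:Z p = (p \is k.-homog).
Proof. by rewrite dhomogE; apply: eq_all => m; rewrite /= eqz_nat. Qed.

Lemma homZ0 n : homZ n 0.
Proof. by rewrite /homZ msupp0. Qed.

Lemma homZD n p q : homZ n p -> homZ n q -> homZ n (p + q).
Proof.
move=> /homZP hp /homZP hq; apply/homZP => m /msuppD_le.
by rewrite mem_cat => /orP[/hp|/hq].
Qed.

Lemma homZM n k p q : homZ n p -> homZ k q -> homZ (n + k) (p * q).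
Proof.
move=> /homZP hp /homZP hq; apply/homZP => m /msuppM_le/allpairsP.
by move=> [[m1 m2] /= [/hp <- /hq <- ->]]; rewrite mdegD PoszD.
Qed.

Lemma homZZ n (c : K) p : homZ n p -> homZ n (c *: p).
Proof. by move=> /homZP hp; apply/homZP => m /msuppZ_le/hp. Qed.

Lemma homZN n p : homZ n p -> homZ n (- p).
Proof. by rewrite -scaleN1r; apply: homZZ. Qed.

Lemma homZB n p q : homZ n p -> homZ n q -> homZ n (p - q).
Proof. by move=> hp hq; apply/homZD/homZN. Qed.

Lemma homZ1 : homZ 0 1.
Proof. by rewrite /homZ msupp1 /= mdeg0 eqxx. Qed.

Lemma homZ_var i : homZ 1 'X_i.
Proof. by rewrite /homZ msuppX /= mdeg1 eqxx. Qed.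

Lemma homZX n p (k : nat) : homZ n p -> homZ (n * k%:Z) (p ^+ k).
Proof.
move=> hp; elim: k => [|k IH]; first by rewrite expr0 mulr0; apply: homZ1.
by rewrite exprS (_ : n * k.+1%:Z = n + n * k%:Z); [apply: homZM | lia].
Qed.

Lemma homZ_sum n (I : finType) (P : pred I) (G : I -> R) :
  (forall i, P i -> homZ n (G i)) -> homZ n (\sum_(i | P i) G i).
Proof.
move=> h; apply: (big_ind (homZ n)) => //; first exact: homZ0.
by move=> x y; apply: homZD.
Qed.

Lemma homZ_prod_var (I : {set 'I_4}) : homZ #|I|%:Z (\prod_(i in I) 'X_i).
Proof.
rewrite -sum1_card; elim/big_rec2: _ => [|i n p _ IH]; first exact: homZ1.
by rewrite PoszD; apply: homZM (homZ_var i) IH.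
Qed.

Lemma homZ_uniq n k p : p != 0 -> homZ n p -> homZ k p -> n = k.
Proof.
move=> p0 /homZP hn /homZP hk.
by rewrite -(hn _ (mlead_supp p0)) (hk _ (mlead_supp p0)).
Qed.

Lemma homZ_neg n p : n < 0 -> homZ n p -> p = 0.
Proof.
move=> n0 /homZP hp; apply/eqP/contraT => p0.
by have := hp _ (mlead_supp p0); lia.
Qed.

Lemma homZ_const p : homZ 0 p -> p = (p@_0)%:MP.
Proof.
move=> /homZP hp; apply/mpolyP => m; rewrite mcoeffC.
case: (m =P 0%MM) => [->|m0]; first by rewrite mulr1.
rewrite mulr0; apply: memN_msupp_eq0; apply: contra_notN m0 => /hp [] /eqP.
by rewrite mdeg_eq0 => /eqP.
Qed.

Definition piZ n p : R := if n is Posz k then pihomog mdeg k p else 0.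

Lemma piZD n p q : piZ n (p + q) = piZ n p + piZ n q.
Proof. by case: n => k; rewrite /piZ ?pihomogD ?addr0. Qed.

Lemma piZ0 n : piZ n 0 = 0.
Proof. by case: n => k; rewrite /piZ ?pihomog0. Qed.

Lemma piZ_sum n (I : finType) (P : pred I) (G : I -> R) :
  piZ n (\sum_(i | P i) G i) = \sum_(i | P i) piZ n (G i).
Proof. exact: (big_morph _ (piZD n) (piZ0 n)). Qed.

Lemma homZ_piZ n p : homZ n (piZ n p).
Proof. by case: n => k /=; [rewrite homZ_nat pihomogP | apply: homZ0]. Qed.

Lemma piZ_hom n k p : homZ k p -> piZ n p = if k == n then p else 0.
Proof.
case: k => [k|k] hk; last first.
  by rewrite (homZ_neg _ hk) // piZ0 if_same.
case: n => n //=; rewrite eqz_nat; rewrite homZ_nat in hk.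
case: eqVneq => [<-|ne]; first exact: pihomog_dE.
by rewrite (pihomog_ne0 _ hk).
Qed.

Lemma piZ_id n p : homZ n p -> piZ n p = p.
Proof. by move/(piZ_hom n) ->; rewrite eqxx. Qed.

Lemma piZ_decomp p : exists N : nat, p = \sum_(d < N) piZ d%:Z p.
Proof. by exists (msize p); apply: pihomog_partitionE. Qed.

Lemma piZM n k a p : homZ k a -> piZ (k + n) (a * p) = a * piZ n p.
Proof.
move=> ha; have [N pE] := piZ_decomp p; rewrite [in RHS]pE [in LHS]pE.
rewrite mulr_sumr !piZ_sum mulr_sumr; apply: eq_bigr => d _.
rewrite (piZ_hom _ (homZM ha (homZ_piZ d p))) (piZ_hom _ (homZ_piZ d p)).
by rewrite (can_eq (addKr k)); case: ifP; rewrite ?mulr0.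
Qed.

Lemma homZ_divl n k a p : a != 0 -> homZ k a -> homZ (k + n) (a * p) -> homZ n p.
Proof.
move=> a0 ha hap; have := piZM n p ha; rewrite (piZ_id hap) => /(mulfI a0) ->.
exact: homZ_piZ.
Qed.

Lemma pihomogM (N : nat) p q : pihomog mdeg N (p * q) =
  \sum_(i < N.+1) pihomog mdeg i p * pihomog mdeg (N - i)%N q.
Proof.
have [M pE] : exists M, p = \sum_(d < N.+1 + M) piZ d%:Z p.
  by exists (msize p); apply: pihomog_partitionE; rewrite leq_addl.
rewrite -[LHS]/(piZ N (p * q)) [in LHS]pE mulr_suml piZ_sum.
rewrite (eq_bigr (fun d : 'I_(N.+1 + M) =>
    piZ d%:Z p * piZ (N%:Z - d%:Z) q)); last first.
  by move=> d _; rewrite -(piZM _ q (homZ_piZ d p)) addrCA subrr addr0.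
rewrite big_split_ord /= [X in _ + X]big1 ?addr0 => [|d _].
  apply: eq_bigr => d _; rewrite /= -[in LHS]/(piZ (N%:Z - d%:Z) q) subzn //.
  by rewrite -ltnS.
rewrite -[X in _ * X]/(piZ (N%:Z - (N.+1 + d)%N%:Z) q).
by rewrite (homZ_neg _ (homZ_piZ _ _)) ?mulr0 //; lia.
Qed.

(** The lowest components of [p] and [q] have a nonzero product, and so do their leading monomials.
    Both products have degree [n], which forces the lowest and the highest degree of [p] to
    agree. *)
Lemma homZ_factor n p q : p * q != 0 -> homZ n (p * q) -> exists k, homZ k p.
Proof.
move=> pq0 hpq; have := pq0; rewrite mulf_eq0 negb_or => /andP[p0 q0].
have low (r : R) : r != 0 -> exists i : nat, pihomog mdeg i r != 0 /\
    forall j : nat, (j < i)%N -> pihomog mdeg j r = 0.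
  move=> r0; have ex : exists i, pihomog mdeg i r != 0.
    apply: contrapT => /forallNP H; case/eqP: r0.
    have [N ->] := piZ_decomp r; apply: big1 => d _.
    by apply/eqP; apply: contrapT => /negP; apply: H.
  have [i ri mi] := ex_minnP ex; exists i; split=> // j ji.
  by apply/eqP; apply: contraTT ji => /mi; rewrite -leqNgt.
have [i [pi0 pi1]] := low p p0; have [j [qj0 qj1]] := low q q0.
have Eij : pihomog mdeg (i + j)%N (p * q) = pihomog mdeg i p * pihomog mdeg j q.
  have ij : (i < (i + j).+1)%N by rewrite ltnS leq_addr.
  rewrite pihomogM (bigD1 (Ordinal ij)) //= addKn big1 ?addr0 // => k ki.
  have [lt|ge] := ltnP k i; first by rewrite pi1 // mul0r.
  rewrite qj1 ?mulr0 //; have : (i < k)%N.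
    rewrite ltn_neqAle ge andbT; apply: contra_neq ki => E; exact: val_inj.
  by case: k {ki ge} => k /= hk; lia.
have nE : n = (i + j)%N%:Z.
  apply: (@homZ_uniq _ _ (piZ (i + j)%N%:Z (p * q))).
  - by rewrite /piZ Eij mulf_neq0.
  - rewrite (piZ_hom _ hpq); case: ifP => // _; exact: homZ0.
  - exact: homZ_piZ.
pose dp := mdeg (mlead p); pose dq := mdeg (mlead q).
have nE' : n = (dp + dq)%N.
  by rewrite -(homZP hpq _ (mlead_supp pq0)) mleadM // mdegD.
have lowb (r : R) (d : nat) : (forall j : nat, (j < d)%N -> pihomog mdeg j r = 0) ->
    forall m, m \in msupp r -> (d <= mdeg m)%N.
  move=> hr m mr; rewrite leqNgt; apply: contraTN mr => /hr E.
  have [N rE] := piZ_decomp r; rewrite -mcoeff_eq0 rE raddf_sum /= big1 // => e _.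
  have [eE|ne] := eqVneq (e : nat) (mdeg m); first by rewrite eE E mcoeff0.
  by apply/eqP; rewrite mcoeff_eq0; apply: contra ne => /(homZP (homZ_piZ e r))[->].
have l1 : (i <= dp)%N := lowb p i pi1 _ (mlead_supp p0).
have l2 : (j <= dq)%N := lowb q j qj1 _ (mlead_supp q0).
exists i; apply/homZP => m mp; congr Posz; apply/eqP; rewrite eqn_leq (lowb p) //.
rewrite andbT; apply: (leq_trans (lemc_mdeg (msupp_le_mlead mp) : (_ <= dp)%N)).
by clearbody dp dq; lia.
Qed.

End Homogeneous.
Arguments homZP {K n p}.

Section Points.
Variable K : fieldType.
Local Notation R := {mpoly K[4]}.
Local Notation F := {fraction {mpoly K[4]}}.
Implicit Types (a b c h y : R) (n k l t : int) (q : point K).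

Definition ideal (H : R -> Prop) : R -> Prop := @rspan R R^o H.

Lemma idealM H a b : ideal H b -> ideal H (a * b).
Proof. exact: (@rspanZ R R^o H a b). Qed.

Lemma idealD H a b : ideal H a -> ideal H b -> ideal H (a + b).
Proof. exact: (@rspanD R R^o H a b). Qed.

Lemma ideal_ind H (P : R -> Prop) : P 0 ->
  (forall a x v, H x -> P v -> P (a * x + v)) -> forall v, ideal H v -> P v.
Proof. by move=> P0 PD v; elim=> // a x w Hx _; apply: PD. Qed.

Lemma idealS H H' v : (forall x, H x -> H' x) -> ideal H v -> ideal H' v.
Proof. by move=> HH; apply: rspan_trans => x /HH; apply: rspan_gen. Qed.

Lemma pointX q a m : q (a ^+ m) -> q a.
Proof.
elim: m => [|m IH]; first by rewrite expr0 => /(point_proper (p := q)).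
by rewrite exprS => /point_prime[].
Qed.

Lemma point_ideal q H v : (forall x, H x -> q x) -> ideal H v -> q v.
Proof.
move=> Hq; apply: (ideal_ind (P := q)); first exact: point0.
by move=> a x w /Hq qx qw; apply: pointD => //; apply: pointMl.
Qed.

(* An ideal maximal among those containing H and avoiding the powers of y is
   prime; the elements all of whose components lie in it form a point. *)
Lemma point_avoiding (H : R -> Prop) y k i :
  (forall h, H h -> exists n, homZ n h) -> homZ k y -> divides 'X_i y ->
  (forall q, ~ q y -> exists2 h, H h & ~ q h) ->
  exists m, ideal H (y ^+ m).
Proof.
move=> homH homy [y' yE] cov; apply: contrapT => /forallNP nH.
(* [H] is adjoined to every candidate, so that the union of the empty chain is admissible as
   well. *)
pose HU (A : R -> Prop) (x : R) := H x \/ A x.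
pose P (A : R -> Prop) := forall m, ~ ideal (HU A) (y ^+ m).
have [G GP Gtot|A [PA Amax]] := @classical_sets.Zorn_bigcup R P.
  move=> m; suff alt v : ideal (HU (classical_sets.bigcup G id)) v ->
      ideal H v \/ exists2 X, G X & ideal (HU X) v.
    by move=> /alt[/nH//|[X /GP PX /PX]].
  apply: (ideal_ind (P := fun v => ideal H v \/ exists2 X, G X & ideal (HU X) v)).
    by left; apply: rspan0.
  move=> a x w Ux IH.
  have {}Ux : H x \/ exists2 X, G X & X x by case: Ux => [|[X]]; [left | right; exists X].
  have {}Ux : ideal H x \/ exists2 X, G X & ideal (HU X) x.
    case: Ux => [Hx|[X GX Xx]]; first by left; apply: rspan_gen.
    by right; exists X => //; apply: rspan_gen; right.
  have HUl X u : ideal H u -> ideal (HU X) u by apply: idealS => z; left.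
  case: Ux IH => [Hx|[X GX Xx]] [Hw|[Y GY Yw]].
  - by left; apply: idealD Hw; apply: idealM.
  - by right; exists Y => //; apply: idealD Yw; apply: idealM; apply: HUl.
  - by right; exists X => //; apply: idealD; [apply: idealM | apply: HUl].
  - have [XY|YX] := Gtot X Y GX GY.
    + right; exists Y => //; apply: idealD Yw; apply: idealM.
      by apply: idealS Xx => z [Hz|/XY]; [left | right].
    + right; exists X => //; apply: idealD; first exact: idealM.
      by apply: idealS Yw => z [Hz|/YX]; [left | right].
pose Q := ideal (HU A).
have Qmax a : ~ Q a -> exists m x r, Q x /\ y ^+ m = x + r * a.
  move=> nQa; have /Amax : classical_sets.proper A (fun z => A z \/ z = a).
    split=> [z Az|]; first by left.
    by move=> /(_ a (or_intror erefl)) Aa; apply: nQa; apply: rspan_gen; right.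
  move=> /existsNP[m /contrapT]; exists m.
  suff: forall v, ideal (HU (fun z => A z \/ z = a)) v -> exists x r, Q x /\ v = x + r * a.
    by apply.
  apply: (ideal_ind (P := fun v => exists x r, Q x /\ v = x + r * a)).
    by exists 0, 0; split; [apply: rspan0 | rewrite mul0r addr0].
  move=> b z w Hz [x [r [Qx ->]]].
  have [Qz|->] : Q z \/ z = a.
    by case: Hz => [Hz|[Az|->]]; [left|left|right] => //; apply: rspan_gen; [left|right].
  - exists (b * z + x), r; split; last by rewrite addrA.
    by apply: idealD => //; apply: idealM.
  - by exists x, (b + r); split => //; rewrite mulrDl addrCA.
have Q1 : ~ Q 1 by apply: (PA 0%N).
have Qp a b : Q (a * b) -> Q a \/ Q b.
  move=> Qab; have [|nQa] := EM (Q a); first by left.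
  have [|nQb] := EM (Q b); first by right.
  have [m [x [r [Qx E1]]]] := Qmax a nQa; have [m' [x' [r' [Qx' E2]]]] := Qmax b nQb.
  exfalso; apply: (PA (m + m')%N); rewrite exprD E1 E2.
  have -> : (x + r * a) * (x' + r' * b) =
      (x' + r' * b) * x + ((r * a) * x' + (r * r') * (a * b)) by ring.
  by apply: idealD; [|apply: idealD]; apply: idealM.
have Qs (I : finType) (C : pred I) (G : I -> R) :
    (forall j, C j -> Q (G j)) -> Q (\sum_(j | C j) G j).
  move=> h; apply: (big_ind Q) => //; first exact: rspan0.
  by move=> u v; apply: idealD.
pose Q' a := forall j : nat, Q (pihomog mdeg j a).
have Q'0 : Q' 0 by move=> j; rewrite pihomog0; apply: rspan0.
have Q'D a b : Q' a -> Q' b -> Q' (a + b).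
  by move=> ha hb j; rewrite pihomogD; apply: idealD; [apply: ha | apply: hb].
have Q'M a b : Q' b -> Q' (a * b).
  by move=> hb j; rewrite pihomogM; apply: Qs => d _; apply/idealM/hb.
have Q'1 : ~ Q' 1.
  by move=> /(_ 0%N); rewrite pihomog_dE //; apply: dhomog1.
have Q'p a b : Q' (a * b) -> Q' a \/ Q' b.
  move=> hab; have [|nQa] := EM (Q' a); first by left.
  have [|nQb] := EM (Q' b); first by right.
  (* With [d] and [e] the least degrees of components outside [Q], the component of degree [d + e]
     of the product is congruent modulo [Q] to the product of these two components. *)
  have low c : ~ Q' c -> exists j : nat, ~ Q (pihomog mdeg j c) /\
      forall d : nat, (d < j)%N -> Q (pihomog mdeg d c).
    move=> nc; have ex : exists j, `[< ~ Q (pihomog mdeg j c) >].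
      by apply: contrapT => /forallNP H'; apply: nc => j; apply: contrapT => /asboolP/H'.
    have [j /asboolP nj mj] := ex_minnP ex; exists j; split=> // d dj.
    by apply: contrapT => /asboolP/mj; rewrite leqNgt dj.
  have [d [na ma]] := low a nQa; have [e [nb mb]] := low b nQb.
  have de : (d < (d + e).+1)%N by rewrite ltnS leq_addr.
  have := hab (d + e)%N; rewrite pihomogM (bigD1 (Ordinal de)) //= addKn => Qsum.
  suff /Qp[/na|/nb] : Q (pihomog mdeg d a * pihomog mdeg e b) by [].
  rewrite -[_ * _](addrK (\sum_(j < (d + e).+1 | j != Ordinal de)
    pihomog mdeg j a * pihomog mdeg (d + e - j)%N b)).
  apply: idealD => //; rewrite -mulN1r; apply: idealM; apply: Qs => j jd.
  have [lt|ge] := ltnP j d; first by rewrite mulrC; apply: idealM; apply: ma.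
  apply: idealM; apply: mb; have : (d < j)%N.
    rewrite ltn_neqAle ge andbT; apply: contra_neq jd => E; exact: val_inj.
  by case: j {jd ge} => j /= hj; lia.
have Q'h a (j : nat) : Q' a -> Q' (pihomog mdeg j a).
  move=> ha d; have [<-|ne] := eqVneq j d; first by rewrite pihomog_id.
  by rewrite (pihomog_ne0 ne (pihomogP _ _ _)); apply: rspan0.
have nQy : ~ Q' y.
  case: k homy => [k|k] homy.
    rewrite homZ_nat in homy; move=> /(_ k); rewrite (pihomog_dE homy) => Qy.
    by apply: (PA 1%N); rewrite expr1.
  move=> _; apply: (PA 1%N); rewrite expr1 (homZ_neg _ homy) //; exact: rspan0.
(* A point must miss some variable; the one dividing [y] serves. *)
have Q'r : exists j : 'I_4, ~ Q' 'X_j.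
  by exists i => Qi; apply: nQy; rewrite yE; apply: Q'M.
pose q := Point Q'0 Q'D Q'M Q'1 Q'p Q'h Q'r.
have [h Hh] := cov q nQy; apply.
have [n homh] := homH h Hh; have Qh : Q h by apply: rspan_gen; left.
move=> j; have := piZ_hom j homh; rewrite /piZ => ->.
by case: ifP => // _; apply: rspan0.
Qed.

End Points.

(** * Homogeneous fractions and stalks *)

Section Fractions.
Variable K : fieldType.
Local Notation R := {mpoly K[4]}.
Local Notation F := {fraction {mpoly K[4]}}.
Implicit Types (a b c h y : R) (n k l t e : int) (q : point K) (x z : F).

(** The stalk of O(n) at the generic point, with integer degrees. *)
Definition hfrac n x := exists k l a b,
  [/\ homZ k a, homZ l b, b != 0, k = l + n & x = tofrac a / tofrac b].

(** Sections of O(n) over the locus where [y], of degree [e], does not vanish. *)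
Definition loc y e n x := exists (m : nat) c,
  homZ (n + e * m%:Z) c /\ x = tofrac c / tofrac y ^+ m.

Lemma tofrac_inj a b : tofrac a = tofrac b -> a = b.
Proof. by move/eqP; rewrite tofrac_eq => /eqP. Qed.

Lemma tofrac_neq0 a : a != 0 -> tofrac a != 0.
Proof. by rewrite tofrac_eq0. Qed.

Lemma point_neq0 q a : ~ q a -> a != 0.
Proof. by move=> qa; apply: contra_notN qa => /eqP->; apply: point0. Qed.

Lemma stalkZP n q x : stalkO n q x <-> exists k l a b,
  [/\ homZ k a, homZ l b, ~ q b, k = l + n & x = tofrac a / tofrac b].
Proof.
split=> [[k [l [a [b [ha hb qb E xE]]]]]|[k [l [a [b [ha hb qb E xE]]]]]].
  by exists k%:Z, l%:Z, a, b; rewrite !homZ_nat.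
(* A zero numerator has every degree, so the given degrees need not be natural numbers; a power of a
   variable not vanishing at [q] is then taken as denominator. *)
have [a0|a0] := eqVneq a 0.
  have [i qi] := point_relevant q.
  have [l' [k' E']] : exists l' k' : nat, k'%:Z = l'%:Z + n.
    by exists (absz n), (absz ((absz n)%:Z + n)); lia.
  exists k', l', 0, ('X_i ^+ l'); split=> //.
  - by rewrite -homZ_nat homZ0.
  - by have := homZX l' (homZ_var K i); rewrite mul1r homZ_nat.
  - by move/pointX.
  - by rewrite xE a0 tofrac0 !mul0r.
have b0 := point_neq0 qb.
case: k E ha => [k|k] E ha; last by rewrite (homZ_neg _ ha) ?eqxx in a0.
case: l E hb => [l|l] E hb; last by rewrite (homZ_neg _ hb) ?eqxx in b0.
by exists k, l, a, b; rewrite -!homZ_nat.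
Qed.

Lemma hfracD n x z : hfrac n x -> hfrac n z -> hfrac n (x + z).
Proof.
move=> [k [l [a [b [ha hb b0 E ->]]]]] [k' [l' [a' [b' [ha' hb' b0' E' ->]]]]].
exists (k + l'), (l + l'), (a * b' + a' * b), (b * b'); split.
- apply: homZD; first exact: homZM.
  by rewrite (_ : k + l' = k' + l); [apply: homZM | rewrite E E'; lia].
- exact: homZM.
- by rewrite mulf_neq0.
- by rewrite E; lia.
- by rewrite addf_div ?tofrac_neq0 // !(tofracM, tofracD).
Qed.

Lemma hfracN n x : hfrac n x -> hfrac n (- x).
Proof.
move=> [k [l [a [b [ha hb b0 E ->]]]]]; exists k, l, (- a), b.
by split=> //; [apply: homZN | rewrite tofracN mulNr].
Qed.

Lemma hfracB n x z : hfrac n x -> hfrac n z -> hfrac n (x - z).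
Proof. by move=> hx hz; apply: hfracD hx (hfracN hz). Qed.

Lemma hfracM n k x z : hfrac n x -> hfrac k z -> hfrac (n + k) (x * z).
Proof.
move=> [k1 [l [a [b [ha hb b0 E ->]]]]] [k' [l' [a' [b' [ha' hb' b0' E' ->]]]]].
exists (k1 + k'), (l + l'), (a * a'), (b * b'); split.
- exact: homZM.
- exact: homZM.
- by rewrite mulf_neq0.
- by rewrite E E'; lia.
- by rewrite mulf_div !tofracM.
Qed.

Lemma hfrac_tofrac n a : homZ n a -> hfrac n (tofrac a).
Proof.
move=> ha; exists n, 0, a, 1; rewrite tofrac1 divr1 oner_neq0 add0r.
by split=> //; apply: homZ1.
Qed.

Lemma tofrac_hfrac n a : hfrac n (tofrac a) -> homZ n a.
Proof.
move=> [k [l [a' [b [ha hb b0 E aE]]]]].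
apply: (homZ_divl b0 hb); rewrite -E.
suff -> : b * a = a' by [].
by apply: tofrac_inj; rewrite tofracM aE mulrC divfK ?tofrac_neq0.
Qed.

Lemma stalk_hfrac n q x : stalkO n q x -> hfrac n x.
Proof.
move=> /stalkZP[k [l [a [b [ha hb qb E ->]]]]].
by exists k, l, a, b; split=> //; apply: point_neq0 qb.
Qed.

Lemma stalkD n q x z : stalkO n q x -> stalkO n q z -> stalkO n q (x + z).
Proof.
move=> /stalkZP[k [l [a [b [ha hb qb E ->]]]]].
move=> /stalkZP[k' [l' [a' [b' [ha' hb' qb' E' ->]]]]].
apply/stalkZP; exists (k + l'), (l + l'), (a * b' + a' * b), (b * b'); split.
- apply: homZD; first exact: homZM.
  by rewrite (_ : k + l' = k' + l); [apply: homZM | rewrite E E'; lia].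
- exact: homZM.
- by move/point_prime => [].
- by rewrite E; lia.
- by rewrite addf_div ?tofrac_neq0 ?(point_neq0 qb) ?(point_neq0 qb') //
    !(tofracM, tofracD).
Qed.

Lemma stalkM n k q x z : stalkO n q x -> stalkO k q z -> stalkO (n + k) q (x * z).
Proof.
move=> /stalkZP[k1 [l [a [b [ha hb qb E ->]]]]].
move=> /stalkZP[k' [l' [a' [b' [ha' hb' qb' E' ->]]]]].
apply/stalkZP; exists (k1 + k'), (l + l'), (a * a'), (b * b'); split.
- exact: homZM.
- exact: homZM.
- by move/point_prime => [].
- by rewrite E E'; lia.
- by rewrite mulf_div !tofracM.
Qed.

Lemma stalk_hom n q a : homZ n a -> stalkO n q (tofrac a).
Proof.
move=> ha; apply/stalkZP; exists n, 0, a, 1.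
rewrite tofrac1 divr1 add0r; split=> //; first exact: homZ1.
exact: point_proper.
Qed.

Lemma stalkN n q x : stalkO n q x -> stalkO n q (- x).
Proof.
move=> hx; rewrite -mulN1r -[n]add0r; apply: stalkM hx.
by rewrite -tofrac1 -tofracN; apply/stalk_hom/homZN/homZ1.
Qed.

Lemma stalk0 n q : stalkO n q 0.
Proof. by rewrite -tofrac0; apply/stalk_hom/homZ0. Qed.

Lemma stalk_div n e q a b :
  homZ (n + e) a -> homZ e b -> ~ q b -> stalkO n q (tofrac a / tofrac b).
Proof.
move=> ha hb qb; apply/stalkZP; exists (n + e), e, a, b; split=> //.
by rewrite addrC.
Qed.

Lemma loc_stalk y e n q x : homZ e y -> ~ q y -> loc y e n x -> stalkO n q x.
Proof.
move=> hy qy [m [c [hc ->]]]; rewrite -tofracXn.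
by apply: stalk_div hc (homZX m hy) _; move/pointX.
Qed.

Lemma loc_hfrac y e n x : y != 0 -> homZ e y -> loc y e n x -> hfrac n x.
Proof.
move=> y0 hy [m [c [hc ->]]]; exists (n + e * m%:Z), (e * m%:Z), c, (y ^+ m).
split=> //; [exact: homZX | exact: expf_neq0 | exact: addrC | by rewrite tofracXn].
Qed.

Lemma hfrac_clear n e h a x :
  homZ e h -> hfrac n x -> tofrac h * x = tofrac a -> homZ (n + e) a.
Proof.
move=> hh hx E; apply: tofrac_hfrac; rewrite -E addrC.
by apply: hfracM hx; apply: hfrac_tofrac.
Qed.

Variables (r s : nat) (B : 'M[R]_(r, s)) (a : 'I_r -> int) (b : 'I_s -> int).

Definition vhom r (a : 'I_r -> int) t (v : 'cV[R]_r) :=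
  forall i, homZ (a i + t) (v i 0).

(** The convention under which [B] is a map of degree 0 from the sum of the R(b j) to the sum of the
    R(a i). *)
Definition bhom := forall i j, homZ (a i - b j) (B i j).

Definition compv r (a : 'I_r -> int) t (v : 'cV[R]_r) : 'cV[R]_r :=
  \col_i piZ (a i + t) (v i 0).

Local Notation tomx := (map_mx (@tofrac R)).

Lemma vhom_compv r' (a' : 'I_r' -> int) t v : vhom a' t (compv a' t v).
Proof. by move=> i; rewrite mxE; apply: homZ_piZ. Qed.

Hypothesis hB : bhom.

Lemma compvM t (x : 'cV[R]_s) : compv a t (B *m x) = B *m compv b t x.
Proof.
apply/matrixP => i j; rewrite !mxE piZ_sum; apply: eq_bigr => k _.
rewrite !mxE (_ : a i + t = (a i - b k) + (b k + t)); first exact: piZM.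
by lia.
Qed.

Lemma hom_preimage t v (x : 'cV[R]_s) : vhom a t v -> v = B *m x ->
  exists2 x', vhom b t x' & v = B *m x'.
Proof.
move=> hv E; exists (compv b t x); first exact: vhom_compv.
rewrite -compvM -E; apply/matrixP => i j; rewrite mxE ord1 piZ_id //.
Qed.

Definition local_im t q (w : 'cV[F]_r) := exists2 u : 'cV[F]_s,
  forall j, stalkO (b j + t) q (u j 0) & w = tomx B *m u.

Lemma local_imD t q u v : local_im t q u -> local_im t q v -> local_im t q (u + v).
Proof.
move=> [x hx ->] [x' hx' ->]; exists (x + x') => [k|].
  by rewrite mxE; apply: stalkD.
by rewrite mulmxDr.
Qed.

Lemma local_imN t q u : local_im t q u -> local_im t q (- u).
Proof.
move=> [x hx ->]; exists (- x) => [k|]; last by rewrite mulmxN.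
by rewrite mxE; apply: stalkN.
Qed.

Lemma local_imB t q u v : local_im t q u -> local_im t q v -> local_im t q (u - v).
Proof. by move=> hu hv; apply/local_imD/local_imN. Qed.

Lemma local_im0 t q : local_im t q 0.
Proof. by exists 0 => [k|]; rewrite ?mulmx0 // mxE; apply: stalk0. Qed.

Lemma hom_clear t e h (w : 'cV[F]_r) (v : 'cV[R]_s) :
  homZ e h -> (forall i, hfrac (a i + t) (w i 0)) ->
  tofrac h *: w = tomx (B *m v) ->
  exists2 v', vhom b (t + e) v' & tofrac h *: w = tomx (B *m v').
Proof.
move=> hh hw E; have [|v' hv' E'] := @hom_preimage (t + e) (B *m v) v _ erefl.
  move=> i; have := congr1 (fun z : 'cV[F]_r => z i 0) E.
  by rewrite [LHS]mxE [RHS]mxE addrA; apply: hfrac_clear.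
by exists v'; rewrite // E E'.
Qed.

Lemma local_im_intro t q e h (w : 'cV[F]_r) (v : 'cV[R]_s) :
  homZ e h -> ~ q h -> (forall i, hfrac (a i + t) (w i 0)) ->
  tofrac h *: w = tomx (B *m v) -> local_im t q w.
Proof.
move=> hh qh hw /(hom_clear hh hw)[v' hv' E].
have h0 := tofrac_neq0 (point_neq0 qh).
exists ((tofrac h)^-1 *: tomx v') => [k|].
  by rewrite !mxE mulrC; apply: stalk_div hh qh; rewrite -addrA.
by rewrite -scalemxAr -map_mxM -E scalerA mulVf // scale1r.
Qed.

(** Consider the homogeneous [h] such that [h] times [w] comes from a polynomial vector. Clearing
    the denominators of a local preimage gives, at each point where [y] is nonzero, one that does
    not vanish there; hence they generate an ideal containing a power of [y]. *)
Lemma local_image t y e i (w : 'cV[F]_r) :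
  homZ e y -> divides 'X_i y -> (forall i, hfrac (a i + t) (w i 0)) ->
  (forall q, ~ q y -> local_im t q w) ->
  exists (m : nat) v, vhom b (t + e * m%:Z) v /\
    tofrac (y ^+ m) *: w = tomx (B *m v).
Proof.
move=> hy dy hw loc_w.
pose D h := (exists k, homZ k h) /\ exists v, tofrac h *: w = tomx (B *m v).
have [|q qy|m ym] := @point_avoiding K D y e i _ hy dy; first by move=> h [].
  have [u hu wE] := loc_w q qy.
  have /choice[x hx] : forall k : 'I_s, exists x : int * R * R,
      [/\ homZ x.1.1 x.1.2, ~ q x.1.2 & u k 0 = tofrac x.2 / tofrac x.1.2].
    move=> k; have /stalkZP[k1 [l [c [d [_ hd qd _ ->]]]]] := hu k.
    by exists (l, d, c).
  exists (\prod_k (x k).1.2).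
    split.
      apply: (big_ind (fun h => exists k, homZ k h)).
      - by exists 0; apply: homZ1.
      - by move=> c d [k hc] [l hd]; exists (k + l); apply: homZM.
      - by move=> k _; exists (x k).1.1; have [] := hx k.
    exists (\col_k ((x k).2 * \prod_(j | j != k) (x j).1.2)).
    rewrite wE map_mxM scalemxAr; congr (_ *m _); apply/matrixP => k j.
    rewrite !mxE ord1; have [_ qd ->] := hx k.
    rewrite (bigD1 k) //= !tofracM mulrC -!mulrA; congr (_ * _).
    by rewrite mulrA mulVf ?mul1r // tofrac_neq0 // (point_neq0 qd).
  apply: (big_ind (fun h => ~ q h)).
  - exact: point_proper.
  - by move=> c d qc qd /point_prime[].
  - by move=> k _; have [] := hx k.
have [v vE] : exists v, tofrac (y ^+ m) *: w = tomx (B *m v).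
  apply: (ideal_ind (P := fun h => exists v, tofrac h *: w = tomx (B *m v))) ym.
    by exists 0; rewrite tofrac0 scale0r mulmx0 map_mx0.
  move=> c h z [_ [v vE]] [v' vE']; exists (c *: v + v').
  rewrite mulmxDr map_mxD -vE' -scalemxAr -[RHS]addrC map_mxZ -vE.
  by rewrite tofracD scalerDl tofracM scalerA addrC.
by have [v' hv' E] := hom_clear (homZX m hy) hw vE; exists m, v'.
Qed.

End Fractions.

Lemma scaler_common (E : comPzRingType) (V : lmodType E) (a b c : E) (u v : V) :
  a *: ((b * c) *: u - b *: (c *: v)) = b *: ((a * c) *: (u - v)).
Proof.
by rewrite !scalerBr !scalerA; congr (_ *: _ - _ *: _); rewrite mulrCA ?mulrA.
Qed.

Lemma mxBE (V : zmodType) m n (A B : 'M[V]_(m, n)) i j :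
  (A - B) i j = A i j - B i j.
Proof. by rewrite !mxE. Qed.

Lemma mul_divA (E : fieldType) (h x y a : E) : x != 0 ->
  h * (x * y) * (a / x) = h * y * a.
Proof. by move=> x0; field. Qed.

(** * Gluing sections of the cokernel *)

Section JacobianGluing.
Variable K : fieldType.
Local Notation R := {mpoly K[4]}.
Local Notation F := {fraction {mpoly K[4]}}.
Local Notation tomx := (map_mx (@tofrac R)).
Local Notation cover := (@Defs.cover K).
Implicit Types (n t : int) (q : point K) (I : {set 'I_4}).

Variables (f g : R) (df dg : nat).
Hypotheses (hf : f \is (df.+1).-homog) (hg : g \is (dg.+1).-homog).

Definition jacR : 'M[R]_(2, 4) := \matrix_(i, j) mderiv j (if i == 0 then f else g).

Definition tgt (i : 'I_2) : int := if i == 0 then df%:Z else dg%:Z.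
Definition src (i : 'I_4) : int := 0.

Lemma jacobianE : jacobian f g = tomx jacR.
Proof. by apply/matrixP => i j; rewrite !mxE. Qed.

Lemma homog_mderiv (h : R) d j : h \is (d.+1).-homog -> homZ d%:Z (mderiv j h).
Proof.
rewrite -homZ_nat => /homZP hh; apply/homZP => m.
rewrite mcoeff_msupp mcoeff_deriv => nz.
have /hh : (m + U_(j))%MM \in msupp h.
  by rewrite mcoeff_msupp; apply: contra_neq nz => ->; rewrite mul0rn.
by rewrite mdegD mdeg1 addn1 => -[->].
Qed.

Lemma bhom_jacR : bhom jacR tgt src.
Proof.
by move=> i j; rewrite subr0 mxE /tgt; case: ifP => _; apply: homog_mderiv.
Qed.

Lemma stalk_imP t q w : stalk_im f g t q w <-> local_im jacR src t q w.
Proof.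
split=> [[v hv ->]|[v hv ->]].
  by rewrite jacobianE; exists v => // j; rewrite /src add0r; apply: hv.
exists v; last by rewrite jacobianE.
by move=> j; have := hv j; rewrite /src add0r.
Qed.

Definition varprod I : R := \prod_(i in I) 'X_i.

Lemma homZ_varprod I : homZ #|I|%:Z (varprod I).
Proof. exact: homZ_prod_var. Qed.

Lemma var_neq0 (i : 'I_4) : 'X_i != 0 :> R.
Proof. by rewrite -msize_poly_eq0 msizeX. Qed.

Lemma varprod_neq0 I : varprod I != 0.
Proof. by apply/prodf_neq0 => i _; apply: var_neq0. Qed.

Lemma divides_varprod I i : i \in I -> divides 'X_i (varprod I).
Proof.
by move=> iI; exists (\prod_(j in I :\ i) 'X_j); rewrite mulrC -big_setD1.
Qed.

Lemma cover_varprod I q : cover I q <-> ~ q (varprod I).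
Proof.
split=> [cq|nq i iI qi]; last first.
  by apply: nq; have [c ->] := divides_varprod iI; apply: pointMl.
apply: (big_ind (fun h => ~ q h)); first exact: point_proper.
  by move=> a b qa qb /point_prime[].
by move=> i iI; apply: cq.
Qed.

Lemma tomx_sum m k (T : finType) (G : T -> 'M[R]_(m, k)) :
  tomx (\sum_i G i) = \sum_i tomx (G i).
Proof. exact: (raddf_sum (map_mx (@tofrac R))). Qed.

Lemma loc_stalk_cover I n q x : cover I q -> loc (varprod I) #|I|%:Z n x -> stalkO n q x.
Proof. by move=> /cover_varprod; apply: loc_stalk; apply: homZ_varprod. Qed.

Lemma loc_hfrac_var I n x : loc (varprod I) #|I|%:Z n x -> hfrac n x.
Proof. exact: loc_hfrac (varprod_neq0 I) (homZ_varprod I). Qed.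

Lemma zopen_cover I : zopen (cover I).
Proof.
move=> p /cover_varprod hp; exists (varprod I), #|I|; split=> //.
  by rewrite -homZ_nat homZ_varprod.
by move=> q /cover_varprod.
Qed.

Lemma local_image_cover t I i (w : 'cV[F]_2) : i \in I ->
  (forall j, hfrac (tgt j + t) (w j 0)) ->
  (forall q, cover I q -> stalk_im f g t q w) ->
  exists2 u : 'cV[F]_4, forall j, loc (varprod I) #|I|%:Z t (u j 0)
    & w = jacobian f g *m u.
Proof.
move=> iI hw him.
have [q /cover_varprod/him/stalk_imP//|m [v [hv E]]] :=
  local_image bhom_jacR (homZ_varprod I) (divides_varprod iI) hw.
have x0 : tofrac (varprod I ^+ m) != 0.
  by rewrite tofrac_eq0 expf_neq0 // varprod_neq0.
exists ((tofrac (varprod I ^+ m))^-1 *: tomx v) => [j|].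
  exists m, (v j 0); split; last by rewrite !mxE mulrC tofracXn.
  by have := hv j; rewrite /src add0r.
by rewrite jacobianE -scalemxAr -map_mxM -E scalerA mulVf // scale1r.
Qed.

(** [h] plays two roles: it clears the denominators of [w], and its nonvanishing cuts out a set on
    which [w] represents [s]. *)
Let good t I (s : point K -> 'cV[F]_2) (h : R) (w : 'cV[F]_2) :=
  [/\ exists e, homZ e h, exists c : 'cV[R]_2, tofrac h *: w = tomx c,
      forall j, hfrac (tgt j + t) (w j 0)
    & forall q, cover I q -> ~ q h -> local_im jacR src t q (s q - w)].

Lemma sectQ_good t I s p : sectQ f g df dg t (cover I) s -> cover I p ->
  exists2 h, (exists w, good t I s h w) & ~ p h.
Proof.
move=> hs cp; have [V [w [oV Vp hw him]]] := hs p cp.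
have [h [e [hh ph hV]]] := oV p Vp.
have st j : stalkO (tgt j + t) p (w j 0) by apply: hw.
have /stalkZP[k0 [l0 [a0 [b0 [ha0 hb0 pb0 E0 w0]]]]] := st 0.
have /stalkZP[k1 [l1 [a1 [b1 [ha1 hb1 pb1 E1 w1]]]]] := st 1.
have n0 := point_neq0 pb0; have n1 := point_neq0 pb1.
exists (h * (b0 * b1)); last by move=> /point_prime[|/point_prime[]].
exists w; split.
- exists (e%:Z + (l0 + l1)); apply: homZM; first by rewrite homZ_nat.
  exact: homZM.
- exists (\col_j if j == 0 then h * b1 * a0 else h * b0 * a1).
  apply/matrixP => j i; rewrite !mxE ord1.
  have [->|->] : j = 0 \/ j = 1.
    by case: j => [[|[|]]] // lt; [left|right]; apply: val_inj.
  + by rewrite w0 /= !tofracM mul_divA // tofrac_eq0.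
  + by rewrite w1 /= !tofracM [tofrac b0 * _]mulrC mul_divA // tofrac_eq0.
- by move=> j; apply: stalk_hfrac (st j).
- move=> q cq nq; apply/stalk_imP/him => //; apply: hV => qh.
  by apply: nq; rewrite mulrC; apply: pointMl.
Qed.

(** Quasi-coherence of the cokernel on an affine open set: finitely many representatives agree
    modulo the image after multiplication by a power of [h * h' * x], and they are patched by a
    partition of unity made of the powers [h ^+ M]. *)
Lemma sectQ_local t I i s : i \in I -> sectQ f g df dg t (cover I) s ->
  exists2 w : 'cV[F]_2, forall j, loc (varprod I) #|I|%:Z (tgt j + t) (w j 0)
    & forall q, cover I q -> stalk_im f g t q (s q - w).
Proof.
move=> iI hs; set x := varprod I; have hx := homZ_varprod I.
have dx := divides_varprod iI.
have [|q /cover_varprod cq|m0 xm0] := @point_avoiding K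
  (fun h => exists w, good t I s h w) x #|I|%:Z i _ hx dx.
- by move=> h [w []].
- by have [h] := sectQ_good hs cq; exists h.
have [L HL xL] := rspan_fin xm0.
have /choice[wt hwt] : forall h, exists w, h \in L -> good t I s h w.
  move=> h; have [/HL[w hw]|_] := boolP (h \in L); first by exists w.
  by exists 0.
have covL q : cover I q -> exists2 h, h \in L & ~ q h.
  move=> /cover_varprod nq; apply: contrapT => nL; apply/nq/(@pointX _ _ _ m0).
  apply: (point_ideal _ xL) => h hL; apply: contrapT => nqh.
  by apply: nL; exists h.
have /choice[N hN] : forall hh' : R * R, exists N : nat,
    hh'.1 \in L -> hh'.2 \in L -> forall M, (N <= M)%N -> exists v,
    tofrac ((hh'.1 * hh'.2 * x) ^+ M) *: (wt hh'.1 - wt hh'.2) = tomx (jacR *m v).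
  move=> [h h'] /=; have [hL|_] := boolP (h \in L); last by exists 0%N.
  have [hL'|_] := boolP (h' \in L); last by exists 0%N.
  have [[e he] _ hw loc_w] := hwt h hL; have [[e' he'] _ hw' loc_w'] := hwt h' hL'.
  have dy : divides 'X_i (h * h' * x) by apply: dividesM.
  have [|q nq|N [v [_ E]]] := local_image (t := t) (w := wt h - wt h') bhom_jacR
      (homZM (homZM he he') hx) dy.
  - by move=> j; rewrite 2!mxE; apply/hfracD => //; apply: hfracN.
  - have -> : wt h - wt h' = (s q - wt h') - (s q - wt h).
      by rewrite opprB [RHS]addrC addrA subrK.
    have cq : cover I q by apply/cover_varprod => qx; apply: nq; apply: pointMl.
    apply: local_imB; [apply: loc_w' | apply: loc_w] => // qh; apply: nq.
    + by rewrite mulrAC; apply: pointMl.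
    + by rewrite -mulrA mulrC; apply: pointMl.
  exists N => _ _ M NM; exists ((h * h' * x) ^+ (M - N) *: v).
  rewrite -scalemxAr map_mxZ -E scalerA -tofracM -exprD subnK //.
(* The successor makes [M] positive, so that [h ^+ M] still clears the denominators of [wt h]. *)
pose M := (\max_(h <- L) \max_(h' <- L) N (h, h')).+1.
have hM h h' : h \in L -> h' \in L -> exists v,
    tofrac ((h * h' * x) ^+ M) *: (wt h - wt h') = tomx (jacR *m v).
  move=> hL hL'; apply: (hN (h, h')) => //; apply: leqW.
  apply: (@leq_trans (\max_(h' <- L) N (h, h'))%N).
    exact: (@leq_bigmax_seq _ _ xpredT (fun h' => N (h, h'))).
  exact: (@leq_bigmax_seq _ _ xpredT (fun h => \max_(h' <- L) N (h, h'))%N).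
have [|q /cover_varprod cq|m1 xm1] := @point_avoiding K
  (fun h => h \in [seq h ^+ M | h <- L]) x #|I|%:Z i _ hx dx.
- move=> _ /mapP[h hL ->]; have [[e he] _ _ _] := hwt h hL.
  by exists (e * M%:Z); apply: homZX.
- have [h hL nq] := covL q cq; exists (h ^+ M); first exact: map_f.
  by move/pointX.
have [c0 c0E] := rspan_seq xm1.
have {c0 c0E} [c cE] : exists c : 'I_(size L) -> R,
    x ^+ m1 = \sum_k c k * L`_k ^+ M.
  move: c0 c0E; rewrite size_map => c E; exists c; rewrite E.
  by apply: eq_bigr => k _; rewrite (nth_map 0).
have Lk (k : 'I_(size L)) : L`_k \in L by rewrite mem_nth.
have /choice[e he] : forall k : 'I_(size L), exists e, homZ e L`_k.
  by move=> k; have [] := hwt _ (Lk k).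
(* Homogeneous parts of the coefficients, so that the glued fraction has the right degree. *)
pose c' k := piZ (#|I|%:Z * m1%:Z - e k * M%:Z) (c k).
have {}cE : x ^+ m1 = \sum_k c' k * L`_k ^+ M.
  rewrite -[LHS](piZ_id (homZX m1 hx)) cE piZ_sum; apply: eq_bigr => k _.
  rewrite [c' _ * _]mulrC -(piZM _ _ (homZX M (he k))).
  by congr (piZ _ _); [lia | exact: mulrC].
have /choice[cw hcw] : forall k : 'I_(size L), exists c : 'cV[R]_2,
    tofrac (L`_k ^+ M) *: wt L`_k = tomx c.
  move=> k; have [_ [c1 E1] _ _] := hwt _ (Lk k).
  exists (L`_k ^+ M.-1 *: c1).
  by rewrite map_mxZ -E1 scalerA -tofracM -exprSr.
have hcwd k j : homZ (tgt j + t + e k * M%:Z) (cw k j 0).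
  have [_ _ hw _] := hwt _ (Lk k).
  apply: (hfrac_clear (homZX M (he k)) (hw j)).
  by have := congr1 (fun z : 'cV[F]_2 => z j 0) (hcw k); rewrite [LHS]mxE [RHS]mxE.
have x0 : tofrac (x ^+ m1) != 0.
  by rewrite tofrac_eq0 expf_neq0 // varprod_neq0.
(* Weighted mean of the representatives: the weights, [c' k] times the [M]-th power of the [k]-th
   element of [L] over [x ^+ m1], add up to 1. *)
pose w : 'cV[F]_2 := (tofrac (x ^+ m1))^-1 *: tomx (\sum_k c' k *: cw k).
have locw j : loc x #|I|%:Z (tgt j + t) (w j 0).
  exists m1, ((\sum_k c' k *: cw k) j 0); split; last first.
    by rewrite [LHS]mxE mulrC -tofracXn; congr (_ / _); rewrite mxE.
  rewrite summxE; apply: homZ_sum => k _; rewrite mxE.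
  rewrite (_ : tgt j + t + #|I|%:Z * m1%:Z =
    (#|I|%:Z * m1%:Z - e k * M%:Z) + (tgt j + t + e k * M%:Z)); last by lia.
  by apply: homZM (hcwd k j); apply: homZ_piZ.
exists w => // q cq; apply/stalk_imP.
have [h hL nqh] := covL q cq; have [[eh heh] _ hwh loc_wh] := hwt h hL.
rewrite -[s q](subrK (wt h)) -addrA; apply: local_imD; first exact: loc_wh.
have hM' : forall k : 'I_(size L), exists v,
    tofrac ((h * L`_k * x) ^+ M) *: (wt h - wt L`_k) = tomx (jacR *m v).
  by move=> k; apply: hM.
have /choice[v hv] := hM'.
have nqx : ~ q x by apply/cover_varprod.
apply: (local_im_intro bhom_jacR (h := x ^+ m1 * (h ^+ M * x ^+ M))
  (v := \sum_k c' k *: v k)).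
- exact: homZM (homZX m1 hx) (homZM (homZX M heh) (homZX M hx)).
- by move=> /point_prime[/pointX//|/point_prime[/pointX|/pointX]].
- move=> j; rewrite mxBE; apply: hfracB => //.
  exact: loc_hfrac_var (locw j).
rewrite tofracM mulrC -scalerA scalerBr.
rewrite {1}cE scalerA divff // scale1r.
rewrite !(raddf_sum (@tofrac R)) /= scaler_suml.
rewrite tomx_sum -sumrB scaler_sumr mulmx_sumr.
rewrite tomx_sum; apply: eq_bigr => k _.
have E1 : tomx (c' k *: cw k) = tofrac (c' k) *: tomx (cw k) by rewrite map_mxZ.
have E2 : tomx (jacR *m (c' k *: v k)) = tofrac (c' k) *: tomx (jacR *m v k).
  by rewrite -scalemxAr map_mxZ.
rewrite E1 E2 -hcw -hv (tofracM (c' k)).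
have -> : tofrac ((h * L`_k * x) ^+ M) = tofrac (h ^+ M * x ^+ M) * tofrac (L`_k ^+ M).
  by rewrite -tofracM -!exprMn mulrAC.
exact: scaler_common.
Qed.

End JacobianGluing.

(** * Cech complexes and Serre vanishing *)

Section CechDifferential.
Variables (A : pzRingType) (V : lmodType A).
Implicit Types (c : {set 'I_4} -> V) (I J : {set 'I_4}).

Definition cechd c I : V :=
  \sum_(i in I) (-1) ^+ #|[set j in I | (j < i)%N]| *: c (I :\ i).

Let eps I (i : 'I_4) := #|[set j in I | (j < i)%N]|.

Let epsD1 I (i j : 'I_4) : i \in I -> eps I j = ((i < j) + eps (I :\ i) j)%N.
Proof.
move=> iI; rewrite /eps (cardsD1 i) inE iI; congr (_ + #|pred_of_set _|)%N.
by apply/setP => k; rewrite !inE andbA.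
Qed.

Lemma eq_cechd c c' I : (forall J, #|J|.+1 = #|I| -> c J = c' J) ->
  cechd c I = cechd c' I.
Proof.
move=> E; apply: eq_bigr => i iI; congr (_ *: _); apply: E.
by rewrite [in RHS](cardsD1 i) iI.
Qed.

Lemma cechdB c c' I : cechd (fun J => c J - c' J) I = cechd c I - cechd c' I.
Proof. by rewrite -sumrB; apply: eq_bigr => i _; rewrite scalerBr. Qed.

Lemma cechd_sum (T : finType) (c : T -> {set 'I_4} -> V) I :
  cechd (fun J => \sum_k c k J) I = \sum_k cechd (c k) I.
Proof.
by rewrite exchange_big; apply: eq_bigr => i _; rewrite scaler_sumr.
Qed.

Lemma cechd_cechd c I : cechd (cechd c) I = 0.
Proof.
pose T (i j : 'I_4) := (-1) ^+ eps I i *: ((-1) ^+ eps (I :\ i) j *: c (I :\ i :\ j)).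
have anti i j : i \in I -> j \in I -> (j < i)%N -> T j i = - T i j.
  move=> iI jI ji; rewrite /T !scalerA -scaleNr -!exprD.
  rewrite (_ : I :\ j :\ i = I :\ i :\ j); last by rewrite !setDDl setUC.
  congr (_ *: _); rewrite (epsD1 i jI) (epsD1 j iI) ji.
  by rewrite ltnNge (ltnW ji) /= add0n addSn exprS mulN1r opprK addnC.
rewrite /cechd; transitivity (\sum_(i in I) \sum_(j in I | j != i) T i j).
  apply: eq_bigr => i iI; rewrite scaler_sumr; apply: eq_bigl => j.
  by rewrite !inE andbC.
rewrite (eq_bigr (fun i : 'I_4 => \sum_(j in I | (j < i)%N) T i j +
    \sum_(j in I | (i < j)%N) T i j)); last first.
  move=> i iI; rewrite (bigID (fun j : 'I_4 => (j < i)%N)) /=.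
  congr (_ + _); apply: eq_bigl => j; rewrite -andbA; congr (_ && _).
    by rewrite -val_eqE /= ltn_neqAle andbA andbb.
  by rewrite -leqNgt [RHS]ltn_neqAle -val_eqE eq_sym.
rewrite big_split /= [X in _ + X](exchange_big_dep (mem I)) /=; last first.
  by move=> i j _ /andP[].
rewrite -big_split big1 // => i iI /=.
rewrite [X in _ + X](eq_bigl (fun j => (j \in I) && (j < i)%N)); last first.
  by move=> j; rewrite iI.
rewrite -big_split big1 // => j /andP[jI ji] /=.
by rewrite (anti i j) // subrr.
Qed.

Definition cech_homotopy (i : 'I_4) c J : V :=
  if i \in J then 0 else (-1) ^+ eps J i *: c (i |: J).

(** If [i] is in [I], only the face omitting [i] contributes; otherwise the cocycle condition on
    [i |: I] expresses [c I] by the other faces, which are those of the homotopy up to sign. *)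
Lemma cech_homotopyK i c I : (i \notin I -> cechd c (i |: I) = 0) ->
  cechd (cech_homotopy i c) I = c I.
Proof.
move=> dc; have [iI|iI] := boolP (i \in I).
  rewrite /cechd (bigD1 i) //= [X in _ + X]big1 => [|j /andP[jI ji]].
    rewrite /cech_homotopy setD11 setD1K // scalerA.
    by rewrite -exprD -/(eps I i) (epsD1 i iI) ltnn addnn -signr_odd odd_double scale1r addr0.
  by rewrite /cech_homotopy !inE iI eq_sym ji scaler0.
have := dc iI; rewrite /cechd big_setU1 //=.
have -> : (i |: I) :\ i = I by rewrite setU1K.
move=> E; have -> : c I =
    (-1) ^+ eps (i |: I) i *: ((-1) ^+ eps (i |: I) i *: c I).
  by rewrite scalerA -exprD addnn -signr_odd odd_double scale1r.
move/eqP: E; rewrite addr_eq0 -/(eps _ i) => /eqP ->.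
rewrite scalerN scaler_sumr -sumrN; apply: eq_bigr => j jI.
have ji : j != i by apply: contraNneq iI => <-.
have iU : i \in i |: I by rewrite setU11.
rewrite /cech_homotopy !inE (negPf iI) andbF !scalerA -scaleNr -!exprD.
have -> : (i |: I) :\ j = i |: I :\ j.
  by apply/setP => k; rewrite !inE; case: (k =P i) => [->|//]; rewrite eq_sym ji.
congr (_ *: _); rewrite -/(eps I j) -/(eps (i |: I) j).
rewrite (epsD1 i iU) ltnn setU1K // (epsD1 j iU) setU1K // (epsD1 i jI).
rewrite !add0n -[RHS]mulN1r -exprS.
rewrite -[LHS]signr_odd -[RHS]signr_odd; congr (_ ^+ nat_of_bool _).
move: (eps I j) (eps (I :\ j) i) => p q.
have [lt|gt|/val_inj/eqP] := ltngtP (j : nat) (i : nat); last by rewrite (negPf ji).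
  by clear; lia.
by clear; lia.
Qed.

End CechDifferential.

Lemma div_common (E : fieldType) (x v w : E) : w != 0 -> x * w / (v * w) = x / v.
Proof. by move=> w0; rewrite invfM mulrACA divff // mulr1. Qed.

Lemma clear_denominator (E : fieldType) (c v w : E) m0 M : v != 0 ->
  (m0 <= M)%N -> c * v ^+ (M - m0) * w ^+ M = c / v ^+ m0 * (v * w) ^+ M.
Proof.
move=> v0 le; have vM : v ^+ M = v ^+ (M - m0) * v ^+ m0 by rewrite -exprD subnK.
by rewrite exprMn vM; field; rewrite expf_neq0.
Qed.

(** * Multigraded pieces and Cech exactness for line bundles *)

Section MonomialProjection.
Variables (n : nat) (K : fieldType).
Local Notation R := {mpoly K[n]}.
Implicit Types (p q : R) (S : pred 'X_{1..n}).

Definition mnmproj S p : R := \sum_(m <- msupp p | S m) p@_m *: 'X_[m].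

Lemma mcoeff_mnmproj S p m : (mnmproj S p)@_m = if S m then p@_m else 0.
Proof.
rewrite /mnmproj raddf_sum /= big_mkcond /=.
have [mp|mp] := boolP (m \in msupp p); last first.
  rewrite (memN_msupp_eq0 mp) if_same big_seq big1 // => k kp.
  case: ifP => // _; rewrite mcoeffZ mcoeffX.
  by case: eqP kp mp => [-> ->//|_ _ _]; rewrite mulr0.
rewrite (bigD1_seq m) //= big1_seq ?addr0 => [|k /andP[km _]].
  by case: ifP => // _; rewrite mcoeffZ mcoeffX eqxx mulr1.
by case: ifP => // _; rewrite mcoeffZ mcoeffX (negPf km) mulr0.
Qed.

Lemma msupp_mnmproj S p m : m \in msupp (mnmproj S p) -> S m && (m \in msupp p).
Proof. by rewrite !mcoeff_msupp mcoeff_mnmproj; case: ifP => //; rewrite eqxx. Qed.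

Lemma mnmprojD S : {morph mnmproj S : p q / p + q}.
Proof.
move=> p q; apply/mpolyP => m; rewrite mcoeffD !mcoeff_mnmproj mcoeffD.
by case: ifP; rewrite ?addr0.
Qed.

Lemma mnmproj0 S : mnmproj S 0 = 0.
Proof. by rewrite /mnmproj msupp0 big_nil. Qed.

Lemma mnmprojZ S (c : K) p : mnmproj S (c *: p) = c *: mnmproj S p.
Proof.
apply/mpolyP => m; rewrite mcoeffZ !mcoeff_mnmproj mcoeffZ.
by case: ifP; rewrite ?mulr0.
Qed.

Lemma sum_mnmproj (T : finType) (sel : 'X_{1..n} -> T) p :
  p = \sum_i mnmproj (fun m => sel m == i) p.
Proof.
apply/mpolyP => m; rewrite raddf_sum /= (bigD1 (sel m)) //= big1 => [|i im].
  by rewrite mcoeff_mnmproj eqxx addr0.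
by rewrite mcoeff_mnmproj eq_sym (negPf im).
Qed.

Lemma mnm_divide (mu : 'X_{1..n}) p :
  (forall m, m \in msupp p -> (mu <= m)%MM) -> exists q, p = q * 'X_[mu].
Proof.
move=> h; exists (\sum_(m <- msupp p) p@_m *: 'X_[m - mu]).
rewrite {1}[p]mpolyE mulr_suml big_seq [RHS]big_seq; apply: eq_bigr => m mp.
by rewrite -scalerAl -mpolyXD submK // h.
Qed.

End MonomialProjection.

Section FreeExact.
Variable K : fieldType.
Local Notation R := {mpoly K[4]}.
Local Notation F := {fraction {mpoly K[4]}}.
Implicit Types (I J : {set 'I_4}).

Definition vmnm I : 'X_{1..4} := [multinom (i \in I : nat) | i < 4].

Lemma varprodE I : varprod K I = 'X_[vmnm I].
Proof.
rewrite mpolyXE_id /varprod big_mkcond; apply: eq_bigr => i _.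
by rewrite mnmE; case: ifP; rewrite ?expr1.
Qed.

Lemma varprodC I : varprod K setT = varprod K I * varprod K (~: I).
Proof.
rewrite /varprod (bigID (mem I)) /=; congr (_ * _); apply: eq_bigl => i.
  by rewrite in_setT.
by rewrite !inE.
Qed.

Lemma varprodX_supp I M (p : R) m i :
  m \in msupp (p * varprod K I ^+ M) -> i \in I -> (M <= m i)%N.
Proof.
rewrite varprodE mpolyXn (perm_mem (msuppMX _ _)) => /mapP[m' _ ->] iI.
by rewrite mnmDE mulmnE mnmE iI mul1n leq_addr.
Qed.

Lemma card_setC4 I M : (#|I| * M + #|~: I| * M = 4 * M)%N.
Proof. by rewrite -mulnDl cardsC card_ord. Qed.

(** After multiplication by the [M]-th power of all four variables, having only the variables of [I]
    in the denominator becomes a condition on exponents: those outside [I] are at least [M]. *)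
Lemma loc_clear N I (x : F) : loc (varprod K I) #|I|%:Z N%:Z x ->
  exists m0, forall M, (m0 <= M)%N -> exists p : R,
    [/\ homZ (N + 4 * M)%N%:Z p,
        forall m i, m \in msupp p -> i \notin I -> (M <= m i)%N
      & tofrac p = x * tofrac (varprod K setT) ^+ M].
Proof.
move=> [m0 [c [hc xE]]]; exists m0 => M m0M.
have v0 : tofrac (varprod K I) != 0 by rewrite tofrac_eq0 varprod_neq0.
exists (c * varprod K I ^+ (M - m0) * varprod K (~: I) ^+ M); split.
- rewrite (_ : (N + 4 * M)%N%:Z = N%:Z + #|I|%:Z * m0%:Z +
    #|I|%:Z * (M - m0)%N%:Z + #|~: I|%:Z * M%:Z); last first.
    rewrite -(card_setC4 I) -{1}(subnKC m0M) mulnDr; lia.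
  by apply: homZM; [apply: homZM => //|]; apply/homZX/homZ_varprod.
- by move=> m i mp iI; apply: varprodX_supp mp _; rewrite inE.
- by rewrite xE (varprodC I) !(tofracM, tofracXn) clear_denominator.
Qed.

(* Contract the multigraded piece of exponent m along an index i with
   m_i >= 0; one exists since the total degree is nonnegative. *)
Lemma free_cech_exact n (N : nat) (c : {set 'I_4} -> F^o) :
  (forall I, #|I| = n -> loc (varprod K I) #|I|%:Z N%:Z (c I)) ->
  (forall I, #|I| = n.+1 -> cechd c I = 0) ->
  exists c' : {set 'I_4} -> F^o,
    (forall J, #|J|.+1 = n -> loc (varprod K J) #|J|%:Z N%:Z (c' J)) /\
    forall I, #|I| = n -> c I = cechd c' I.
Proof.
move=> lc dc.
have /choice[m0 hm0] : forall I, exists m0 : nat, #|I| = n ->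
    forall M, (m0 <= M)%N -> exists p : R,
    [/\ homZ (N + 4 * M)%N%:Z p,
        forall m i, m \in msupp p -> i \notin I -> (M <= m i)%N
      & tofrac p = c I * tofrac (varprod K setT) ^+ M].
  move=> I; have [cI|cI] := eqVneq #|I| n; last first.
    by exists 0%N => /eqP; rewrite (negPf cI).
  by have [m0 h] := loc_clear (lc I cI); exists m0.
pose M := (\max_(I : {set 'I_4}) m0 I)%N.
have /choice[P hP] : forall I, exists p : R, [/\ homZ (N + 4 * M)%N%:Z p,
    forall m i, m \in msupp p -> i \notin I -> (M <= m i)%N
  & tofrac p = (if #|I| == n then c I else 0) * tofrac (varprod K setT) ^+ M].
  move=> I; case: eqP => cI; last first.
    exists 0; rewrite mul0r tofrac0; split=> [|m i|]; rewrite ?msupp0 //.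
    exact: homZ0.
  by apply: (hm0 I cI); apply: (@leq_bigmax _ m0 I).
have dP I : #|I| = n.+1 -> cechd (P : {set 'I_4} -> R^o) I = 0.
  move=> cI; apply: (@tofrac_inj K).
  rewrite tofrac0 /cechd (raddf_sum (@tofrac R)) /=.
  transitivity (cechd c I * tofrac (varprod K setT) ^+ M); last first.
    by rewrite dc // mul0r.
  rewrite /cechd mulr_suml; apply: eq_bigr => i iI.
  have [_ _ E] := hP (I :\ i).
  have ci : #|I :\ i| == n.
    by move: (cardsD1 i I); rewrite iI cI add1n => -[->].
  by rewrite tofracM E ci tofracXn tofracN tofrac1 mulrA.
(* An exponent at least [M] is one that was nonnegative before denominators were cleared. A monomial
   of degree [N + 4 * M] has one, so the default [ord0] is not reached for it. *)
pose sel (m : 'X_{1..4}) : 'I_4 := odflt ord0 [pick i | (M <= m i)%N].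
have selP (m : 'X_{1..4}) : mdeg m = (N + 4 * M)%N -> (M <= m (sel m))%N.
  rewrite /sel; case: pickP => //= none; rewrite mdegE => dm.
  have lt i : (m i < M)%N by rewrite ltnNge none.
  have : (\sum_(i < 4) m i <= \sum_(i < 4) M.-1)%N.
    by apply: leq_sum => i _; move: (lt i); case: (M).
  by rewrite dm sum_nat_const card_ord; move: (lt ord0); clear; lia.
pose pr i := mnmproj (fun m => sel m == i) : R -> R.
pose Pr i : {set 'I_4} -> R^o := fun I => pr i (P I).
have dPr i I : #|I| = n.+1 -> cechd (Pr i) I = 0.
  move=> cI; rewrite -[RHS](@mnmproj0 _ K (fun m => sel m == i)) -(dP I cI) /cechd.
  rewrite [RHS](big_morph _ (@mnmprojD _ K _) (@mnmproj0 _ K _)); apply: eq_bigr => j _.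
  rewrite /Pr -signr_odd -[in RHS]signr_odd.
  case: odd; rewrite ?expr1 ?expr0 ?scale1r // !scaleN1r.
  by rewrite -!(scaleN1r _ : (-1 : K) *: _ = _) mnmprojZ.
pose bJ i := cech_homotopy i (Pr i).
pose b J : R := \sum_i bJ i J.
have PE I : #|I| = n -> P I = cechd (b : {set 'I_4} -> R^o) I.
  move=> cI; rewrite [LHS](sum_mnmproj sel) /b.
  rewrite (cechd_sum (V := R^o)); apply: eq_bigr => i _.
  rewrite /bJ (@cech_homotopyK _ R^o) // => iI.
  by apply: dPr; rewrite cardsU1 iI cI.
have hb J : homZ (N + 4 * M)%N%:Z (b J) /\
    forall m l, m \in msupp (b J) -> l \notin J -> (M <= m l)%N.
  suff H i : homZ (N + 4 * M)%N%:Z (bJ i J) /\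
      forall m l, m \in msupp (bJ i J : R) -> l \notin J -> (M <= m l)%N.
    split; first by apply: homZ_sum => i _; case: (H i).
    move=> m l mb lJ; apply: contraTT mb => nM.
    rewrite -mcoeff_eq0 raddf_sum big1 //= => i _.
    by apply/eqP; rewrite mcoeff_eq0; apply: contra nM => mb; case: (H i) => _ ->.
  rewrite /bJ /cech_homotopy; case: ifP => iJ.
    by split; [apply: homZ0 | move=> m l; rewrite msupp0].
  have [hPi Pi _] := hP (i |: J).
  have Hm m : m \in msupp (Pr i (i |: J) : R) ->
      [/\ sel m = i, mdeg m = (N + 4 * M)%N & forall l, l \notin i |: J -> (M <= m l)%N].
    move=> /msupp_mnmproj /= /andP[/eqP -> mP]; split=> //.
      by have [] := homZP hPi m mP.
    by move=> l; apply: Pi.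
  have sgn (k : nat) (p : R) : msupp ((-1) ^+ k *: (p : R^o) : R) =i msupp p.
    move=> m; rewrite -signr_odd; case: odd; last by rewrite scale1r.
    by rewrite expr1 scaleN1r (perm_mem (msuppN p)).
  split.
    by apply/homZP => m; rewrite sgn => /Hm[_ ->].
  move=> m l; rewrite sgn => /Hm[smi dm hm] lJ.
  (* Contraction along [i] removes [X_i] from the allowed denominators; this is harmless because
     [sel] chose an exponent at least [M]. *)
  have [->|li] := eqVneq l i; first by rewrite -smi selP.
  by apply: hm; rewrite !inE negb_or li.
have X0 : tofrac (varprod K setT) ^+ M != 0.
  by rewrite expf_neq0 // tofrac_eq0 varprod_neq0.
exists (fun J => tofrac (b J) / tofrac (varprod K setT) ^+ M); split.
  move=> J _; have [hbJ sJ] := hb J.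
  have [|b' bE] := @mnm_divide _ _ (vmnm (~: J) *+ M)%MM (b J).
    move=> m mb; apply/mnm_lepP => l; rewrite mulmnE mnmE inE.
    by case: (boolP (l \in J)) => lJ; rewrite ?mul0n // mul1n sJ.
  exists M, b'; split; last first.
    rewrite bE -mpolyXn -varprodE (varprodC J) !tofracM !tofracXn exprMn.
    by apply: div_common; rewrite expf_neq0 // tofrac_eq0 varprod_neq0.
  have v0 : varprod K (~: J) ^+ M != 0 by rewrite expf_neq0 // varprod_neq0.
  apply: (homZ_divl v0 (homZX M (homZ_varprod K (~: J)))).
  rewrite varprodE mpolyXn (mulrC _ b') -bE.
  by rewrite (_ : _ + _ = (N + 4 * M)%N%:Z) // -(card_setC4 J); lia.
move=> I cI; have [_ _ E] := hP I; rewrite cI eqxx in E.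
apply: (mulIf X0); rewrite -E PE // /cechd (raddf_sum (@tofrac R)) mulr_suml.
apply: eq_bigr => i _ /=; rewrite tofracM tofracXn tofracN tofrac1.
by rewrite /GRing.scale /= -mulrA divfK.
Qed.

End FreeExact.

Lemma mul_div_swap (E : fieldType) (x y c : E) : y != 0 -> x * y * (c / y) = c * x.
Proof. by move=> y0; field. Qed.

(** * Vanishing for cokernels by dimension shifting *)

Section SerreVanishing.
Variable K : fieldType.
Local Notation R := {mpoly K[4]}.
Local Notation F := {fraction {mpoly K[4]}}.
Local Notation tomx := (map_mx (@tofrac R)).
Local Notation vp := (varprod K).
Implicit Types (I J : {set 'I_4}).

Definition vloc r (a : 'I_r -> int) (t : int) I (w : 'cV[F]_r) :=
  forall i, loc (vp I) #|I|%:Z (a i + t) (w i 0).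

Definition loc_im r s (B : 'M[R]_(r, s)) (b : 'I_s -> int) t I (w : 'cV[F]_r) :=
  exists2 u, vloc b t I u & w = tomx B *m u.

(* Exactness at the sets of n elements of the Cech complex of coker B, augmented
   by coker B itself at the empty set. *)
Definition cech_exact n (t : int) r s (B : 'M[R]_(r, s)) a b :=
  forall c : {set 'I_4} -> 'cV[F]_r,
  (forall I, #|I| = n -> vloc a t I (c I)) ->
  (forall I, #|I| = n.+1 -> loc_im B b t I (cechd c I)) ->
  exists c', (forall J, #|J|.+1 = n -> vloc a t J (c' J)) /\
    forall I, #|I| = n -> loc_im B b t I (c I - cechd c' I).

Lemma locD y e n (x z : F) : homZ e y -> y != 0 ->
  loc y e n x -> loc y e n z -> loc y e n (x + z).
Proof.
move=> hy y0 [m [c [hc ->]]] [m' [c' [hc' ->]]].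
exists (m + m')%N, (c * y ^+ m' + c' * y ^+ m); split; last first.
  by rewrite addf_div ?expf_neq0 ?tofrac_eq0 // exprD !(tofracD, tofracM, tofracXn).
apply: homZD.
  rewrite (_ : _ + _ = (n + e * m%:Z) + e * m'%:Z); last by lia.
  by apply: homZM => //; apply: homZX.
rewrite (_ : _ + _ = (n + e * m'%:Z) + e * m%:Z); last by lia.
by apply: homZM => //; apply: homZX.
Qed.

Lemma locMr y e n k (p : R) (x : F) : homZ k p -> loc y e n x ->
  loc y e (k + n) (tofrac p * x).
Proof.
move=> hp [m [c [hc ->]]]; exists m, (p * c); split; last by rewrite tofracM mulrA.
by rewrite -addrA; apply: homZM.
Qed.

Lemma loc0 y e n : loc y e n (0 : F).
Proof. by exists 0%N, 0; rewrite tofrac0 mul0r; split=> //; apply: homZ0. Qed.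

Section Fixed.
Variables (r s : nat) (B : 'M[R]_(r, s)) (a : 'I_r -> int) (b : 'I_s -> int).
Hypothesis hB : bhom B a b.

Lemma vlocD t I u v : vloc b t I u -> vloc b t I v -> vloc b t I (u + v).
Proof.
by move=> hu hv i; rewrite mxE; apply: locD (homZ_varprod K I) (varprod_neq0 K I) _ _.
Qed.

Lemma vlocN t I u : vloc b t I u -> vloc b t I (- u).
Proof.
move=> hu i; rewrite mxE -mulN1r -tofrac1 -tofracN -[b i + t]add0r.
by apply: locMr (hu i); apply/homZN/homZ1.
Qed.

Lemma vlocB t I u v : vloc b t I u -> vloc b t I v -> vloc b t I (u - v).
Proof. by move=> hu hv; apply/vlocD/vlocN. Qed.

Lemma vlocM t I u : vloc b t I u -> vloc a t I (tomx B *m u).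
Proof.
move=> hu i; rewrite mxE; apply: big_ind; first exact: loc0.
  by move=> x z; apply: locD (homZ_varprod K I) (varprod_neq0 K I).
move=> j _; rewrite mxE (_ : a i + t = (a i - b j) + (b j + t)); last by lia.
exact: locMr.
Qed.

Lemma loc_sub I J n (x : F) : I \subset J -> loc (vp I) #|I|%:Z n x ->
  loc (vp J) #|J|%:Z n x.
Proof.
move=> IJ [m [c [hc ->]]].
have E : vp J = vp I * vp (J :\: I).
  rewrite /varprod (bigID (mem I)) /=; congr (_ * _); apply: eq_bigl => k.
    by case: (boolP (k \in I)) => kI; rewrite ?andbF // (subsetP IJ).
  by rewrite inE andbC.
exists m, (c * vp (J :\: I) ^+ m); split.
  have -> : #|J|%:Z = #|I|%:Z + #|J :\: I|%:Z.
    by rewrite cardsD (setIidPr IJ) -PoszD subnKC // subset_leq_card.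
  by rewrite mulrDl addrA; apply: homZM => //; apply/homZX/homZ_varprod.
have v0 : tofrac (vp (J :\: I)) ^+ m != 0.
  by rewrite expf_neq0 // tofrac_eq0 varprod_neq0.
by rewrite E !(tofracM, tofracXn) exprMn div_common.
Qed.

Lemma vloc_cechd t I c : (forall J, #|J|.+1 = #|I| -> vloc b t J (c J)) ->
  vloc b t I (cechd c I).
Proof.
move=> hc i; rewrite /cechd summxE; apply: big_ind; first exact: loc0.
  by move=> x z; apply: locD (homZ_varprod K I) (varprod_neq0 K I).
move=> j jI; rewrite mxE.
have -> : (-1) ^+ #|[set k in I | (k < j)%N]| =
    tofrac ((-1) ^+ #|[set k in I | (k < j)%N]| : R).
  by rewrite tofracXn tofracN tofrac1.
rewrite -[b i + t]add0r; apply: locMr.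
  rewrite -signr_odd; case: odd; rewrite ?expr0 ?expr1; last exact: homZ1.
  exact/homZN/homZ1.
apply: (loc_sub (subD1set I j)); apply: hc.
by rewrite (cardsD1 j I) jI.
Qed.

Lemma vloc_clear t I (w : 'cV[F]_s) : vloc b t I w -> exists (m : nat) v,
  vhom b (t + #|I|%:Z * m%:Z) v /\ tofrac (vp I) ^+ m *: w = tomx v.
Proof.
have v0 : tofrac (vp I) != 0 by rewrite tofrac_eq0 varprod_neq0.
move=> hw; have /choice[m hm] := hw.
pose M := (\max_i m i)%N.
have /choice[v hv] : forall i, exists v : R,
    homZ (b i + (t + #|I|%:Z * M%:Z)) v /\ tofrac (vp I) ^+ M * w i 0 = tofrac v.
  move=> i; have [c [hc ->]] := hm i.
  have miM : (m i <= M)%N by apply: (@leq_bigmax _ m i).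
  exists (c * vp I ^+ (M - m i)); split.
    rewrite (_ : b i + _ = (b i + t + #|I|%:Z * (m i)%:Z) + #|I|%:Z * (M - m i)%N%:Z).
      by apply: homZM => //; apply/homZX/homZ_varprod.
    by rewrite -[in LHS](subnKC miM) PoszD mulrDr !addrA.
  rewrite -[in LHS](subnK miM) exprD tofracM tofracXn.
  by apply: mul_div_swap; rewrite expf_neq0.
exists M, (\col_i v i); split; first by move=> i; rewrite mxE; case: (hv i).
by apply/matrixP => i j; rewrite !mxE ord1; case: (hv i).
Qed.

(** [subset_fg] applied to the homogeneous kernel elements gives the columns of [C]; a column of
    degree [t] receives the twist [- t]. *)
Lemma syzygies : exists u (C : 'M[R]_(s, u)) c, [/\ bhom C b c, B *m C = 0
  & forall t v, vhom b t v -> B *m v = 0 -> exists x, v = C *m x].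
Proof.
have [L HL genL] := @subset_fg K 4 s (fun v => (exists t, vhom b t v) /\ B *m v = 0).
have Lk (k : 'I_(size L)) : L`_k \in L by rewrite mem_nth.
have /choice[c hc] : forall k : 'I_(size L), exists t, vhom b t L`_k.
  by move=> k; have [] := HL _ (Lk k).
exists (size L), (\matrix_(i, k) L`_k i 0), (fun k => - c k); split.
- by move=> i k; rewrite mxE opprK; apply: hc.
- apply/matrixP => i k; have [_ E] := HL _ (Lk k).
  have := congr1 (fun z : 'cV[R]_r => z i 0) E.
  rewrite [LHS]mxE [RHS]mxE => E'; rewrite [RHS]mxE -E' mxE.
  by apply: eq_bigr => j _; rewrite mxE.
- move=> t v hv Bv; have [x vE] := rspan_seq (genL v (conj (ex_intro _ t hv) Bv)).
  exists (\col_k x k); rewrite vE; apply/matrixP => i j.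
  rewrite summxE mxE; apply: eq_bigr => k _; rewrite !mxE ord1; exact: mulrC.
Qed.

End Fixed.

Lemma cechd_mulmx r s (A : 'M[F]_(r, s)) (c : {set 'I_4} -> 'cV[F]_s) I :
  cechd (fun J => A *m c J) I = A *m cechd c I.
Proof.
by rewrite /cechd mulmx_sumr; apply: eq_bigr => i _; rewrite scalemxAr.
Qed.

Lemma cechd_entry r (c : {set 'I_4} -> 'cV[F]_r) I i :
  cechd c I i 0 = cechd (fun J => c J i 0 : F^o) I.
Proof. by rewrite /cechd summxE; apply: eq_bigr => j _; rewrite mxE. Qed.

(** Descending induction on [n], trivial beyond four indices. A lift [y] of the differential of [e]
    to the source is a cocycle modulo syzygies, so the case [n.+1] for the syzygy matrix [C] makes
    it the differential of some [y'] modulo [C]. Subtracting the image of [y'] from [e] leaves a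
    cocycle of line bundles. *)
Lemma serre_vanishing n r s (B : 'M[R]_(r, s)) a b : bhom B a b ->
  exists t0 : nat, forall t : nat, (t0 <= t)%N -> cech_exact n t%:Z B a b.
Proof.
have [k] := ubnP (5 - n)%N; elim: k => // k IHk in n r s B a b * => nk hB.
have [n5|n5] := leqP 5 n.
  exists 0%N => t _ c _ _; exists (fun=> 0); split=> [J|I] cJ.
    by move=> i; rewrite mxE; apply: loc0.
  have := max_card (mem I); rewrite card_ord => le4.
  by move: n5; rewrite -cJ ltnNge le4.
have [u [C [c [hC BC genC]]]] := syzygies B b.
have [|t1 ht1] := IHk n.+1 _ _ C b c _ hC; first by lia.
(* The second summand makes all twists [a i + t] nonnegative, as [free_cech_exact] requires. *)
exists (t1 + \max_i absz (a i))%N => t tt1 e le de.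
have /choice[y hy] : forall I, exists y, #|I| = n.+1 ->
    vloc b t I y /\ cechd e I = tomx B *m y.
  move=> I; have [cI|cI] := eqVneq #|I| n.+1.
    by have [y h1 h2] := de I cI; exists y.
  by exists 0 => /eqP; rewrite (negPf cI).
have [|||y' [ly' hy']] := ht1 t _ y.
- by apply: leq_trans tt1; rewrite leq_addr.
- by move=> I /hy[].
- move=> I cI; set z := cechd y I.
  have lz : vloc b t I z.
    apply: vloc_cechd => J cJ.
    have cJ' : #|J| = n.+1 by move: cJ; rewrite cI => -[].
    by have [] := hy J cJ'.
  have Bz : tomx B *m z = 0.
    rewrite /z -cechd_mulmx -[RHS](cechd_cechd e I); apply: eq_cechd => J cJ.
    have cJ' : #|J| = n.+1 by move: cJ; rewrite cI => -[].
    by have [_ ->] := hy J cJ'.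
  have [m [v [hv vE]]] := vloc_clear lz.
  have v0 : tofrac (vp I) ^+ m != 0.
    by rewrite expf_neq0 // tofrac_eq0 varprod_neq0.
  have Bv : B *m v = 0.
    apply/matrixP => i j; apply: (@tofrac_inj K).
    have := congr1 (fun z : 'cV[F]_r => z i j) (map_mxM (@tofrac R) B v).
    by rewrite -vE -scalemxAr Bz scaler0 !mxE tofrac0.
  have [x vx] := genC _ v hv Bv; have [x' hx' vx'] := hom_preimage hC hv vx.
  exists ((tofrac (vp I) ^+ m)^-1 *: tomx x').
    move=> j; exists m, (x' j 0); split; first by rewrite -addrA.
    by rewrite !mxE mulrC.
  by rewrite -scalemxAr -map_mxM -vx' -vE scalerA mulVf // scale1r.
pose e' I := e I - tomx B *m y' I.
have le' I : #|I| = n -> vloc a t I (e' I).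
  move=> cI; apply: vlocB; first exact: le.
  by apply: (vlocM hB); apply: ly'; rewrite cI.
have de' I : #|I| = n.+1 -> cechd e' I = 0.
  move=> cI; rewrite cechdB cechd_mulmx; have [_ ->] := hy I cI.
  rewrite -mulmxBr; have [x _ ->] := hy' I cI.
  by rewrite mulmxA -map_mxM BC map_mx0 mul0mx.
have /choice[f hf] : forall i, exists f : {set 'I_4} -> F^o,
    (forall J, #|J|.+1 = n -> loc (vp J) #|J|%:Z (a i + t%:Z) (f J)) /\
    forall I, #|I| = n -> e' I i 0 = cechd f I.
  move=> i; have aE : a i + t%:Z = (absz (a i + t%:Z))%:Z.
    have : (absz (a i) <= t)%N.
      apply: leq_trans (leq_trans (leq_addl _ _) tt1).
      exact: (@leq_bigmax _ (fun i => absz (a i)) i).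
    lia.
  rewrite aE; apply: free_cech_exact => I cI; first by rewrite -aE; apply: le'.
  by rewrite -cechd_entry de' // mxE.
exists (fun J => \col_i f i J); split=> [J cJ i|I cI].
  by rewrite mxE; have [h _] := hf i; apply: h.
exists (y' I); first by apply: ly'; rewrite cI.
suff <- : e' I = cechd (fun J => \col_i f i J) I by rewrite /e' opprB addrC subrK.
apply/matrixP => i j; rewrite ord1 cechd_entry; have [_ /(_ I cI) ->] := hf i.
by apply: (@eq_cechd _ F^o) => J _; rewrite mxE.
Qed.

End SerreVanishing.

Lemma mem_lker_linear (K : fieldType) (X Y : vectType K) (J : {linear X -> Y}) x :
  (x \in lker (linfun J)) = (J x == 0).
Proof. by rewrite memv_ker lfunE. Qed.

Lemma mem_limg_linear (K : fieldType) (X Y : vectType K) (J : {linear X -> Y})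
    (U : {vspace X}) y :
  reflect (exists2 x, x \in U & y = J x) (y \in linfun J @: U)%VS.
Proof.
by apply: (iffP memv_imgP) => -[x xU ->]; exists x; rewrite ?lfunE.
Qed.

(** The map sending [(a, x)] to [\sum_k a 0 k *: y k + J x] is onto, and its kernel projects
    isomorphically onto that of [J]; rank-nullity concludes. *)
Lemma basis_complement_dim (K : fieldType) (X Y : vectType K) (J : {linear X -> Y})
    (N : nat) (y : 'I_N -> Y) :
  (forall w, exists (a : 'rV[K]_N) x, w = \sum_k a 0 k *: y k + J x) ->
  (forall (a : 'rV[K]_N) x, \sum_k a 0 k *: y k + J x = 0 -> a = 0) ->
  (N + \dim {:X} = \dim {:Y} + \dim (lker (linfun J)))%N.
Proof.
move=> gen indep.
pose P (u : 'rV[K]_N * X) : Y := \sum_k u.1 0 k *: y k + J u.2.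
have P_lin : linear P.
  move=> c u v; rewrite /P (linearP J) scalerDr addrACA; congr (_ + _).
  rewrite scaler_sumr -big_split; apply: eq_bigr => k _ /=.
  by rewrite !mxE scalerDl scalerA.
pose PL : {linear ('rV[K]_N * X)%type -> Y} :=
  HB.pack P (GRing.isLinear.Build _ _ _ _ P P_lin).
pose Q (u : 'rV[K]_N * X) : X := u.2.
have Q_lin : linear Q by [].
pose QL : {linear ('rV[K]_N * X)%type -> X} :=
  HB.pack Q (GRing.isLinear.Build _ _ _ _ Q Q_lin).
have QE u : linfun QL u = u.2 by exact: (lfunE QL).
have PE u : linfun PL u = P u by exact: (lfunE PL).
have JE x : linfun J x = J x by exact: (lfunE J).
have := limg_ker_dim (linfun PL) fullv; rewrite capfv.
have -> : limg (linfun PL) = fullv.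
  apply/vspaceP => w; rewrite memvf; have [a [x ->]] := gen w.
  by apply/memv_imgP; exists (a, x); rewrite ?memvf // PE.
have <- : (linfun QL @: lker (linfun PL))%VS = lker (linfun J).
  apply/vspaceP => x; rewrite memv_ker JE; apply/memv_imgP/eqP.
    move=> [[a x'] kx]; rewrite QE /= => ->; move: kx.
    rewrite memv_ker PE => /eqP H; have a0 := indep a x' H.
    by rewrite -H /P /= a0 big1 ?add0r // => k _; rewrite mxE scale0r.
  move=> Jx; exists (0, x); last by rewrite QE.
  rewrite memv_ker PE /P /= Jx addr0 big1 // => k _.
  by rewrite mxE scale0r.
rewrite limg_dim_eq; last first.
  apply/vspaceP => -[a x]; rewrite memv_cap !memv_ker QE PE memv0 /=.
  apply/andP/eqP => [[/eqP H /eqP Qx]|[-> ->]].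
    by rewrite (indep a x H) Qx.
  split; rewrite // /P /= linear0 addr0 big1 // => k _.
  by rewrite mxE scale0r.
have -> : \dim {:('rV[K]_N * X)%type} = (N + \dim {:X})%N.
  by rewrite !dimvf -[N in RHS]mul1n.
by rewrite addnC.
Qed.

(** * The Hilbert polynomial of the cokernel *)

Section Cohomology.
Variable K : fieldType.
Local Notation R := {mpoly K[4]}.
Local Notation F := {fraction {mpoly K[4]}}.
Local Notation tomx := (map_mx (@tofrac R)).
Local Notation cover := (@Defs.cover K).
Local Notation scalar := (@Defs.scalar K).
Implicit Types (t : int) (q : point K) (I : {set 'I_4}).

Variables (f g : R) (df dg : nat).
Hypotheses (hf : f \is (df.+1).-homog) (hg : g \is (dg.+1).-homog).

Local Notation JM := (jacR f g).
Local Notation tgt := (tgt df dg).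
Local Notation stalk_im := (stalk_im f g).

Lemma stalk_imD t q u v : stalk_im t q u -> stalk_im t q v -> stalk_im t q (u + v).
Proof. by rewrite !stalk_imP; apply: local_imD. Qed.

Lemma stalk_imN t q u : stalk_im t q u -> stalk_im t q (- u).
Proof. by rewrite !stalk_imP; apply: local_imN. Qed.

Lemma stalk_imB t q u v : stalk_im t q u -> stalk_im t q v -> stalk_im t q (u - v).
Proof. by rewrite !stalk_imP; apply: local_imB. Qed.

Lemma stalk_im0 t q : stalk_im t q 0.
Proof. by rewrite stalk_imP; apply: local_im0. Qed.

Lemma stalk_imZ t q (p : R) u : homZ 0 p -> stalk_im t q u ->
  stalk_im t q (tofrac p *: u).
Proof.
move=> hp [v hv ->]; exists (tofrac p *: v); last by rewrite scalemxAr.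
by move=> j; rewrite mxE -[src_deg t j]add0r; apply: stalkM (hv j); apply: stalk_hom.
Qed.

Lemma stalk_im_cechd t q (c : {set 'I_4} -> 'cV[F]_2) I :
  (forall J : {set 'I_4}, #|J|.+1 = #|I| -> J \subset I -> stalk_im t q (c J)) ->
  stalk_im t q (cechd c I).
Proof.
move=> h; rewrite /cechd; apply: big_ind; first exact: stalk_im0.
  by move=> u v; apply: stalk_imD.
move=> i iI; have : stalk_im t q (c (I :\ i)).
  by apply: h; rewrite ?subD1set // [in RHS](cardsD1 i) iI.
rewrite -signr_odd; case: odd; rewrite ?expr0 ?scale1r // expr1 scaleN1r.
exact: stalk_imN.
Qed.

Lemma card_exists n I : #|I| = n.+1 -> exists i, i \in I.
Proof. by move=> cI; apply/set0Pn; rewrite -card_gt0 cI. Qed.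

Lemma cover_sub I I' q : I' \subset I -> cover I q -> cover I' q.
Proof. by move=> /subsetP sub cq i /sub; apply: cq. Qed.

Lemma loc_im_cover t n I (w : 'cV[F]_2) : #|I| = n.+1 -> vloc tgt t I w ->
  (forall q, cover I q -> stalk_im t q w) -> loc_im JM src t I w.
Proof.
move=> /card_exists[i iI] hw him.
have [j|u hu ->] := local_image_cover hf hg iI _ him.
  exact: loc_hfrac_var (hw j).
by exists u; [move=> j; rewrite /src add0r | rewrite jacobianE].
Qed.

Lemma stalk_loc_im t I q w : cover I q -> loc_im JM src t I w -> stalk_im t q w.
Proof.
move=> cq [u hu ->]; exists u; last by rewrite jacobianE.
by move=> j; have := loc_stalk_cover cq (hu j); rewrite /src add0r.
Qed.

(** Families of germs are replaced by honest fractions, by [sectQ_local]. The cochain [b] is a Cech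
    primitive when [n] is positive; when [n] is 0 it is a single global element, indexed by the
    empty set. *)
Lemma cocycle_global t n (c : cochain K) : cech_exact n.+1 t JM tgt src ->
  cech_cocycle f g df dg t n c -> exists b : {set 'I_4} -> 'cV[F]_2,
  (forall I, #|I| = n -> vloc tgt t I (b I)) /\
  forall I, #|I| = n.+1 -> forall q, cover I q ->
    stalk_im t q (c I q - cechd b I).
Proof.
move=> ex [hc dc].
have /choice[w hw] : forall I, exists w : 'cV[F]_2, #|I| = n.+1 ->
    vloc tgt t I w /\ forall q, cover I q -> stalk_im t q (c I q - w).
  move=> I; have [cI|cI] := eqVneq #|I| n.+1; last first.
    by exists 0 => /eqP; rewrite (negPf cI).
  have [i iI] := card_exists cI.
  by have [w h1 h2] := sectQ_local hf hg iI (hc I cI); exists w.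
have wdc I q : #|I| = n.+2 -> cover I q -> stalk_im t q (cechd w I).
  move=> cI cq; have := dc I cI q cq.
  rewrite subr0 (_ : cech_d c I q = cechd (fun I' => c I' q) I) // => h1.
  have -> : cechd w I = cechd (fun I' => c I' q) I - cechd (fun I' => c I' q - w I') I.
    by rewrite -cechdB; apply: eq_cechd => J' _; rewrite subKr.
  apply: stalk_imB => //; apply: stalk_im_cechd => I' cI' sub.
  have cI'' : #|I'| = n.+1 by move: cI'; rewrite cI => -[].
  by have [_] := hw I' cI''; apply; apply: cover_sub cq.
have [|I cI|b [hb hwb]] := ex w; first by move=> I /hw[].
  apply: (loc_im_cover cI); last by move=> q; apply: wdc.
  apply: vloc_cechd => I' cI'.
  have cI'' : #|I'| = n.+1 by move: cI'; rewrite cI => -[].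
  by have [] := hw I' cI''.
exists b; split=> [I cI|I cI q cq]; first by apply: hb; rewrite cI.
rewrite -[c I q](subrK (w I)) -addrA; apply: stalk_imD.
  by have [_] := hw I cI; apply.
by apply: stalk_loc_im cq _; apply: hwb.
Qed.

Lemma sectQ_const t I (w : 'cV[F]_2) : vloc tgt t I w ->
  sectQ f g df dg t (cover I) (fun=> w).
Proof.
move=> hw p cp; exists (cover I), w; split=> //.
- exact: zopen_cover.
- by move=> j q cq; apply: loc_stalk_cover cq (hw j).
- by move=> q _ _; rewrite subrr; apply: stalk_im0.
Qed.

Lemma vloc0 r (a : 'I_r -> int) t I : vloc a t I (0 : 'cV[F]_r).
Proof. by move=> i; rewrite mxE; apply: loc0. Qed.

Lemma cech_d_const (b : {set 'I_4} -> 'cV[F]_2) I q :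
  cech_d (fun I' _ => b I') I q = cechd b I.
Proof. by []. Qed.

Lemma cocycle0 t n : cech_cocycle f g df dg t n (fun _ _ => 0).
Proof.
split=> [I _|I _ q _]; first exact/sectQ_const/vloc0.
rewrite cech_d_const subr0 /cechd big1 => [|i _]; first exact: stalk_im0.
by rewrite scaler0.
Qed.

Lemma dimH_vanish t n N : (forall c, cech_cocycle f g df dg t n c ->
  cech_coboundary f g df dg t n c) -> dimH f g df dg t n N -> N = 0%N.
Proof.
case: N => // N van [e [he uniq]]; exfalso.
have [a [_ ha]] := uniq _ (he ord0).
have h1 := ha 0; have h2 := ha (\row_k (k == ord0)%:R).
have : 0 = \row_(k < N.+1) (k == ord0)%:R :> 'rV[K]_N.+1.
  rewrite -h1 ?h2 //.
  - have -> : (fun I q => e ord0 I q - \sum_(k < N.+1)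
        scalar ((\row_k (k == ord0)%:R) 0 k) *: e k I q) = (fun _ _ => 0).
      apply/funext => I; apply/funext => q; rewrite (bigD1 ord0) //= mxE eqxx.
      rewrite /Defs.scalar mpolyC1 tofrac1 scale1r big1 ?addr0 ?subrr // => k k0.
      by rewrite mxE (negPf k0) mpolyC0 tofrac0 scale0r.
    exact/van/cocycle0.
  - have -> : (fun I q => e ord0 I q - \sum_(k < N.+1)
        scalar ((0 : 'rV[K]_N.+1) 0 k) *: e k I q) = e ord0.
      apply/funext => I; apply/funext => q; rewrite big1 ?subr0 // => k _.
      by rewrite mxE /Defs.scalar mpolyC0 tofrac0 scale0r.
    exact/van/he.
move/matrixP => /(_ 0 ord0); rewrite !mxE eqxx => /eqP.
by rewrite eq_sym oner_eq0.
Qed.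

Lemma higher_vanish t n c : cech_exact n.+2 t JM tgt src ->
  cech_cocycle f g df dg t n.+1 c -> cech_coboundary f g df dg t n.+1 c.
Proof.
move=> ex /(cocycle_global ex)[b [hb hcb]]; exists (fun I _ => b I).
  by move=> I cI; apply/sectQ_const/hb.
by move=> I cI q cq; rewrite cech_d_const; apply: hcb.
Qed.

Section GlobalSections.
Variable t : nat.
Local Notation X := {ffun 'I_4 -> dhomog 4 K t}.
Local Notation Y := (dhomog 4 K (df + t) * dhomog 4 K (dg + t))%type.

Definition colX (x : X) : 'cV[R]_4 := \col_j val (x j).
Definition colY (y : Y) : 'cV[R]_2 := \col_i (if i == 0 then val y.1 else val y.2).

(** [indhomog] only packages homogeneous polynomials: [colY_jac] shows that no entry is lost to its
    default value. *)
Definition jac_t (x : X) : Y :=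
  (indhomog (df + t) ((JM *m colX x) 0 0), indhomog (dg + t) ((JM *m colX x) 1 0)).

Lemma homZ_dhomog d (p : dhomog 4 K d) : homZ d%:Z (val p).
Proof. by rewrite homZ_nat; apply: dhomog_is_dhomog. Qed.

Lemma val_indhomog d (p : R) : homZ d%:Z p -> val (indhomog d p) = p.
Proof. by rewrite homZ_nat => hp; rewrite insubdK. Qed.

Lemma vhom_colX x : vhom src t (colX x).
Proof. by move=> j; rewrite mxE /src add0r; apply: homZ_dhomog. Qed.

Lemma vhom_colY y : vhom tgt t (colY y).
Proof.
by move=> i; rewrite mxE /tgt; case: ifP => _; rewrite -PoszD; apply: homZ_dhomog.
Qed.

Lemma ord2P (i : 'I_2) : i = 0 \/ i = 1.
Proof. by case: i => [[|[|]]] // lt; [left|right]; apply: val_inj. Qed.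

Lemma colY_jac x : colY (jac_t x) = JM *m colX x.
Proof.
have h i : homZ (tgt i + t) ((JM *m colX x) i 0).
  have <- : compv tgt t (JM *m colX x) = JM *m colX x.
    rewrite (compvM (bhom_jacR hf hg)); congr (_ *m _).
    by apply/matrixP => j k; rewrite mxE ord1 piZ_id //; apply: vhom_colX.
  by rewrite mxE; apply: homZ_piZ.
apply/matrixP => i j; rewrite ord1 mxE.
by have [->|->] := ord2P i; rewrite /= val_indhomog //; have := h 0; have := h 1;
  rewrite /tgt /= -!PoszD.
Qed.

Lemma colY_inj : injective colY.
Proof.
move=> y y' /matrixP E; apply: injective_projections; apply: val_inj.
  by have := E 0 0; rewrite !mxE.
by have := E 1 0; rewrite !mxE.
Qed.

Lemma colX_surj v : vhom src t v -> exists x, colX x = v.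
Proof.
move=> hv; exists [ffun j => indhomog t (v j 0)]; apply/matrixP => j k.
by rewrite mxE ord1 ffunE val_indhomog //; have := hv j; rewrite /src add0r.
Qed.

Lemma colY_surj v : vhom tgt t v -> exists y, colY y = v.
Proof.
move=> hv; exists (indhomog (df + t) (v 0 0), indhomog (dg + t) (v 1 0)).
apply/matrixP => i k; rewrite mxE ord1 /=.
by have [->|->] := ord2P i; rewrite /= val_indhomog //; have := hv 0; have := hv 1;
  rewrite /tgt /= -!PoszD.
Qed.

Lemma colYD y y' : colY (y + y') = colY y + colY y'.
Proof. by apply/matrixP => i j; rewrite !mxE; case: ifP. Qed.

Lemma colYZ a y : colY (a *: y) = a%:MP *: colY y.
Proof. by apply/matrixP => i j; rewrite !mxE; case: ifP => _; rewrite mul_mpolyC. Qed.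

Lemma colY0 : colY 0 = 0.
Proof. by apply/matrixP => i j; rewrite !mxE; case: ifP. Qed.

Lemma colY_sum N (y : 'I_N -> Y) : colY (\sum_k y k) = \sum_k colY (y k).
Proof. exact: (big_morph colY colYD colY0). Qed.

Lemma colXP a x x' : colX (a *: x + x') = a%:MP *: colX x + colX x'.
Proof. by apply/matrixP => i j; rewrite !mxE !ffunE mul_mpolyC. Qed.

Lemma jac_t_linear : linear jac_t.
Proof.
move=> a x x'; apply: colY_inj; rewrite colYD colYZ !colY_jac colXP mulmxDr.
by rewrite -scalemxAr.
Qed.

HB.instance Definition _ := GRing.isLinear.Build K X Y _ jac_t jac_t_linear.

Lemma mem_lker_jac x : (x \in lker (linfun jac_t)) = (JM *m colX x == 0).
Proof.
transitivity (jac_t x == 0); first exact: mem_lker_linear.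
apply/eqP/eqP => [E|E]; first by rewrite -colY_jac E colY0.
by apply: colY_inj; rewrite colY_jac E colY0.
Qed.

Lemma vloc_set0 r (a : 'I_r -> int) (w : 'cV[F]_r) : vloc a t set0 w ->
  exists2 v, vhom a t v & w = tomx v.
Proof.
move=> /vloc_clear[m [v [hv E]]]; exists v; last first.
  by rewrite -E /varprod big_set0 tofrac1 expr1n scale1r.
by move=> i; have := hv i; rewrite cards0 mul0r addr0.
Qed.

Lemma vhom_vloc r (a : 'I_r -> int) I (v : 'cV[R]_r) : vhom a t v ->
  vloc a t I (tomx v).
Proof.
move=> hv i; exists 0%N, (v i 0); rewrite mulr0 addr0 expr0 divr1 mxE.
by split=> //; apply: hv.
Qed.

(** Exactness at the empty set: an element of the graded cokernel that vanishes on the four standard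
    open sets is zero. *)
Lemma coker_injective y : cech_exact 0 t JM tgt src ->
  (forall I, #|I| = 1%N -> forall q, cover I q -> stalk_im t q (tomx (colY y))) ->
  exists x, y = jac_t x.
Proof.
move=> ex him; have [||b [_ hb]] := ex (fun=> tomx (colY y)).
- by move=> I _; apply/vhom_vloc/vhom_colY.
- move=> I cI; apply: (loc_im_cover cI).
    by apply: vloc_cechd => I' _; apply/vhom_vloc/vhom_colY.
  by move=> q cq; apply: stalk_im_cechd => I' _ _; apply: him cI q cq.
have [u /vloc_set0[v hv ->]] := hb set0 (cards0 _).
rewrite /cechd big_set0 subr0 -map_mxM => E.
have [x xE] := colX_surj hv; exists x; apply: colY_inj; rewrite colY_jac xE.
by apply/matrixP => i j; apply: (@tofrac_inj K); have /matrixP/(_ i j) := E; rewrite !mxE.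
Qed.

Lemma cocycle_const y : cech_cocycle f g df dg t 0 (fun _ _ => tomx (colY y)).
Proof.
split=> [I _|I cI q cq]; first exact/sectQ_const/vhom_vloc/vhom_colY.
rewrite cech_d_const subr0 -[stalk_im t q _]/(stalk_im t q _).
rewrite (_ : cechd _ I = 0); first exact: stalk_im0.
rewrite -[RHS](cechd_cechd (fun=> tomx (colY y)) I); apply: eq_cechd => I' cI'.
have /cards1P[i ->] : #|I'| == 1%N by move: cI'; rewrite cI => -[->].
rewrite /cechd big_set1 (_ : [set j in [set i] | (j < i)%N] = set0).
  by rewrite cards0 expr0 scale1r.
by apply/setP => j; rewrite !inE; case: eqP => //= ->; rewrite ltnn.
Qed.

(** Exactness at 1 lifts the basis of cohomology to homogeneous elements [y k], and exactness at 0
    makes these a basis of a complement to the image of [jac_t]. *)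
Lemma dimH0 N : cech_exact 0 t JM tgt src -> cech_exact 1 t JM tgt src ->
  dimH f g df dg t 0 N ->
  (N + \dim {:X} = \dim {:Y} + \dim (lker (linfun jac_t)))%N.
Proof.
move=> ex0 ex1 [e [he uniq]].
have /choice[y hy] : forall k, exists y : Y, forall I, #|I| = 1%N ->
    forall q, cover I q -> stalk_im t q (e k I q - tomx (colY y)).
  move=> k; have [b [hb hcb]] := cocycle_global ex1 (he k).
  have [v hv bE] := vloc_set0 (hb set0 (cards0 _)).
  have [y yE] := colY_surj hv; exists y => I cI q cq.
  have := hcb I cI q cq; have /cards1P[i ->] : #|I| == 1%N by rewrite cI.
  rewrite /cechd big_set1 (_ : [set j in [set i] | (j < i)%N] = set0); last first.
    by apply/setP => j; rewrite !inE; case: eqP => //= ->; rewrite ltnn.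
  by rewrite cards0 expr0 scale1r setDv bE yE.
have comb (a : 'rV[K]_N) I q : #|I| = 1%N -> cover I q ->
    stalk_im t q (\sum_k scalar (a 0 k) *: e k I q -
      tomx (colY (\sum_k a 0 k *: y k))).
  move=> cI cq; have -> : tomx (colY (\sum_k a 0 k *: y k)) =
      \sum_k scalar (a 0 k) *: tomx (colY (y k)).
    rewrite colY_sum tomx_sum; apply: eq_bigr => k _.
    by rewrite colYZ map_mxZ.
  rewrite -sumrB; apply: big_ind; first exact: stalk_im0.
    by move=> u v; apply: stalk_imD.
  move=> k _; rewrite -scalerBr; apply: stalk_imZ; last exact: hy.
  by rewrite -(mulr1 _%:MP) mul_mpolyC; apply/homZZ/homZ1.
apply: (basis_complement_dim (y := y)) => [w|a x H].
  have [a [ha _]] := uniq _ (cocycle_const w); exists a.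
  have [|x xE] := @coker_injective (w - \sum_k a 0 k *: y k) ex0.
    move=> I cI q cq; have := stalk_imD (ha I cI q cq) (comb a I q cI cq).
    rewrite subr0 addrA subrK => h; rewrite (_ : tomx _ =
      tomx (colY w) - tomx (colY (\sum_k a 0 k *: y k))) //.
    rewrite colYD -scaleN1r colYZ; apply/matrixP => i j; rewrite !mxE.
    by rewrite mpolyCN mpolyC1 mulN1r tofracD tofracN.
  by exists x; rewrite /= -xE addrC subrK.
have [a0 [_ ha0]] := uniq _ (cocycle0 t 0).
rewrite -(ha0 a) ?(ha0 0) //.
  move=> I cI q cq; rewrite subr0 big1 ?subr0; first exact: stalk_im0.
  by move=> k _; rewrite mxE /Defs.scalar mpolyC0 tofrac0 scale0r.
move=> I cI q cq; rewrite subr0 sub0r; apply: stalk_imN.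
rewrite -[\sum_k _](subrK (tomx (colY (\sum_k a 0 k *: y k)))).
apply: stalk_imD; first exact: comb.
have -> : \sum_k a 0 k *: y k = jac_t (- x).
  by apply/eqP; rewrite linearN -addr_eq0; apply/eqP.
rewrite colY_jac map_mxM -jacobianE; exists (tomx (colX (- x))) => // j.
by rewrite mxE; apply: stalk_hom; have := vhom_colX (- x) j; rewrite /src add0r.
Qed.

End GlobalSections.

Lemma euler_char_large : exists t0 : nat, forall t : nat, (t0 <= t)%N ->
  forall x, euler_charQ f g df dg t x -> exists2 N : nat, x = N%:Z &
  (N + \dim {:{ffun 'I_4 -> dhomog 4 K t}} =
   \dim {:(dhomog 4 K (df + t) * dhomog 4 K (dg + t))%type} +
   \dim (lker (linfun (@jac_t t))))%N.
Proof.
have hB := bhom_jacR hf hg.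
have [t0 h0] := serre_vanishing 0 hB; have [t1 h1] := serre_vanishing 1 hB.
have [t2 h2] := serre_vanishing 2 hB; have [t3 h3] := serre_vanishing 3 hB.
have [t4 h4] := serre_vanishing 4 hB.
exists (t0 + t1 + t2 + t3 + t4)%N => t ht x [h [hh ->]].
exists (h ord0); last by apply: dimH0 (hh ord0); [apply: h0 | apply: h1]; lia.
have z (i : 'I_4) n : (i : nat) = n.+1 -> cech_exact n.+2 t JM tgt src -> h i = 0%N.
  move=> iE ex; have := hh i; rewrite iE; apply: dimH_vanish => c.
  exact: higher_vanish.
rewrite big_ord_recl big1 ?addr0 => [|i _]; first by rewrite expr0 mul1r.
rewrite (z (lift ord0 i) i) ?mulr0 //.
by case: i => [[|[|[|]]]] //= _; [apply: h2 | apply: h3 | apply: h4]; lia.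
Qed.

End Cohomology.

(** * Complementary minors and the kernel of the Jacobian *)

Section ComplementaryMinors.
Variable E : comPzRingType.
Implicit Types (f g u v : 'I_4 -> E) (i j k l : 'I_4).

Definition o0 : 'I_4 := @Ordinal 4 0 isT.
Definition o1 : 'I_4 := @Ordinal 4 1 isT.
Definition o2 : 'I_4 := @Ordinal 4 2 isT.
Definition o3 : 'I_4 := @Ordinal 4 3 isT.

Lemma ord4P i : [\/ i = o0, i = o1, i = o2 | i = o3].
Proof.
case: i => [[|[|[|[|//]]]] lt];
  [constructor 1|constructor 2|constructor 3|constructor 4]; exact: val_inj.
Qed.

Lemma sum4 (G : 'I_4 -> E) : \sum_i G i = G o0 + G o1 + G o2 + G o3.
Proof.
rewrite !big_ord_recl big_ord0 addr0 !addrA.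
by congr (G _ + G _ + G _ + G _); apply: val_inj.
Qed.

Definition dot f u := \sum_i f i * u i.

Definition minor f g i j := f i * g j - f j * g i.

(* The Hodge dual of f /\ g: the bivector spanning the kernel of the 2 x 4
   matrix with rows f and g. *)
Definition cminor f g i j : E :=
  match nat_of_ord i, nat_of_ord j with
  | 0%N, 1%N => minor f g o2 o3 | 1%N, 0%N => - minor f g o2 o3
  | 0%N, 2%N => - minor f g o1 o3 | 2%N, 0%N => minor f g o1 o3
  | 0%N, 3%N => minor f g o1 o2 | 3%N, 0%N => - minor f g o1 o2
  | 1%N, 2%N => minor f g o0 o3 | 2%N, 1%N => - minor f g o0 o3
  | 1%N, 3%N => - minor f g o0 o2 | 3%N, 1%N => minor f g o0 o2
  | 2%N, 3%N => minor f g o0 o1 | 3%N, 2%N => - minor f g o0 o1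
  | _, _ => 0
  end.

Lemma cminorN f g i j : cminor f g i j = - cminor f g j i.
Proof.
by case: (ord4P i) => ->; case: (ord4P j) => ->; rewrite /cminor /= ?opprK ?oppr0.
Qed.

Lemma cminor_ii f g i : cminor f g i i = 0.
Proof. by case: (ord4P i) => ->. Qed.

(** Lets vanishing and divisibility pass from the complementary minors to the minors. *)
Lemma minor_cminor f g i j : exists k l (b : bool),
  minor f g i j = (-1) ^+ b * cminor f g k l.
Proof.
have D h : minor f g h h = (-1) ^+ false * cminor f g o0 o0.
  by rewrite /minor subrr /cminor mulr0.
have S h h' k l b : minor f g h h' = (-1) ^+ b * cminor f g k l ->
    minor f g h' h = (-1) ^+ b * cminor f g l k.
  move=> H; rewrite (cminorN _ _ l k) mulrN -H /minor; ring.
case: (ord4P i) => ->; case: (ord4P j) => ->;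
  try (by exists o0, o0, false; apply: D).
- by exists o2, o3, false; rewrite mul1r.
- by exists o1, o3, true; rewrite expr1 mulN1r opprK.
- by exists o1, o2, false; rewrite mul1r.
- by exists o3, o2, false; apply: S; rewrite mul1r.
- by exists o0, o3, false; rewrite mul1r.
- by exists o0, o2, true; rewrite expr1 mulN1r opprK.
- by exists o3, o1, true; apply: S; rewrite expr1 mulN1r opprK.
- by exists o3, o0, false; apply: S; rewrite mul1r.
- by exists o0, o1, false; rewrite mul1r.
- by exists o2, o1, false; apply: S; rewrite mul1r.
- by exists o2, o0, true; apply: S; rewrite expr1 mulN1r opprK.
- by exists o1, o0, false; apply: S; rewrite mul1r.
Qed.

Lemma dot_cminor f g l : dot f (fun i => cminor f g i l) = 0.
Proof.
by rewrite /dot sum4; case: (ord4P l) => ->; rewrite /cminor /minor /=; ring.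
Qed.

Lemma dot_cminor' f g l : dot g (fun i => cminor f g i l) = 0.
Proof.
by rewrite /dot sum4; case: (ord4P l) => ->; rewrite /cminor /minor /=; ring.
Qed.

Section Kernel.
Variables (f g u : 'I_4 -> E).
Hypotheses (fu : dot f u = 0) (gu : dot g u = 0).
Local Notation A := (cminor f g).

(** The trivector [u /\ A] is dual to the contraction of [f /\ g] with [u], that is to [dot f u]
    times [g] minus [dot g u] times [f], which vanishes. Four triples are computed; the others
    follow by antisymmetry. *)
Lemma kernel_wedge i j l : u i * A j l + u j * A l i + u l * A i j = 0.
Proof.
have fu4 : f o0 * u o0 + f o1 * u o1 + f o2 * u o2 + f o3 * u o3 = 0.
  by rewrite -(sum4 (fun i => f i * u i)).
have gu4 : g o0 * u o0 + g o1 * u o1 + g o2 * u o2 + g o3 * u o3 = 0.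
  by rewrite -(sum4 (fun i => g i * u i)).
have K m : g m * (f o0 * u o0 + f o1 * u o1 + f o2 * u o2 + f o3 * u o3) -
  f m * (g o0 * u o0 + g o1 * u o1 + g o2 * u o2 + g o3 * u o3) = 0.
  by rewrite fu4 gu4 !mulr0 subr0.
pose T i j l := u i * A j l + u j * A l i + u l * A i j.
rewrite -/(T i j l).
have Trot i' j' l' : T i' j' l' = T j' l' i' by rewrite /T; ring.
have Tsw i' j' l' : T i' j' l' = - T j' i' l'.
  by rewrite /T (cminorN _ _ j' l') (cminorN _ _ l' i') (cminorN _ _ i' j'); ring.
have Tii i' j' : T i' i' j' = 0.
  by rewrite /T (cminorN _ _ i' j') cminor_ii; ring.
have T012 : T o0 o1 o2 = 0.
  by rewrite -[RHS](K o3) /T /cminor /minor /=; ring.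
have T013 : T o0 o1 o3 = 0.
  by rewrite -[RHS]oppr0 -(K o2) /T /cminor /minor /=; ring.
have T023 : T o0 o2 o3 = 0.
  by rewrite -[RHS](K o1) /T /cminor /minor /=; ring.
have T123 : T o1 o2 o3 = 0.
  by rewrite -[RHS]oppr0 -(K o0) /T /cminor /minor /=; ring.
have Tiji i' j' : T i' j' i' = 0 by rewrite Trot Trot Tii.
have Tjii i' j' : T j' i' i' = 0 by rewrite Trot Tii.
have all6 a b c : T a b c = 0 -> [/\ T b c a = 0, T c a b = 0, T b a c = 0,
    T a c b = 0 & T c b a = 0].
  move=> H; split.
  - by rewrite -(Trot a b c).
  - by rewrite Trot.
  - by rewrite Tsw H oppr0.
  - by rewrite Tsw Trot H oppr0.
  - by rewrite Tsw -(Trot a b c) H oppr0.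
have [? ? ? ? ?] := all6 _ _ _ T012; have [? ? ? ? ?] := all6 _ _ _ T013.
have [? ? ? ? ?] := all6 _ _ _ T023; have [? ? ? ? ?] := all6 _ _ _ T123.
by case: (ord4P i) => ->; case: (ord4P j) => ->; case: (ord4P l) => ->;
  rewrite ?Tii ?Tiji ?Tjii.
Qed.

Lemma wedge_cminor i j l : u i * A j l - u j * A i l = - u l * A i j.
Proof.
have := kernel_wedge i j l; rewrite (cminorN _ _ l i) => H.
by rewrite -[RHS]addr0 -H; ring.
Qed.

End Kernel.

(** For independent [f] and [g], both [u /\ v] and [A] lie in the exterior square of a kernel of
    rank two, which has rank one; [kernel_wedge] gives the proportionality without division. *)
Lemma wedge_proportional f g u v i j k l :
  dot f u = 0 -> dot g u = 0 -> dot f v = 0 -> dot g v = 0 ->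
  (u i * v j - u j * v i) * cminor f g k l =
  (u k * v l - u l * v k) * cminor f g i j.
Proof.
move=> fu gu fv gv; set A := cminor f g.
have E1 := kernel_wedge fv gv j k l; have E2 := kernel_wedge fv gv i k l.
have E3 := wedge_cminor fu gu i j l; have E4 := wedge_cminor fu gu i j k.
rewrite -/A in E1 E2 E3 E4.
have V1 : v j * A k l = v k * A j l - v l * A j k.
  by rewrite -[LHS]subr0 -E1 /A (cminorN _ _ l j); ring.
have V2 : v i * A k l = v k * A i l - v l * A i k.
  by rewrite -[LHS]subr0 -E2 /A (cminorN _ _ l i); ring.
transitivity (u i * (v j * A k l) - u j * (v i * A k l)); first by ring.
rewrite V1 V2.
transitivity (v k * (u i * A j l - u j * A i l) - v l * (u i * A j k - u j * A i k)).
  by ring.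
by rewrite E3 E4; ring.
Qed.

(* Cauchy-Binet for a product of 2 x 4 and 4 x 2 matrices. *)
Lemma dot_minor f g u v : dot f u * dot g v - dot f v * dot g u =
  \sum_i \sum_j minor f g i j * (u i * v j).
Proof.
rewrite /dot !mulr_suml (eq_bigr (fun i => \sum_j f i * u i * (g j * v j))).
  rewrite [X in _ - X](eq_bigr (fun i => \sum_j f i * v i * (g j * u j))).
    rewrite [X in _ - X]exchange_big -sumrB; apply: eq_bigr => i _.
    rewrite -sumrB; apply: eq_bigr => j _; rewrite /minor; ring.
  by move=> i _; rewrite mulr_sumr.
by move=> i _; rewrite mulr_sumr.
Qed.

End ComplementaryMinors.

(** * Normality and the coprimality of the minors *)

Section NormalMinors.
Variable K : fieldType.
Local Notation R := {mpoly K[4]}.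
Local Notation F := {fraction {mpoly K[4]}}.
Implicit Types (p : R) (q : point K).

Variables (f g : R) (df dg : nat).
Hypotheses (hf : f \is (df.+1).-homog) (hg : g \is (dg.+1).-homog).

Definition grad (h : R) (j : 'I_4) : R := mderiv j h.

Lemma homZ_grad_f j : homZ df%:Z (grad f j).
Proof. exact: homog_mderiv. Qed.

Lemma homZ_grad_g j : homZ dg%:Z (grad g j).
Proof. exact: homog_mderiv. Qed.

Local Notation A := (cminor (grad f) (grad g)).
Local Notation M := (minor (grad f) (grad g)).

Lemma homZ_minor i j : homZ (df + dg)%N%:Z (M i j).
Proof.
rewrite PoszD; apply: homZB; last rewrite addrC.
  exact: homZM (homZ_grad_f i) (homZ_grad_g j).
by rewrite addrC; apply: homZM (homZ_grad_f j) (homZ_grad_g i).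
Qed.

Lemma homZ_cminor i j : homZ (df + dg)%N%:Z (A i j).
Proof.
have h0 := homZ0; have hN k l := homZN (homZ_minor k l).
by case: (ord4P i) => ->; case: (ord4P j) => ->; rewrite /cminor /=;
  try exact: homZ0; try exact: homZ_minor; apply: hN.
Qed.

(** The maximal ideal of the local ring of R at [q], without grading. *)
Definition vanishing q (x : F) := exists a b,
  [/\ q a, ~ q b & x = tofrac a / tofrac b].

Lemma vanishingD q x y : vanishing q x -> vanishing q y -> vanishing q (x + y).
Proof.
move=> [a [b [qa qb ->]]] [a' [b' [qa' qb' ->]]].
exists (a * b' + a' * b), (b * b'); split.
- by apply: pointD; [rewrite mulrC|]; [|rewrite mulrC]; apply: pointMl.
- by move/point_prime => [].
- by rewrite addf_div ?tofrac_neq0 ?(point_neq0 qb) ?(point_neq0 qb') //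
    !(tofracM, tofracD).
Qed.

Lemma vanishingM n q (a : R) x : q a -> stalkO n q x -> vanishing q (tofrac a * x).
Proof.
move=> qa /stalkZP[k [l [c [b [_ _ qb _ ->]]]]]; exists (c * a), b.
by split=> //; [apply: pointMl | rewrite mulrA -tofracM mulrC [a * c]mulrC mulrC].
Qed.

(** Were the Jacobian onto at [q], some local vectors [v] and [v'] would be sent to a power of a
    variable in either coordinate. By [dot_minor] the product of the two powers, nonzero at [q],
    would be a combination of the minors, which vanish there. *)
Lemma minors_in_supp q : (forall i j, q (M i j)) -> suppQ f g df dg q.
Proof.
move=> qM; apply: contrapT => nsupp.
have im w : stalk_sum (tgt_deg df dg 0) q w -> stalk_im f g 0 q w.
  by move=> hw; apply: contrapT => nw; apply: nsupp; exists w.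
have [i0 qi0] := point_relevant q.
have [|v hv vE] := im (\col_i if i == 0 then tofrac ('X_i0 ^+ df) else 0).
  move=> i; rewrite mxE /tgt_deg addr0; case: ifP => _; last exact: stalk0.
  by apply: stalk_hom; rewrite -[df%:Z]mul1r; apply/homZX/homZ_var.
have [|v' hv' vE'] := im (\col_i if i == 0 then 0 else tofrac ('X_i0 ^+ dg)).
  move=> i; rewrite mxE /tgt_deg addr0; case: ifP => _; first exact: stalk0.
  by apply: stalk_hom; rewrite -[dg%:Z]mul1r; apply/homZX/homZ_var.
have row (w : 'cV[F]_2) (u : 'cV[F]_4) : w = jacobian f g *m u ->
    w 0 0 = dot (fun j => tofrac (grad f j)) (u^~ 0) /\
    w 1 0 = dot (fun j => tofrac (grad g j)) (u^~ 0).
  by move=> ->; rewrite !mxE; split; apply: eq_bigr => j _; rewrite !mxE.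
have [f1 g1] := row _ _ vE; have [f2 g2] := row _ _ vE'.
rewrite !mxE /= in f1 g1 f2 g2.
have := dot_minor (fun j => tofrac (grad f j)) (fun j => tofrac (grad g j)) (v^~ 0) (v'^~ 0).
rewrite -f1 -g2 -f2 mul0r subr0 -tofracM => E.
have [a [b [qa qb E']]] : vanishing q (tofrac ('X_i0 ^+ df * 'X_i0 ^+ dg)).
  rewrite E.
  have v0 : vanishing q 0.
    exists 0, 1; split; [exact: point0 | exact: point_proper | by rewrite tofrac0 mul0r].
  apply: big_ind => // [|i _]; first exact: vanishingD.
  apply: big_ind => // [|j _]; first exact: vanishingD.
  have -> : minor (fun j => tofrac (grad f j)) (fun j => tofrac (grad g j)) i j =
     tofrac (M i j) by rewrite /minor tofracB !tofracM.
  apply: (vanishingM (n := 0 + 0)) => //.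
  by apply: stalkM; [apply: hv | apply: hv'].
have b0 := tofrac_neq0 (point_neq0 qb).
have /tofrac_inj ab : tofrac ('X_i0 ^+ df * 'X_i0 ^+ dg * b) = tofrac a.
  by rewrite tofracM E' divfK.
rewrite -ab in qa; case/point_prime: qa => // /point_prime[] /pointX //.
Qed.

Lemma homZ_deg0_unit p : p != 0 -> homZ 0 p -> p \is a GRing.unit.
Proof.
move=> p0 /homZ_const pE; rewrite pE; apply: (rmorph_unit (@mpolyC 4 K)).
by rewrite unitfE; apply: contra_neq p0 => E; rewrite pE E mpolyC0.
Qed.

Lemma prime_homog_deg p n : prime_elt p -> homZ n p -> 0 < n.
Proof.
move=> [p0 pu _] hp; have [n0|//|n0] := ltgtP n 0.
  by case/eqP: p0; apply: homZ_neg hp.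
by case/negP: pu; apply: homZ_deg0_unit => //; rewrite -n0.
Qed.

(** Otherwise [p] has degree 1 and all variables are proportional to it. This is what makes the
    ideal of [p] relevant, hence a point. *)
Lemma not_divides_vars p n : prime_elt p -> homZ n p ->
  exists i : 'I_4, ~ divides p 'X_i.
Proof.
move=> pp hp; have n0 := prime_homog_deg pp hp; have [p0 _ _] := pp.
apply: contrapT => /forallNP H.
have lin (i : 'I_4) : exists c : K, c != 0 /\ 'X_i = c *: p.
  have /contrapT[c cE] := H i.
  have hc : homZ (1 - n) c.
    apply: (homZ_divl p0 hp); rewrite mulrC -cE addrC subrK; exact: homZ_var.
  have c0 : c != 0.
    by apply: contra_neq (var_neq0 K i) => E; rewrite cE E mul0r.
  have n1 : 1 - n = 0.
    have [lt|] := ltP (1 - n) 0; last by lia.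
    by case/eqP: c0; apply: homZ_neg hc.
  have c1 := homZ_const (p := c); rewrite n1 in hc; move/c1: hc => {}c1.
  exists c@_0; split; last by rewrite -mul_mpolyC -c1.
  by apply: contra_neq c0 => E; rewrite c1 E mpolyC0.
have [c [c0 E0]] := lin o0; have [c' [c0' E1]] := lin o1.
have : c' *: 'X_o0 = c *: 'X_o1 :> R by rewrite E0 E1 !scalerA mulrC.
move/(congr1 (mcoeff U_(o0))); rewrite !mcoeffZ !mcoeffX eqxx mulr1.
rewrite (_ : (U_(o1) == U_(o0))%MM = false) ?mulr0; last by rewrite eq_mnm1.
by move/eqP; rewrite (negPf c0').
Qed.

Lemma prime_point p n : prime_elt p -> homZ n p ->
  exists q, forall a, q a <-> divides p a.
Proof.
move=> pp hp; have [p0 pu pM] := pp.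
have P0 : divides p 0 by apply: divides0.
have PD a b : divides p a -> divides p b -> divides p (a + b) by apply: dividesD.
have PM a b : divides p b -> divides p (a * b) by apply: dividesM.
have P1 : ~ divides p 1.
  by move=> [c E]; case/negP: pu; apply/unitrP; exists c; rewrite [p * c]mulrC -E.
have Ph a k : divides p a -> divides p (pihomog mdeg k a).
  move=> [c ->]; exists (piZ (k%:Z - n) c).
  by rewrite -[LHS]/(piZ k%:Z (c * p)) mulrC [RHS]mulrC -(piZM _ _ hp) addrC subrK.
by exists (Point P0 PD PM P1 pM Ph (not_divides_vars pp hp)).
Qed.

(* Infinite descent on degrees: a prime strictly contained in (p) is zero. *)
Lemma prime_height1 p n q : prime_elt p -> homZ n p ->
  (forall a, q a <-> divides p a) -> ~ height_ge 2 q.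
Proof.
move=> pp hp qE [q1 [q1q [b qb nq1b]] [q2 [_ [a q1a nq2a]] _]].
have [p0 _ _] := pp; have n0 := prime_homog_deg pp hp.
have nq1p : ~ q1 p.
  by move=> q1p; apply: nq1b; have /qE[c ->] := qb; apply: pointMl.
suff z c : q1 c -> c = 0 by apply: nq2a; rewrite (z a q1a); apply: point0.
have [N] := ubnP (msize c); elim: N c => // N IHN c.
rewrite ltnS => cN q1c; have /q1q/qE[c' cE] := q1c.
have [c'0|c'0] := eqVneq c' 0; first by rewrite cE c'0 mul0r.
have q1c' : q1 c' by move: q1c; rewrite cE => /point_prime[].
rewrite cE (IHN c') ?mul0r //; apply: leq_trans cN.
rewrite cE msizeM // (mpolySpred _ c'0).
have /homZP/(_ _ (mlead_supp p0)) dp := hp.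
have := mlead_deg p0; lia.
Qed.

Lemma zero_point : exists q, forall a, q a <-> a = 0.
Proof.
pose Z (a : R) := a = 0.
have Z0 : Z 0 by [].
have ZD a b : Z a -> Z b -> Z (a + b) by rewrite /Z => -> ->; rewrite addr0.
have ZM a b : Z b -> Z (a * b) by rewrite /Z => ->; rewrite mulr0.
have Z1 : ~ Z 1 by apply/eqP; rewrite oner_neq0.
have Zp a b : Z (a * b) -> Z a \/ Z b.
  by move/eqP; rewrite mulf_eq0 => /orP[]/eqP; [left | right].
have Zh a k : Z a -> Z (pihomog mdeg k a) by rewrite /Z => ->; rewrite pihomog0.
have Zr : exists i : 'I_4, ~ Z 'X_i by exists o0; apply/eqP/var_neq0.
by exists (Point Z0 ZD ZM Z1 Zp Zh Zr).
Qed.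

Hypothesis hnormal : normal f g df dg.

Lemma minor_neq0 : exists i j, M i j != 0.
Proof.
apply: contrapT => H.
have M0 i j : M i j = 0.
  by apply/eqP; apply: contrapT => /negP nz; apply: H; exists i, j.
have [q qE] := zero_point.
have /hnormal[q1 [_ [a qa nqa]] _] : suppQ f g df dg q by apply: minors_in_supp => i j; apply/qE.
by apply: nqa; have /qE -> := qa; apply: point0.
Qed.

Lemma cminor_neq0 : exists i j, A i j != 0.
Proof.
have [i [j nz]] := minor_neq0; have [k [l [b E]]] := minor_cminor (grad f) (grad g) i j.
by exists k, l; apply: contra_neq nz => E0; rewrite E E0 mulr0.
Qed.

(** A common prime factor is homogeneous, as it divides a nonzero homogeneous element. It defines a
    point of height at most 1 where all minors vanish, which normality excludes. *)
Lemma cminor_coprime : coprime_family (fun ij : 'I_4 * 'I_4 => A ij.1 ij.2).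
Proof.
move=> p pp; apply: contrapT => /forallNP H.
have pA k l : divides p (A k l) by apply: contrapT; apply: (H (k, l)).
have pM i j : divides p (M i j).
  by have [k [l [b ->]]] := minor_cminor (grad f) (grad g) i j; apply: dividesM.
have [i [j nz]] := cminor_neq0; have [c cE] := pA i j.
have [n hp] : exists n, homZ n p.
  by apply: (@homZ_factor _ (df + dg)%N%:Z p c); rewrite mulrC -cE // homZ_cminor.
have [q qE] := prime_point pp hp.
apply: (prime_height1 pp hp qE); apply: hnormal; apply: minors_in_supp => i' j'.
exact/qE.
Qed.

End NormalMinors.

Lemma mpoly_generators_ind n (K : fieldType) (P : {mpoly K[n]} -> Prop) :
  (forall c, P c%:MP) -> (forall i, P 'X_i) ->
  (forall p q, P p -> P q -> P (p + q)) ->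
  (forall p q, P p -> P q -> P (p * q)) -> forall p, P p.
Proof.
move=> PC PX PD PM p; have P1 : P 1 by rewrite -mpolyC1.
have PXn i k : P ('X_i ^+ k).
  by elim: k => [|k IH]; [rewrite expr0 | rewrite exprS; apply: PM].
have Pm m : P 'X_[m].
  by rewrite mpolyXE_id; apply: (big_ind P) => // q q'; apply: PM.
rewrite [p]mpolyE; apply: (big_ind P); first by rewrite -mpolyC0.
  by move=> q q'; apply: PD.
by move=> m _; rewrite -mul_mpolyC; apply: PM.
Qed.

(** * Binary forms and the zero scheme of a section *)

Section LinearForms.
Variable K : fieldType.
Local Notation R := {mpoly K[4]}.
Implicit Types (p q : R) (w y : 'I_4) (z : K).

Definition lform w y z : R := 'X_w - z *: 'X_y.

(** Reduction modulo [lform w y z], realised as a substitution. *)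
Definition elim_var w y z p : R :=
  p \mPo [tuple if i == w then z *: 'X_y else 'X_i | i < 4].

Lemma elim_varM w y z : {morph elim_var w y z : p q / p * q}.
Proof. by move=> p q; rewrite /elim_var rmorphM. Qed.

Lemma elim_varX w y z i :
  elim_var w y z 'X_i = if i == w then z *: 'X_y else 'X_i.
Proof. by rewrite /elim_var comp_mpolyXU -tnth_nth tnth_mktuple. Qed.

Lemma elim_var_lform w y z a b z' : a != w -> b != w ->
  elim_var w y z (lform a b z') = lform a b z'.
Proof.
move=> aw bw; rewrite /lform {1}/elim_var comp_mpolyB comp_mpolyZ.
by rewrite -!/(elim_var w y z _) !elim_varX (negPf aw) (negPf bw).
Qed.

Lemma elim_var_self w y z : w != y -> elim_var w y z (lform w y z) = 0.
Proof.
move=> wy; rewrite /lform {1}/elim_var comp_mpolyB comp_mpolyZ.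
by rewrite -!/(elim_var w y z _) !elim_varX eqxx eq_sym (negPf wy) subrr.
Qed.

Lemma elim_var_mod w y z p : divides (lform w y z) (p - elim_var w y z p).
Proof.
apply: (@mpoly_generators_ind 4 K
  (fun q => divides (lform w y z) (q - elim_var w y z q))).
- by move=> c; rewrite /elim_var comp_mpolyC subrr; apply: divides0.
- move=> i; rewrite elim_varX; case: eqP => [->|_]; first by exists 1; rewrite mul1r.
  by rewrite subrr; apply: divides0.
- move=> q q' [c E] [c' E']; rewrite /elim_var comp_mpolyD; exists (c + c').
  by rewrite mulrDl -E -E' opprD addrACA.
move=> q q' [c E] [c' E']; rewrite elim_varM.
exists (c * q' + elim_var w y z q * c').
by rewrite mulrDl -mulrA [q' * _]mulrC mulrA -E -[_ * c' * _]mulrA -E'; ring.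
Qed.

Lemma lform_neq0 w y z : w != y -> lform w y z != 0.
Proof.
move=> wy; apply: contra_neq (oner_neq0 K) => /(congr1 (mcoeff U_(w))).
rewrite mcoeffB mcoeffZ !mcoeffX eqxx mcoeff0 eq_mnm1 eq_sym (negPf wy).
by rewrite mulr0 subr0.
Qed.

Lemma lform_cancel w y z a b z' p : w != y -> a != w -> b != w -> a != b ->
  divides (lform w y z) (lform a b z' * p) -> divides (lform w y z) p.
Proof.
move=> wy aw bw ab [c E].
suff e0 : elim_var w y z p = 0 by have := elim_var_mod w y z p; rewrite e0 subr0.
apply: (mulfI (lform_neq0 z' ab)).
rewrite mulr0 -(elim_var_lform y z z' aw bw) -elim_varM E elim_varM.
by rewrite elim_var_self // mulr0.
Qed.

(* The forms X_w - z X_y, X_a - z' X_b, X_k - z'' X_l are a regular sequence. *)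
Lemma lform_regular w y z a b z' k l z'' p c c' :
  w != y -> a != b -> k != l ->
  a != w -> b != w -> k != w -> l != w -> k != a -> l != a ->
  lform k l z'' * p = c * lform w y z + c' * lform a b z' ->
  exists d d', p = d * lform w y z + d' * lform a b z'.
Proof.
move=> wy ab kl aw bw kw lw ka la E.
have [d dE] := elim_var_mod w y z p.
have [d' dE'] : divides (lform a b z') (elim_var w y z p).
  apply: (lform_cancel ab ka la kl (z' := z'')).
  rewrite -(elim_var_lform y z z'' kw lw) -elim_varM E.
  exists (elim_var w y z c').
  rewrite {1}/elim_var comp_mpolyD -!/(elim_var w y z _) !elim_varM.
  by rewrite elim_var_self // mulr0 add0r elim_var_lform.
by exists d, d'; rewrite -dE -dE' subrK.
Qed.

End LinearForms.

(** * The ideal of the zero scheme of a section *)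

Section Colon.
Variable K : fieldType.
Local Notation R := {mpoly K[4]}.
Implicit Types (u v : 'cV[R]_4) (p q : R).

Variables (f g : R).
Local Notation A := (cminor (grad f) (grad g)).
Local Notation M := (minor (grad f) (grad g)).
Local Notation JM := (jacR f g).

Definition wedge (u v : 'cV[R]_4) (i j : 'I_4) : R :=
  u i 0 * v j 0 - u j 0 * v i 0.

Lemma jac_kerP v : JM *m v = 0 <->
  dot (grad f) (v^~ 0) = 0 /\ dot (grad g) (v^~ 0) = 0.
Proof.
have E0 : (JM *m v) 0 0 = dot (grad f) (v^~ 0).
  by rewrite mxE; apply: eq_bigr => j _; rewrite mxE.
have E1 : (JM *m v) 1 0 = dot (grad g) (v^~ 0).
  by rewrite mxE; apply: eq_bigr => j _; rewrite mxE.
rewrite -E0 -E1; split=> [->|[H0 H1]]; first by rewrite !mxE.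
by apply/matrixP => i j; rewrite ord1 [RHS]mxE; have [->|->] := ord2P i.
Qed.

Definition cminor_col (l : 'I_4) : 'cV[R]_4 := \col_i A i l.

Lemma jac_cminor_col l : JM *m cminor_col l = 0.
Proof.
apply/jac_kerP; split.
  rewrite -[RHS](dot_cminor (grad f) (grad g) l).
  by apply: eq_bigr => j _; rewrite mxE.
rewrite -[RHS](dot_cminor' (grad f) (grad g) l).
by apply: eq_bigr => j _; rewrite mxE.
Qed.

Lemma wedge_cminor_col u l i j : JM *m u = 0 ->
  wedge u (cminor_col l) i j = - u l 0 * A i j.
Proof. by move=> /jac_kerP[fu gu]; rewrite /wedge !mxE; exact: (wedge_cminor fu gu). Qed.

Hypothesis coA : coprime_family (fun ij : 'I_4 * 'I_4 => A ij.1 ij.2).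
Hypothesis A0 : exists i j, A i j != 0.

(** By proportionality [A i j] divides every [wedge u v i j * A k l], and the entries of [A] are
    coprime. *)
Lemma wedge_factor u v : JM *m u = 0 -> JM *m v = 0 ->
  exists p, forall i j, wedge u v i j = p * A i j.
Proof.
move=> /jac_kerP[fu gu] /jac_kerP[fv gv]; have [i [j nz]] := A0.
have prop k l := wedge_proportional i j k l fu gu fv gv.
have [p pE] : divides (A i j) (wedge u v i j).
  apply: (divides_coprime_family (@factorial_mpoly 4 K) coA nz) => -[k l] /=.
  by exists (wedge u v k l); rewrite /wedge prop.
exists p => k l; apply: (mulIf nz); rewrite /wedge -prop.
by rewrite -[X in X * _]/(wedge u v i j) pE mulrAC.
Qed.

Variable s : 'cV[R]_4.
Hypotheses (s_ker : JM *m s = 0) (s0 : s != 0).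
Hypothesis co_s : coprime_family (fun j => s j 0).

Lemma entry_neq0 : exists j, s j 0 != 0.
Proof.
apply: contrapT => H; case/eqP: s0; apply/matrixP => i j; rewrite ord1 mxE.
by apply/eqP; apply: contrapT => /negP nz; apply: H; exists i.
Qed.

Lemma wedge_eq0 v : (forall i j, wedge s v i j = 0) -> exists p, v = p *: s.
Proof.
move=> H; have [j nz] := entry_neq0.
have prop i : s i 0 * v j 0 = s j 0 * v i 0 by apply/eqP; rewrite -subr_eq0 -/(wedge _ _ _ _) H.
have [p pE] : divides (s j 0) (v j 0).
  apply: (divides_coprime_family (@factorial_mpoly 4 K) co_s nz) => i.
  by exists (v i 0); rewrite mulrC prop mulrC.
exists p; apply/matrixP => i k; rewrite ord1 mxE; apply: (mulfI nz).
by rewrite -prop pE; ring.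
Qed.

(* The ideal of the zero scheme of the section s of the reflexive sheaf. *)
Definition zero_ideal p := exists2 v, JM *m v = 0 &
  forall i j, wedge s v i j = p * A i j.

Lemma zero_idealM c p : zero_ideal p -> zero_ideal (c * p).
Proof.
move=> [v kv E]; exists (c *: v); first by rewrite -scalemxAr kv scaler0.
by move=> i j; rewrite -mulrA -E /wedge !mxE; ring.
Qed.

(* R / zero_ideal has depth at least 3 off its support: no element is killed by
   a regular sequence of length 3. *)
Lemma zero_ideal_colon w y z a b z' k l z'' p :
  w != y -> a != b -> k != l ->
  a != w -> b != w -> k != w -> l != w -> k != a -> l != a ->
  zero_ideal (lform w y z * p) -> zero_ideal (lform a b z' * p) ->
  zero_ideal (lform k l z'' * p) -> zero_ideal p.
Proof.
move=> wy ab kl aw bw kw lw ka la.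
set l1 := lform w y z; set l2 := lform a b z'; set l3 := lform k l z''.
move=> [v1 k1 E1] [v2 k2 E2] [v3 k3 E3].
(* Koszul relations: lifts of two multiples of the same [p] agree, after cross multiplication, up to
   a multiple of [s]. *)
have syz (x1 x2 : 'cV[R]_4) (m1 m2 : R) :
    (forall i j, wedge s x1 i j = m1 * p * A i j) ->
    (forall i j, wedge s x2 i j = m2 * p * A i j) ->
    exists r, m2 *: x1 - m1 *: x2 = r *: s.
  move=> H1 H2; apply: wedge_eq0 => i j.
  have := H1 i j; have := H2 i j; rewrite /wedge !mxE => H2' H1'.
  transitivity (m2 * (s i 0 * x1 j 0 - s j 0 * x1 i 0) -
    m1 * (s i 0 * x2 j 0 - s j 0 * x2 i 0)); first by ring.
  by rewrite H1' H2'; ring.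
have [r12 R12] := syz v1 v2 l1 l2 E1 E2.
have [r13 R13] := syz v1 v3 l1 l3 E1 E3.
have [r23 R23] := syz v2 v3 l2 l3 E2 E3.
have [j0 nz] := entry_neq0.
have ent (x x' : 'cV[R]_4) j : x = x' -> x j 0 = x' j 0 by move->.
(* The three relations give [l3 * r12 = l2 * r13 - l1 * r23], and [l3] is a nonzerodivisor modulo
   [l1] and [l2]. *)
have [d [d' rE]] : exists d d', r12 = d * l1 + d' * l2.
  apply: (lform_regular (k := k) (l := l) (z'' := z'') (c := - r23) (c' := r13)) => //.
  rewrite -/l1 -/l2 -/l3; apply: (mulIf nz).
  have := ent _ _ j0 R12; rewrite !mxE => H12.
  have := ent _ _ j0 R13; rewrite !mxE => H13.
  have := ent _ _ j0 R23; rewrite !mxE => H23.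
  transitivity (l3 * (r12 * s j0 0)); first by ring.
  transitivity (l2 * (r13 * s j0 0) - l1 * (r23 * s j0 0)); last by ring.
  by rewrite -H12 -H13 -H23; ring.
(* Now [l2] times [v1 - d' *: s] equals [l1] times [v2 + d *: s], so [l1] divides the corrected lift
   [v1 - d' *: s]; the quotient is a lift of [p]. *)
have [v vE] : exists v, v1 - d' *: s = l1 *: v.
  suff /choice[v vE] : forall j, exists x, (v1 - d' *: s) j 0 = x * l1.
    exists (\col_j v j); apply/matrixP => j i; rewrite ord1 vE !mxE; exact: mulrC.
  move=> j; apply: (lform_cancel wy aw bw ab (z' := z')); rewrite -/l1 -/l2.
  exists ((v2 + d *: s) j 0); have := ent _ _ j R12; rewrite !mxE rE => H.
  apply/eqP; rewrite -subr_eq0; apply/eqP.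
  transitivity ((l2 * v1 j 0 - l1 * v2 j 0) - (d * l1 + d' * l2) * s j 0).
    by ring.
  by rewrite H; ring.
have l10 : l1 != 0 by apply: lform_neq0.
exists v.
  have : l1 *: (JM *m v) = 0 by rewrite scalemxAr -vE mulmxBr k1 -scalemxAr s_ker scaler0 subr0.
  move/matrixP => H; apply/matrixP => i j; have := H i j; rewrite !mxE => /eqP.
  by rewrite mulf_eq0 (negPf l10) => /eqP.
move=> i j; apply: (mulfI l10); rewrite mulrA -E1.
have vi i' : l1 * v i' 0 = v1 i' 0 - d' * s i' 0.
  by have := ent _ _ i' vE; rewrite !mxE.
transitivity (s i 0 * (l1 * v j 0) - s j 0 * (l1 * v i 0)); first by rewrite /wedge; ring.
by rewrite !vi /wedge; ring.
Qed.

End Colon.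

(** For [p] of degree at most [t], the homogenization of [p] in degree [t]: the [t]-th power of
    [X_y] times the value of [p] at [X_w / X_y]. A smaller degree of [p] shows as factors [X_y]. *)
Definition bform (K : fieldType) (t : nat) (p : {poly K}) (y w : 'I_4) :
    {mpoly K[4]} :=
  \sum_(i < t.+1) p`_i *: ('X_w ^+ i * 'X_y ^+ (t - i)).

Lemma bform_coef (K : fieldType) b (p : {poly K}) (y w : 'I_4) (k : nat) :
  y != w -> (k <= b)%N ->
  (bform b p y w)@_(U_(w) *+ k + U_(y) *+ (b - k)) = p`_k.
Proof.
move=> yw kb; rewrite raddf_sum /= (bigD1 (Ordinal (kb : (k < b.+1)%N))) //= big1.
  by rewrite !mpolyXn -mpolyXD mcoeffZ mcoeffX eqxx mulr1 addr0.
move=> l lk; rewrite !mpolyXn -mpolyXD mcoeffZ mcoeffX.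
case: eqP => [/mnmP/(_ w)|_]; last by rewrite mulr0.
rewrite !mnmDE !mulmnE !mnm1E eqxx (negPf yw) !mul0n !addn0 !mul1n => E.
by case/eqP: lk; apply: val_inj.
Qed.

Lemma homZ_bform (K : fieldType) b (p : {poly K}) y w : homZ b%:Z (bform b p y w).
Proof.
apply: homZ_sum => i _; apply: homZZ.
have -> : b%:Z = 1 * i%:Z + 1 * (b - i)%N%:Z.
  by rewrite !mul1r -PoszD subnKC // -ltnS.
by apply: homZM; apply/homZX/homZ_var.
Qed.

Section BinaryForms.
Variable K : closedFieldType.
Local Notation R := {mpoly K[4]}.

Lemma bform_root t (p : {poly K}) z y w : (size p <= t.+1)%N ->
  bform t.+1 (p * ('X - z%:P)) y w = lform w y z * bform t p y w.
Proof.
move=> sp; rewrite /bform mulr_sumr.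
rewrite (eq_bigr (fun i : 'I_t.+2 => (p * 'X)`_i *: ('X_w ^+ i * 'X_y ^+ (t.+1 - i)) -
   (z * p`_i) *: ('X_w ^+ i * 'X_y ^+ (t.+1 - i)) : R)); last first.
  by move=> i _; rewrite -scalerBl mulrBr coefB coefMC [z * _]mulrC.
rewrite sumrB big_ord_recl coefMX /= scale0r add0r.
rewrite [X in _ - X]big_ord_recr /= nth_default // mulr0 scale0r addr0 -sumrB.
apply: eq_bigr => i _; rewrite /lform /bump /= !add1n coefMX /= subSS.
have it : (i <= t)%N by rewrite -ltnS.
rewrite (subSn it) !exprS.
rewrite -scalerA -!mul_mpolyC mulrBl; congr (_ - _); first by ring.
ring.
Qed.

(* A chain of factors of a binary form lying in I yields a linear form killing
   a nonzero class modulo I. *)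
Lemma bform_annihilator (I : R -> Prop) t (p : {poly K}) y w u :
  (forall c q, I q -> I (c * q)) -> p != 0 -> (size p <= t.+1)%N ->
  I (bform t p y w * u) -> ~ I u ->
  exists c z, ~ I (c * u) /\
    (I (lform w y z * (c * u)) \/ I (lform y w z * (c * u))).
Proof.
move=> IM; elim: t p => [|t IHt] p p0 sp Ib nu.
  exfalso; apply: nu; have pE := size1_polyC sp.
  have c0 : p`_0 != 0 by apply: contra_neq p0 => E; rewrite pE E.
  have -> : u = ((p`_0)^-1)%:MP * (bform 0 p y w * u).
    rewrite /bform big_ord_recl big_ord0 addr0 /= subn0 !expr0 mulr1.
    by rewrite mulrA -[_ *: 1]mul_mpolyC mulr1 -mpolyCM mulVf // mul1r.
  exact: IM.
have [sp1|sp1] := leqP (size p) 1.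
  have pE := size1_polyC sp1.
  (* A constant [p] homogenizes to a multiple of a power of [X_y], whose linear factor is
     [lform y w 0]. *)
  have E : bform t.+1 p y w = lform y w 0 * bform t p y w.
    rewrite /lform scale0r subr0 /bform big_ord_recl [in RHS]big_ord_recl.
    rewrite !big1 => [|i _|i _]; rewrite ?addr0; last 2 first.
    - by rewrite nth_default ?scale0r // (leq_trans sp1).
    - by rewrite nth_default ?scale0r // (leq_trans sp1).
    by rewrite /= !subn0 exprS -!scalerAr; congr (_ *: _); ring.
  have [Ib'|nb] := EM (I (bform t p y w * u)).
    by apply: (IHt p) => //; apply: leq_trans sp1 _.
  by exists (bform t p y w), 0; split=> //; right; rewrite mulrA -E.
have /closed_rootP[z /factor_theorem[p' pE]] : size p != 1%N by rewrite gtn_eqF.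
have p'0 : p' != 0 by apply: contra_neq p0 => E; rewrite pE E mul0r.
have sp' : (size p' <= t.+1)%N.
  by move: sp; rewrite pE size_Mmonic ?monicXsubC // size_XsubC addn2.
rewrite pE bform_root // in Ib.
have [Ib'|nb] := EM (I (bform t p' y w * u)); first exact: (IHt p').
by exists (bform t p' y w), z; split=> //; left; rewrite mulrA.
Qed.

Lemma unit_ideal (f g : R) (s : 'cV[R]_4) :
  jacR f g *m s = 0 -> s != 0 -> coprime_family (fun j => s j 0) ->
  (forall y w : 'I_4, y != w -> exists t (p : {poly K}), [/\ p != 0, (size p <= t.+1)%N
     & zero_ideal f g s (bform t p y w)]) ->
  zero_ideal f g s 1.
Proof.
move=> ks s0 cs bf; apply: contrapT => n1.
set I := zero_ideal f g s in bf n1 *.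
have IM c q : I q -> I (c * q) by apply: zero_idealM.
have step y w u : y != w -> ~ I u -> exists c z, ~ I (c * u) /\
    (I (lform w y z * (c * u)) \/ I (lform y w z * (c * u))).
  move=> yw nu; have [t [p [p0 sp Ib]]] := bf y w yw.
  by apply: (bform_annihilator (t := t) (p := p)) => //; rewrite mulrC; apply: IM.
have {}step y w u : y != w -> ~ I u -> exists c a b z, [/\ ~ I (c * u),
    I (lform a b z * (c * u)) & (a, b) = (w, y) \/ (a, b) = (y, w)].
  move=> yw nu; have [c [z [nc [H|H]]]] := step y w u yw nu.
    by exists c, w, y, z; split=> //; left.
  by exists c, y, w, z; split=> //; right.
(* Each step multiplies the class by some [c], which keeps it nonzero modulo [I] and preserves the
   earlier annihilators. *)
have [c1 [a1 [b1 [z1 [n2 I1 E1]]]]] := step o0 o1 1 isT n1.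
have [c2 [a2 [b2 [z2 [n3 I2 E2]]]]] := step o2 o3 _ isT n2.
have b12 : b1 != b2 by case: E1 => -[_ ->]; case: E2 => -[_ ->].
(* The variables [b1] and [b2] survive the elimination of [a1] and [a2]; a third form in them
   completes a regular sequence. *)
have [c3 [a3 [b3 [z3 [n4 I3 E3]]]]] := step b1 b2 _ b12 n3.
apply: n4; apply: (zero_ideal_colon ks s0 cs (z := z1) (z' := z2) (z'' := z3)
    (w := a1) (y := b1) (a := a2) (b := b2) (k := a3) (l := b3)) => //.
1-9: by case: E1 => -[? ?]; case: E2 => -[? ?]; case: E3 => -[? ?]; subst.
- rewrite (_ : lform _ _ _ * _ = c3 * (c2 * (lform a1 b1 z1 * (c1 * 1)))); last by ring.
  by apply: (IM); apply: (IM).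
- rewrite (_ : lform _ _ _ * _ = c3 * (lform a2 b2 z2 * (c2 * (c1 * 1)))); last by ring.
  exact: IM.
Qed.

End BinaryForms.

(** * Sections of least degree *)

Lemma leq_dim_limg (K : fieldType) (U V : vectType K) (h : 'Hom(U, V)) :
  (\dim (limg h) <= \dim {:U})%N.
Proof. by rewrite -(limg_ker_dim h fullv) leq_addl. Qed.

Lemma dim_limg_inj (K : fieldType) (X Y : vectType K) (J : {linear X -> Y}) :
  (forall x, J x = 0 -> x = 0) -> \dim (limg (linfun J)) = \dim {:X}.
Proof.
move=> inj; rewrite limg_dim_eq // capfv; apply/vspaceP => x.
rewrite mem_lker_linear memv0; apply/eqP/eqP => [/inj//|->]; exact: linear0.
Qed.

Lemma val_dhomogP n (K : fieldType) d (c : K) (p q : dhomog n K d) :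
  val (c *: p + q) = c *: val p + val q.
Proof. by []. Qed.

Section MinimalSection.
Variable K : fieldType.
Local Notation R := {mpoly K[4]}.
Implicit Types (t : int).

Variables (f g : R) (df dg : nat).
Hypotheses (hf : f \is (df.+1).-homog) (hg : g \is (dg.+1).-homog).
Hypothesis hnormal : normal f g df dg.

Local Notation A := (cminor (grad f) (grad g)).
Local Notation JM := (jacR f g).

Let coA := cminor_coprime hf hg hnormal.
Let A0 := cminor_neq0 hnormal.

Definition kernel_section t (s : 'cV[R]_4) :=
  [/\ vhom src t s, JM *m s = 0 & s != 0].

Lemma minor_section : exists s, kernel_section (df + dg)%N s.
Proof.
have [i [l nz]] := A0; exists (cminor_col f g l); split.
- by move=> j; rewrite mxE /src add0r; apply: homZ_cminor.
- exact: jac_cminor_col.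
- by apply: contra_neq nz => /matrixP/(_ i 0); rewrite !mxE.
Qed.

Lemma min_section : exists (e : nat) s, [/\ kernel_section e s, (e <= df + dg)%N
  & forall (e' : nat) s', kernel_section e' s' -> (e <= e')%N].
Proof.
have ex : exists e : nat, `[< exists s, kernel_section e s >].
  by exists (df + dg)%N; apply/asboolP; apply: minor_section.
have [e /asboolP[s hs] me] := ex_minnP ex; exists e, s; split=> //.
  by apply: me; apply/asboolP; apply: minor_section.
by move=> e' s' hs'; apply: me; apply/asboolP; exists s'.
Qed.

(** A common prime factor would be homogeneous of positive degree, and dividing by it would give a
    section of smaller degree. *)
Lemma min_section_coprime (e : nat) s : kernel_section e s ->
  (forall (e' : nat) s', kernel_section e' s' -> (e <= e')%N) ->
  coprime_family (fun j => s j 0).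
Proof.
move=> [hs ks s0] emin p pp; apply: contrapT => /forallNP H.
have /choice[c cE] : forall j, exists c, s j 0 = c * p by move=> j; apply: contrapT (H j).
have [j nz] := entry_neq0 s0.
have [p0 _ _] := pp.
have hsj i : homZ e%:Z (s i 0) by have := hs i; rewrite /src add0r.
have [k hk] : exists k, homZ k p.
  apply: (@homZ_factor _ e%:Z p (c j)); rewrite mulrC -cE //.
have k0 := prime_homog_deg pp hk.
have hc i : homZ (e%:Z - k) (c i).
  by apply: (homZ_divl p0 hk); rewrite mulrC -cE addrC subrK.
have cj0 : c j != 0 by apply: contra_neq nz => E; rewrite cE E mul0r.
have ek : 0 <= e%:Z - k.
  rewrite leNgt; apply/negP => lt; case/eqP: cj0; exact: homZ_neg lt (hc j).
have Hs : kernel_section (absz (e%:Z - k)) (\col_i c i).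
  rewrite gez0_abs //; split.
  - by move=> i; rewrite mxE /src add0r.
  - have : p *: (JM *m \col_i c i) = 0.
      rewrite scalemxAr -[RHS]ks; congr (_ *m _); apply/matrixP => i l.
      by rewrite !mxE ord1 cE mulrC.
    move/matrixP => E; apply/matrixP => i l; have := E i l; rewrite mxE [RHS]mxE.
    by move/eqP; rewrite mulf_eq0 (negPf p0) [RHS]mxE => /eqP.
  - by apply: contra_neq cj0 => /matrixP/(_ j 0); rewrite !mxE.
have := emin _ _ Hs; clear -k0 ek; lia.
Qed.

Section Dimension.
Variables (e t a b : nat) (s : 'cV[R]_4).
Hypotheses (hs : kernel_section e s) (cs : coprime_family (fun j => s j 0)).
Hypotheses (ta : (a + e = t)%N) (tb : (b + (df + dg) = t + e)%N).
Variables (i j : 'I_4).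
Hypothesis nzA : A i j != 0.

Local Notation X := {ffun 'I_4 -> dhomog 4 K t}.
Local Notation U := (lker (linfun (@jac_t K f g df dg t))).

Lemma mem_kernel x : (x \in U) = (JM *m colX x == 0).
Proof. exact: (mem_lker_jac hf hg). Qed.

(** As [A i j] is nonzero, the entry [(i, j)] alone determines [p] in [s /\ x = p A]. For [x] of
    degree [t], this [p] has degree [b], and the coefficient of a multiple of [s] has degree [a]. *)
Definition wedge_entry (x : X) : dhomog 4 K (t + e) :=
  indhomog (t + e) (wedge s (colX x) i j).

Lemma val_wedge_entry x : val (wedge_entry x) = wedge s (colX x) i j.
Proof.
have [hvs _ _] := hs; apply: val_indhomog; rewrite /wedge PoszD [_ + _]addrC.
by apply: homZB; apply: homZM; (have := hvs i; have := hvs j; have := vhom_colX x i;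
  have := vhom_colX x j; rewrite /src !add0r).
Qed.

Lemma wedge_entry_linear : linear wedge_entry.
Proof.
move=> c x x'; apply: val_inj; rewrite linearP /= -!/(val (wedge_entry _)).
rewrite !val_wedge_entry colXP /wedge !mxE -!mul_mpolyC; ring.
Qed.

HB.instance Definition _ :=
  GRing.isLinear.Build K X (dhomog 4 K (t + e)) _ wedge_entry wedge_entry_linear.

Lemma dim_kernel_cap : (\dim (U :&: lker (linfun wedge_entry)) <= \dim {:dhomog 4 K a})%N.
Proof.
have [hvs ks s0] := hs.
pose mu (r : dhomog 4 K a) : X := [ffun k => indhomog t (val r * s k 0)].
have muE r k : val (mu r k) = val r * s k 0.
  rewrite ffunE val_indhomog // -ta PoszD.
  by apply: homZM (homZ_dhomog r) _; have := hvs k; rewrite /src add0r.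
have mu_lin : linear mu.
  move=> c r r'; apply/ffunP => k; apply: val_inj.
  have -> : (c *: mu r + mu r') k = c *: mu r k + mu r' k by rewrite !ffunE.
  by rewrite val_dhomogP !muE val_dhomogP mulrDl scalerAl.
pose muL : {linear _ -> _} := HB.pack mu (GRing.isLinear.Build _ _ _ _ mu mu_lin).
apply: leq_trans (leq_dim_limg (linfun muL)); apply: dimvS; apply/subvP => x.
rewrite memv_cap mem_kernel => /andP[/eqP kx].
rewrite (_ : (x \in _) = (wedge_entry x == 0)); last exact: mem_lker_linear.
move=> /eqP wx0; apply/mem_limg_linear.
have [p pE] := wedge_factor coA A0 ks kx.
have p0 : p = 0.
  apply/eqP; have := pE i j; rewrite -val_wedge_entry wx0 => /esym/eqP.
  by rewrite mulf_eq0 (negPf nzA) orbF.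
have [|c cE] := wedge_eq0 s0 cs (v := colX x).
  by move=> k l; rewrite pE p0 mul0r.
have [l nzl] := entry_neq0 s0.
have hc : homZ a%:Z c.
  apply: (homZ_divl nzl (k := e)); first by have := hvs l; rewrite /src add0r.
  have := vhom_colX x l; rewrite cE mxE mulrC /src add0r.
  by rewrite -PoszD addnC ta.
exists (indhomog a c); rewrite ?memvf //; apply/ffunP => k; apply: val_inj.
rewrite [val (muL _ _)](muE _ k) val_indhomog //.
by have := congr1 (fun v : 'cV[R]_4 => v k 0) cE; rewrite !mxE.
Qed.

Definition minor_multiple (r : dhomog 4 K b) : dhomog 4 K (t + e) :=
  indhomog (t + e) (val r * A i j).

Lemma val_minor_multiple r : val (minor_multiple r) = val r * A i j.
Proof.
apply: val_indhomog; rewrite -tb PoszD.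
by apply: homZM (homZ_dhomog r) (homZ_cminor hf hg i j).
Qed.

Lemma minor_multiple_linear : linear minor_multiple.
Proof.
move=> c r r'; apply: val_inj.
by rewrite val_dhomogP !val_minor_multiple val_dhomogP mulrDl scalerAl.
Qed.

HB.instance Definition _ :=
  GRing.isLinear.Build K _ (dhomog 4 K (t + e)) _ minor_multiple
    minor_multiple_linear.

Lemma wedge_image_sub :
  (linfun wedge_entry @: U <= limg (linfun minor_multiple))%VS.
Proof.
have [hvs ks s0] := hs; apply/subvP => y /mem_limg_linear[x].
rewrite mem_kernel => /eqP kx ->; apply/mem_limg_linear.
have [p pE] := wedge_factor coA A0 ks kx.
have hp : homZ b%:Z p.
  apply: (homZ_divl nzA (homZ_cminor hf hg i j)); rewrite mulrC -pE -val_wedge_entry.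
  by rewrite -PoszD addnC tb; apply: homZ_dhomog.
exists (indhomog b p); rewrite ?memvf //; apply: val_inj.
rewrite [LHS]val_wedge_entry [RHS]val_minor_multiple val_indhomog //.
Qed.

Lemma dim_kernel_le : (\dim U <= \dim {:dhomog 4 K a} + \dim {:dhomog 4 K b})%N.
Proof.
rewrite -(limg_ker_dim (linfun wedge_entry) U) leq_add ?dim_kernel_cap //.
exact: leq_trans (dimvS wedge_image_sub) (leq_dim_limg _).
Qed.

Lemma minor_multiple_inj r : minor_multiple r = 0 -> r = 0.
Proof.
move/(congr1 val); rewrite val_minor_multiple => /eqP.
by rewrite mulf_eq0 (negPf nzA) orbF => /eqP E; apply: val_inj.
Qed.

(** The dimension hypothesis bounds by [C] the codimension, among forms of degree [b], of the degree
    [b] part of the ideal. Polynomials of size at most [C.+1] give a space of binary forms of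
    dimension [C.+1], which must meet it. *)
Lemma zero_ideal_bform C y w : y != w -> (C <= b)%N ->
  (\dim {:dhomog 4 K a} + \dim {:dhomog 4 K b} <= \dim U + C)%N ->
  exists p : {poly K}, [/\ p != 0, (size p <= b.+1)%N
    & zero_ideal f g s (bform b p y w)].
Proof.
move=> yw Cb dimU; have [hvs ks s0] := hs.
pose beta (r : 'rV[K]_C.+1) : dhomog 4 K (t + e) :=
  minor_multiple (indhomog b (bform b (rVpoly r) y w)).
have bformP c (p q : {poly K}) : bform b (c *: p + q) y w =
    c *: bform b p y w + bform b q y w.
  rewrite /bform scaler_sumr -big_split; apply: eq_bigr => k _ /=.
  by rewrite coefD coefZ scalerDl scalerA.
have beta_lin : linear beta.
  move=> c r r'; rewrite /beta -linearP; congr minor_multiple.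
  apply: val_inj; rewrite val_dhomogP !val_indhomog; try exact: homZ_bform.
  by rewrite linearP bformP.
pose betaL : {linear _ -> _} :=
  HB.pack beta (GRing.isLinear.Build _ _ _ _ beta beta_lin).
have beta_inj r : beta r = 0 -> r = 0.
  move=> /minor_multiple_inj/(congr1 val); rewrite val_indhomog; last exact: homZ_bform.
  move=> E; rewrite -[r]rVpolyK; apply/rowP => k; rewrite !mxE.
  have kb : (k <= b)%N by apply: leq_trans Cb; rewrite -ltnS.
  by rewrite -(bform_coef (rVpoly r) yw kb) E mcoeff0.
pose V := (linfun wedge_entry @: U)%VS; pose W := limg (linfun betaL).
have dimW : \dim W = C.+1.
  transitivity (\dim {:'rV[K]_C.+1}); first exact: dim_limg_inj.
  by rewrite dimvf -[RHS]mul1n.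
have dimV : (\dim {:dhomog 4 K b} <= \dim V + C)%N.
  have := limg_ker_dim (linfun wedge_entry) U; have := dim_kernel_cap.
  rewrite -/V; move: dimU; lia.
have WV : (V + W <= limg (linfun minor_multiple))%VS.
  rewrite subv_add wedge_image_sub; apply/subvP => z /mem_limg_linear[r _ ->].
  by apply/mem_limg_linear; exists (indhomog b (bform b (rVpoly r) y w)); rewrite ?memvf.
have : (0 < \dim (V :&: W))%N.
  have le : (\dim (V + W) <= \dim {:dhomog 4 K b})%N.
    exact: leq_trans (dimvS WV) (leq_dim_limg _).
  have := dimv_sum_cap V W; rewrite dimW => E.
  rewrite lt0n; apply: contraTneq dimV => E0; rewrite -ltnNge.
  rewrite E0 addn0 in E; move: le; rewrite E addnS; exact.
rewrite lt0n dimv_eq0 => /eqP nz.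
have [z zVW z0] : exists2 z, z \in (V :&: W)%VS & z != 0.
  apply: contrapT => H; apply: nz; apply/vspaceP => z; rewrite memv0.
  apply/idP/eqP => [zVW|->]; last exact: mem0v.
  by apply/eqP; apply: contrapT => /negP z0; apply: H; exists z.
move: zVW; rewrite memv_cap => /andP[/mem_limg_linear[x xU zx] /mem_limg_linear[r _ zr]].
exists (rVpoly r); split.
- by apply: contra_neq z0 => E; rewrite zr -[betaL r]/(beta r) /beta E /bform
    big1 => [|k _]; [apply: val_inj; rewrite val_minor_multiple val_indhomog
      ?mul0r //; exact: homZ0 | rewrite coef0 scale0r].
- by apply: leq_trans (size_poly _ _) _; rewrite ltnS.
move: xU; rewrite mem_kernel => /eqP kx; exists (colX x) => //.
have [p pE] := wedge_factor coA A0 ks kx.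
suff -> : bform b (rVpoly r) y w = p by [].
apply: (mulIf nzA); rewrite -pE -val_wedge_entry -[wedge_entry x]zx zr.
by rewrite [RHS]val_minor_multiple val_indhomog //; apply: homZ_bform.
Qed.

(** Combinations of [s] and [v] are independent: wedging with [s] leaves only the coefficient of
    [v], times [A]. *)
Lemma dim_kernel_ge (c : nat) (v : 'cV[R]_4) : (b + c = t)%N ->
  vhom src c v -> JM *m v = 0 -> (forall k l, wedge s v k l = A k l) ->
  (\dim {:dhomog 4 K a} + \dim {:dhomog 4 K b} <= \dim U)%N.
Proof.
move=> bc hv kv wv; have [hvs ks s0] := hs.
pose T := (dhomog 4 K a * dhomog 4 K b)%type.
pose h (r : T) : X := [ffun k => indhomog t (val r.1 * s k 0 + val r.2 * v k 0)].
have hE r k : val (h r k) = val r.1 * s k 0 + val r.2 * v k 0.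
  rewrite ffunE val_indhomog //; apply: homZD.
    by rewrite -ta PoszD; apply: homZM (homZ_dhomog _) _; have := hvs k; rewrite /src add0r.
  by rewrite -bc PoszD; apply: homZM (homZ_dhomog _) _; have := hv k; rewrite /src add0r.
have colE r : colX (h r) = val r.1 *: s + val r.2 *: v.
  by apply/matrixP => k l; rewrite ord1 !mxE hE.
have h_lin : linear h.
  move=> x r r'; apply/ffunP => k; apply: val_inj.
  have -> : (x *: h r + h r') k = x *: h r k + h r' k by rewrite !ffunE.
  rewrite val_dhomogP !hE /= !mulrDl -!scalerAl scalerDr; exact: addrACA.
pose hL : {linear T -> X} := HB.pack h (GRing.isLinear.Build _ _ _ _ h h_lin).
have -> : (\dim {:dhomog 4 K a} + \dim {:dhomog 4 K b} = \dim (limg (linfun hL)))%N.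
  transitivity (\dim {:T}); first by rewrite !dimvf.
  apply/esym/dim_limg_inj => r hr0.
  have col0 k : val r.1 * s k 0 + val r.2 * v k 0 = 0 by rewrite -hE -[h r]/(hL r) hr0 ffunE.
  have r2 : val r.2 = 0.
    apply: (mulIf nzA); rewrite mul0r -wv /wedge.
    transitivity (s i 0 * (val r.1 * s j 0 + val r.2 * v j 0) -
        s j 0 * (val r.1 * s i 0 + val r.2 * v i 0)); first by ring.
    by rewrite !col0 !mulr0 subr0.
  have [l nzl] := entry_neq0 s0.
  have r1 : val r.1 = 0.
    by apply: (mulIf nzl); rewrite mul0r; have := col0 l; rewrite r2 mul0r addr0.
  by apply: injective_projections; apply: val_inj.
apply: dimvS; apply/subvP => x /mem_limg_linear[r _ ->].
rewrite mem_kernel [colX _]colE mulmxDr -!scalemxAr ks kv !scaler0 addr0 //.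
Qed.

End Dimension.
End MinimalSection.

(** * Compressible sequences *)

Lemma mderiv_var n (K : fieldType) (i j : 'I_n) :
  mderiv i ('X_j : {mpoly K[n]}) = (j == i)%:R.
Proof.
rewrite mderivX mnm1E; case: eqVneq => [->|_]; last by rewrite scale0r.
by rewrite scale1r -{1}[U_(i)%MM]add0m addmK mpolyX0.
Qed.

Section Compressible.
Variable K : fieldType.
Local Notation R := {mpoly K[4]}.
Implicit Types (p h : R) (A B : 'M[K]_4).

Lemma mderiv_comp n k (p : {mpoly K[n]}) (lq : n.-tuple {mpoly K[k]}) i :
  mderiv i (p \mPo lq) = \sum_j (mderiv j p \mPo lq) * mderiv i (tnth lq j).
Proof.
move: p; apply: mpoly_generators_ind => [c|j|p q IHp IHq|p q IHp IHq].
- rewrite comp_mpolyC mderivC big1 // => j _.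
  by rewrite mderivC comp_mpoly0 mul0r.
- rewrite comp_mpolyXU -tnth_nth (bigD1 j) //= big1 => [|l lj].
    by rewrite mderiv_var eqxx comp_mpoly1 mul1r addr0.
  by rewrite mderiv_var eq_sym (negPf lj) comp_mpoly0 mul0r.
- rewrite comp_mpolyD mderivD IHp IHq -big_split; apply: eq_bigr => j _ /=.
  by rewrite mderivD comp_mpolyD mulrDl.
- rewrite rmorphM mderivM IHp IHq mulr_suml mulr_sumr -big_split.
  apply: eq_bigr => j _ /=; rewrite mderivM comp_mpolyD !rmorphM mulrDl.
  by congr (_ + _); rewrite -?mulrA //; congr (_ * _); rewrite mulrC.
Qed.

Lemma linear_substX A j : linear_subst A 'X_j = \sum_k A j k *: 'X_k.
Proof. by rewrite /linear_subst comp_mpolyXU -tnth_nth tnth_mktuple. Qed.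

Lemma linear_substD A : {morph linear_subst A : p q / p + q}.
Proof. by move=> p q; rewrite /linear_subst comp_mpolyD. Qed.

Lemma linear_substM A : {morph linear_subst A : p q / p * q}.
Proof. by move=> p q; rewrite /linear_subst rmorphM. Qed.

Lemma linear_subst0 A : linear_subst A 0 = 0.
Proof. by rewrite /linear_subst comp_mpoly0. Qed.

Lemma linear_substK A B : A *m B = 1%:M -> cancel (linear_subst A) (linear_subst B).
Proof.
move=> AB; apply: mpoly_generators_ind => [c|j|p q IHp IHq|p q IHp IHq].
- by rewrite /linear_subst !comp_mpolyC.
- rewrite linear_substX (big_morph _ (linear_substD B) (linear_subst0 B)).
  transitivity (\sum_l (A *m B) j l *: ('X_l : R)).
    rewrite (eq_bigr (fun k => \sum_l (A j k * B k l) *: ('X_l : R))).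
      rewrite exchange_big; apply: eq_bigr => l _.
      by rewrite mxE scaler_suml.
    move=> k _; rewrite [LHS]comp_mpolyZ -/(linear_subst B _) linear_substX scaler_sumr.
    by apply: eq_bigr => l _; rewrite scalerA.
  rewrite AB (bigD1 j) //= big1 => [|l lj]; first by rewrite mxE eqxx scale1r addr0.
  by rewrite mxE eq_sym (negPf lj) scale0r.
- by rewrite !linear_substD IHp IHq.
- by rewrite !linear_substM IHp IHq.
Qed.

Lemma mderiv_linear_subst A i h : mderiv i (linear_subst A h) =
  linear_subst A (\sum_j A j i *: mderiv j h).
Proof.
rewrite [LHS]mderiv_comp (big_morph _ (linear_substD A) (linear_subst0 A)).
apply: eq_bigr => j _; rewrite tnth_mktuple -/(linear_subst A (mderiv j h)).
rewrite -mul_mpolyC linear_substM [linear_subst A _%:MP]comp_mpolyC mulrC.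
congr (_ * _); rewrite (raddf_sum (mderiv i)) (bigD1 i) //= big1 => [|k ki].
  by rewrite mderivZ mderiv_var eqxx addr0 -mul_mpolyC mulr1.
by rewrite mderivZ mderiv_var (negPf ki) scaler0.
Qed.

Hypothesis char0 : [pchar K] =i pred0.

(** Derivation multiplies the coefficient of a monomial by its exponent at [i], which is nonzero in
    characteristic zero as soon as the variable occurs. *)
Lemma free_ofP i h : free_of i h <-> mderiv i h = 0.
Proof.
split=> [fr|d0 m mh].
  apply/mpolyP => m; rewrite mcoeff_deriv mcoeff0.
  rewrite memN_msupp_eq0 ?mul0rn //; apply/negP => /fr.
  by rewrite mnmDE mnm1E eqxx addn1.
apply/eqP; apply: contraTT mh => mi.
have E : (m - U_(i) + U_(i))%MM = m by rewrite submK // lep1mP.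
have := congr1 (mcoeff (m - U_(i))) d0; rewrite mcoeff_deriv E mcoeff0 => /eqP.
rewrite -mulr_natr mulf_eq0 ((pcharf0P K).1 char0) /= orbF => /eqP z.
by rewrite mcoeff_msupp z eqxx.
Qed.

Variables (f g : R).

(** By the chain rule the derivative in the new variable [i] is the derivative along column [i] of
    the substitution matrix. *)
Lemma compressible_kernel : compressible f g <-> exists s, kernel_section f g 0 s.
Proof.
split=> [[A uA [i [fi gi]]]|[s [hs ks s0]]].
  have van h : free_of i (linear_subst A h) -> \sum_j A j i *: mderiv j h = 0.
    move/free_ofP; rewrite mderiv_linear_subst.
    have inj := can_inj (linear_substK (mulmxV uA)); move=> E; apply: inj.
    by rewrite E linear_subst0.
  exists (\col_j (A j i)%:MP); split.
  - move=> j; rewrite mxE /src addr0 -(mulr1 _%:MP) mul_mpolyC.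
    exact/homZZ/homZ1.
  - apply/jac_kerP; split; [rewrite -[RHS](van f fi) | rewrite -[RHS](van g gi)].
      by apply: eq_bigr => j _; rewrite mxE mulrC mul_mpolyC.
    by apply: eq_bigr => j _; rewrite mxE mulrC mul_mpolyC.
  - apply/eqP => /matrixP E.
    have Ai j : A j i = 0.
      have := E j 0; rewrite !mxE => /(congr1 (mcoeff 0%MM)).
      by rewrite mcoeffC mcoeff0 eqxx mulr1.
    have := mulVmx uA => /matrixP/(_ i i); rewrite !mxE eqxx big1 => [|j _].
      by move/eqP; rewrite eq_sym oner_eq0.
    by rewrite Ai mulr0.
have [l nz] := entry_neq0 s0.
pose c j := (s j 0)@_0%MM.
have cE j : s j 0 = (c j)%:MP by apply: homZ_const; have := hs j; rewrite /src addr0.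
have cl : c l != 0 by apply: contra_neq nz => E; rewrite cE E mpolyC0.
(* The identity matrix with column [l] replaced by the constant vector; [B] is its inverse,
   available since [c l] is nonzero. *)
pose A := \matrix_(j, k) (if k == l then c j else (j == k)%:R) : 'M[K]_4.
pose B := \matrix_(j, k) (if k == l then (if j == l then 1 else - c j) / c l
                          else (j == k)%:R) : 'M[K]_4.
have AB : A *m B = 1%:M.
  apply/matrixP => j k; rewrite !mxE (bigD1 l) //= !mxE !eqxx.
  rewrite (eq_bigr (fun n => if n == j then (j != l)%:R * B j k else 0)); last first.
    move=> n pl; rewrite mxE (negPf pl); case: eqVneq => [->|]; first by rewrite pl.
    by rewrite mul0r.
  have -> : \sum_(n | n != l) (if n == j then (j != l)%:R * B j k else 0) =
      (j != l)%:R * B j k.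
    case: (eqVneq j l) => [->|jl].
      rewrite mul0r big1 // => p pl; by rewrite (negPf pl).
    rewrite (bigD1 j) //= eqxx big1 ?addr0 // => p /andP[_ pj].
    by rewrite (negPf pj).
  rewrite mxE; case: (eqVneq k l) => [->|kl].
    case: (eqVneq j l) => [->|jl]; first by rewrite mul0r addr0 mul1r divff.
    by rewrite !mul1r mulNr subrr.
  have lk : (l == k) = false by rewrite eq_sym (negPf kl).
  rewrite /= mulr0 add0r; case: (eqVneq j l) => [->|jl]; last by rewrite mul1r.
  by rewrite mul0r ?lk.
have [uA _] := mulmx1_unit AB.
have fr h : dot (grad h) (s^~ 0) = 0 -> free_of l (linear_subst A h).
  move=> E; apply/free_ofP; rewrite mderiv_linear_subst.
  rewrite (_ : \sum_j _ = 0) ?linear_subst0 //.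
  by rewrite -[RHS]E; apply: eq_bigr => j _; rewrite mxE eqxx cE -mul_mpolyC mulrC.
have /jac_kerP[sf sg] := ks.
by exists A => //; exists l; split; apply: fr.
Qed.

End Compressible.

(** * Global sections and splitting *)

Lemma wedge_ratio (E : fieldType) (si sj xi xj a p h : E) : a != 0 -> h != 0 ->
  si * (h * xj) - sj * (h * xi) = p * a -> (si * xj - sj * xi) / a = p / h.
Proof.
move=> a0 h0 H; apply: (mulIf a0); rewrite divfK // mulrAC -H.
by apply: (mulIf h0); rewrite divfK //; ring.
Qed.

Lemma mul_div_mid (E : fieldType) (b a P : E) : b != 0 -> a * P = b * P * (a / b).
Proof. by move=> b0; field. Qed.

Lemma wedge_comb (E : comPzRingType) (si sj vi vj a b : E) :
  si * (a * sj + b * vj) - sj * (a * si + b * vi) = b * (si * vj - sj * vi).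
Proof. ring. Qed.

Lemma comb_div (E : fieldType) (z s y : E) : s != 0 -> (z * s + y * 0) / s = z.
Proof. by move=> s0; rewrite mulr0 addr0 mulfK. Qed.

Lemma wedge_comb_div (E : fieldType) (si sj vi vj a b w : E) : w != 0 ->
  si * vj - sj * vi = w ->
  (si * (a * sj + b * vj) - sj * (a * si + b * vi)) / w = b.
Proof. by move=> w0 H; rewrite wedge_comb H mulfK. Qed.

Section GlobalSectionsO.
Variable K : fieldType.
Local Notation R := {mpoly K[4]}.
Local Notation F := {fraction {mpoly K[4]}}.
Implicit Types (n t : int) (q : point K).

(* Ideals of denominators contain powers of X_0 and X_1, which are coprime. *)
Lemma global_sectO n (x : F) : sectO n (@whole K) x ->
  exists2 c : R, homZ n c & x = tofrac c.
Proof.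
move=> hx.
have den (i : 'I_4) : exists (m : nat) (c : R), tofrac ('X_i ^+ m) * x = tofrac c.
  pose D (h : R) := (exists k, homZ k h) /\ exists c, tofrac h * x = tofrac c.
  have dX : divides 'X_i ('X_i : R) by exists 1; rewrite mul1r.
  have [|q _|m] := @point_avoiding K D 'X_i 1 i _ (homZ_var K i) dX.
  - by move=> h [].
  - have /stalkZP[k [l [a [b [_ hb qb _ xE]]]]] := hx q I.
    exists b => //; split; first by exists l.
    by exists a; rewrite xE mulrC divfK // tofrac_neq0 // (point_neq0 qb).
  move=> Dm; exists m; move: Dm.
  apply: (ideal_ind (P := fun h => exists c, tofrac h * x = tofrac c)).
    by exists 0; rewrite tofrac0 mul0r.
  move=> a h v [_ [c cE]] [c' cE']; exists (a * c + c').
  by rewrite !tofracD !tofracM mulrDl -mulrA cE cE'.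
have [m [c0 E0]] := den o0; have [k [c1 E1]] := den o1.
have E : 'X_o1 ^+ k * c0 = 'X_o0 ^+ m * c1 :> R.
  by apply: tofrac_inj; rewrite !tofracM -E0 -E1 mulrCA.
have [|c cE] := @mnm_divide 4 K (U_(o0) *+ m)%MM c0.
  move=> mu mc0; apply/mnm_lepP => i; rewrite mulmnE mnm1E.
  case: eqP => [<-|_]; last by rewrite mul0n.
  rewrite mul1n.
  have : (U_(o1) *+ k + mu)%MM \in msupp ('X_o0 ^+ m * c1 : R).
    rewrite -E mpolyXn mulrC (perm_mem (msuppMX _ _)).
    by apply/mapP; exists mu.
  rewrite mpolyXn mulrC (perm_mem (msuppMX _ _)) => /mapP[nu _ /mnmP/(_ o0)].
  by rewrite !mnmDE !mulmnE !mnm1E /= mul0n mul1n add0n => ->; rewrite leq_addr.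
have xE : x = tofrac c.
  have X0 : tofrac ('X_o0 ^+ m) != 0 :> F.
    by rewrite tofrac_eq0 expf_neq0 // var_neq0.
  by apply: (mulfI X0); rewrite E0 cE mpolyXn tofracM mulrC.
exists c => //; have [q _] := zero_point K.
by apply: tofrac_hfrac; rewrite -xE; apply: stalk_hfrac (hx q I).
Qed.

Variables (f g : R).
Local Notation JM := (jacR f g).
Local Notation tomx := (map_mx (@tofrac R)).

Lemma tomx_inj m k (P Q : 'M[R]_(m, k)) : tomx P = tomx Q -> P = Q.
Proof.
move=> /matrixP E; apply/matrixP => i j; apply: tofrac_inj.
by have := E i j; rewrite !mxE.
Qed.

Lemma global_sectT t : (exists2 v, sectT f g t (@whole K) v & v != 0) <->
  exists s, kernel_section f g t s.
Proof.
split=> [[v [hv kv] v0]|[s [hs ks s0]]].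
  have /choice[c hc] : forall j, exists c : R, homZ t c /\ v j 0 = tofrac c.
    by move=> j; have [c h1 h2] := global_sectO (hv j); exists c.
  have vE : v = tomx (\col_j c j).
    by apply/matrixP => j k; rewrite ord1 !mxE; case: (hc j).
  exists (\col_j c j); split.
  - by move=> j; rewrite mxE /src add0r; case: (hc j).
  - by apply: tomx_inj; rewrite map_mxM -vE -jacobianE kv map_mx0.
  - by apply: contra_neq v0 => E; rewrite vE E map_mx0.
exists (tomx s).
  split; last by rewrite jacobianE -map_mxM ks map_mx0.
  move=> j q _; rewrite mxE; apply: stalk_hom.
  by have := hs j; rewrite /src add0r.
by apply: contra_neq s0 => E; apply: tomx_inj; rewrite E map_mx0.
Qed.

Lemma kernel_section_ge0 t s : kernel_section f g t s -> (0 <= t)%R.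
Proof.
move=> [hs _ s0]; have [j nz] := entry_neq0 s0; rewrite leNgt; apply/negP => t0.
by case/eqP: nz; apply: (homZ_neg t0); have := hs j; rewrite /src add0r.
Qed.

Lemma is_indeg0 : is_indeg f g 0 <-> exists s, kernel_section f g 0 s.
Proof.
split=> [[/global_sectT]//|hs]; split; first exact/global_sectT.
by move=> k /global_sectT[s /kernel_section_ge0].
Qed.

End GlobalSectionsO.

Section SheafIso.
Variable K : fieldType.
Local Notation R := {mpoly K[4]}.
Local Notation F := {fraction {mpoly K[4]}}.
Local Notation tomx := (map_mx (@tofrac R)).
Implicit Types (n t : int) (q : point K).

Variables (f g : R) (df dg : nat).
Hypotheses (hf : f \is (df.+1).-homog) (hg : g \is (dg.+1).-homog).
Hypothesis hnormal : normal f g df dg.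

Local Notation A := (cminor (grad f) (grad g)).
Local Notation JM := (jacR f g).
Local Notation d := (df + dg)%N.
Local Notation split_deg := (fun i : 'I_2 => if i == 0 then 0 else - d%:Z).

Lemma const_section s : kernel_section f g 0 s ->
  exists (c : 'I_4 -> K) l, (forall j, s j 0 = (c j)%:MP) /\ c l != 0.
Proof.
move=> [hs ks s0]; have [l nz] := entry_neq0 s0.
have cE j : s j 0 = ((s j 0)@_0%MM)%:MP.
  by apply: homZ_const; have := hs j; rewrite /src addr0.
exists (fun j => (s j 0)@_0%MM), l; split=> //.
by apply: contra_neq nz => E; rewrite cE E mpolyC0.
Qed.

(** Wedging [s] with column [l] of [A] gives [- s l 0] times [A], and [s l 0] is an invertible
    constant for a suitable [l]. The entry [v l 0] vanishes because [A] is alternating; this later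
    separates the two coordinates. *)
Lemma const_complement s : kernel_section f g 0 s -> exists v l,
  [/\ vhom src d v, JM *m v = 0, forall i j, wedge s v i j = A i j, s l 0 != 0
    & v l 0 = 0].
Proof.
move=> hs; have [_ ks s0] := hs; have [c [l [cE cl]]] := const_section hs.
exists (- (c l)^-1%:MP *: cminor_col f g l), l; split.
- move=> j; rewrite !mxE /src add0r -mpolyCN mul_mpolyC.
  exact/homZZ/homZ_cminor.
- by rewrite -scalemxAr jac_cminor_col scaler0.
- move=> i j; have := wedge_cminor_col l i j ks; rewrite /wedge ![in X in X -> _]mxE => E.
  rewrite !mxE; transitivity (- (c l)^-1%:MP *
    (s i 0 * A j l - s j 0 * A i l)); first by ring.
  by rewrite E cE mulrA mulrNN -mpolyCM mulVf // mpolyC1 mul1r.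
- by rewrite cE mpolyC_eq0.
- by rewrite !mxE cminor_ii mulr0.
Qed.

Lemma jac_ker_frac (x : 'cV[F]_4) : jacobian f g *m x = 0 ->
  dot (fun j => tofrac (grad f j)) (x^~ 0) = 0 /\
  dot (fun j => tofrac (grad g j)) (x^~ 0) = 0.
Proof.
move/matrixP => E; have := E 0 0; have := E 1 0; rewrite !mxE => E1 E0.
split; [rewrite -E0 | rewrite -E1]; by apply: eq_bigr => j _; rewrite !mxE.
Qed.

Lemma tofrac_cminor i j :
  cminor (fun j => tofrac (grad f j)) (fun j => tofrac (grad g j)) i j = tofrac (A i j).
Proof.
have E k l : minor (fun j => tofrac (grad f j)) (fun j => tofrac (grad g j)) k l =
  tofrac (minor (grad f) (grad g) k l) by rewrite /minor tofracB !tofracM.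
by case: (ord4P i) => ->; case: (ord4P j) => ->; rewrite /cminor /= ?E ?tofracN ?tofrac0.
Qed.

(** The ratio of [s /\ x] to [A] is regular even where [A i j] vanishes: once the denominators of
    [x] are cleared, [wedge_factor] provides it as a polynomial. *)
Lemma sect_coef s q (x : 'cV[F]_4) i j : kernel_section f g 0 s ->
  A i j != 0 -> (forall k, stalkO 0 q (x k 0)) -> jacobian f g *m x = 0 ->
  stalkO (- d%:Z) q
    ((tofrac (s i 0) * x j 0 - tofrac (s j 0) * x i 0) / tofrac (A i j)).
Proof.
move=> [hs ks s0] nzA hx kx.
have /choice[y hy] : forall k, exists y : int * R * R,
    [/\ homZ y.1.1 y.1.2, ~ q y.1.2 & x k 0 = tofrac y.2 / tofrac y.1.2].
  move=> k; have /stalkZP[k1 [l [c [b [_ hb qb _ ->]]]]] := hx k.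
  by exists (l, b, c).
pose h : R := \prod_k (y k).1.2.
have [e he] : exists e, homZ e h.
  apply: (big_ind (fun h => exists k, homZ k h)).
  - by exists 0; apply: homZ1.
  - by move=> c b [k hc] [l hb]; exists (k + l); apply: homZM.
  - by move=> k _; exists (y k).1.1; have [] := hy k.
have qh : ~ q h.
  apply: (big_ind (fun h => ~ q h)).
  - exact: point_proper.
  - by move=> c b qc qb /point_prime[].
  - by move=> k _; have [] := hy k.
have h0 := tofrac_neq0 (point_neq0 qh).
pose v : 'cV[R]_4 := \col_k ((y k).2 * \prod_(l | l != k) (y l).1.2).
have vE : tomx v = tofrac h *: x.
  apply/matrixP => k l; rewrite !mxE ord1; have [_ qb ->] := hy k.
  rewrite (_ : h = (y k).1.2 * \prod_(l | l != k) (y l).1.2); last first.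
    by rewrite /h (bigD1 k).
  rewrite !tofracM; move: (tofrac_neq0 (point_neq0 qb)).
  move: (tofrac (y k).1.2) (tofrac (y k).2) (tofrac (\prod_(l | _) _)).
  exact: mul_div_mid.
have hv k : homZ e (v k 0).
  rewrite -[e]add0r; apply: (hfrac_clear he (stalk_hfrac (hx k))).
  by have := congr1 (fun z : 'cV[F]_4 => z k 0) vE; rewrite [LHS]mxE [RHS]mxE.
have kv : JM *m v = 0.
  by apply: tomx_inj; rewrite map_mxM vE -scalemxAr -jacobianE kx scaler0 map_mx0.
have [p pE] := wedge_factor (cminor_coprime hf hg hnormal) (cminor_neq0 hnormal) ks kv.
have hp : homZ (- d%:Z + e) p.
  apply: (homZ_divl nzA (homZ_cminor hf hg i j)); rewrite mulrC -pE addrA subrr add0r.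
  rewrite -[e]add0r; apply: homZB; apply: homZM => //.
    by have := hs i; rewrite /src addr0.
  by have := hs j; rewrite /src addr0.
suff -> : (tofrac (s i 0) * x j 0 - tofrac (s j 0) * x i 0) / tofrac (A i j) =
    tofrac p / tofrac h by apply: stalk_div hp he qh.
have A0 := tofrac_neq0 nzA.
have vk k : tofrac (v k 0) = tofrac h * x k 0.
  by have := congr1 (fun z : 'cV[F]_4 => z k 0) vE; rewrite [LHS]mxE [RHS]mxE.
have H : tofrac (s i 0) * (tofrac h * x j 0) - tofrac (s j 0) * (tofrac h * x i 0) =
    tofrac p * tofrac (A i j).
  by rewrite -!vk -[RHS]tofracM -(pE i j) tofracB !tofracM.
exact: (wedge_ratio A0 h0 H).
Qed.

Lemma const_section_iso s : kernel_section f g 0 s ->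
  sheaf_iso (sectT f g 0) (sect_sum split_deg).
Proof.
move=> hs; have [hvs ks s0] := hs.
have [v [l [hv kv wv nzl vl]]] := const_complement hs.
have [i [j nzA]] := cminor_neq0 hnormal.
have l0 := tofrac_neq0 nzl; have A0 := tofrac_neq0 nzA.
have hsk k q : stalkO 0 q (tofrac (s k 0)).
  by apply: stalk_hom; have := hvs k; rewrite /src addr0.
have [c [_ [cE _]]] := const_section hs.
have hsl q : stalkO 0 q (tofrac (s l 0))^-1.
  have h1 : homZ (0 + 0) (1 : R) by rewrite addr0; apply: homZ1.
  rewrite -[_^-1]mul1r -tofrac1; apply: stalk_div h1 _ _.
    by have := hvs l; rewrite /src addr0.
  move=> ql; apply: (point_proper (p := q)).
  have -> : 1 = (c l)^-1%:MP * s l 0.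
    rewrite cE -mpolyCM mulVf ?mpolyC1 //.
    by apply: contra_neq nzl => E; rewrite cE E mpolyC0.
  exact: pointMl.
(* Coordinates with respect to [s] and [v]: as [v l 0] is zero, the entry [l] reads off the
   coefficient of [s], and wedging with [s] that of [v]. *)
pose phi (x : 'cV[F]_4) : 'cV[F]_2 := \col_k if k == 0 then x l 0 / tofrac (s l 0)
  else (tofrac (s i 0) * x j 0 - tofrac (s j 0) * x i 0) / tofrac (A i j).
have phiD x y : phi (x + y) = phi x + phi y.
  apply/matrixP => k m; rewrite !mxE; case: ifP => _; rewrite -mulrDl //.
  by rewrite !mulrDr opprD addrACA.
have phiZ a x : phi (a *: x) = a *: phi x.
  apply/matrixP => k m; rewrite !mxE; case: ifP => _; rewrite [RHS]mulrA //.
  by congr (_ / _); rewrite mulrBr; congr (_ - _); apply: mulrCA.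
have ker x : jacobian f g *m x = 0 -> phi x = 0 -> x = 0.
  move=> kx /matrixP E; have := E 0 0; have := E 1 0; rewrite !mxE /= => /eqP E1 /eqP E0.
  have xl : x l 0 = 0 by move: E0; rewrite mulf_eq0 invr_eq0 (negPf l0) orbF => /eqP.
  have {}E1 : tofrac (s i 0) * x j 0 - tofrac (s j 0) * x i 0 = 0.
    by move: E1; rewrite mulf_eq0 invr_eq0 (negPf A0) orbF => /eqP.
  have ks' : jacobian f g *m tomx s = 0 by rewrite jacobianE -map_mxM ks map_mx0.
  have [f1 g1] := jac_ker_frac ks'; have [f2 g2] := jac_ker_frac kx.
  apply/matrixP => k m; rewrite ord1 mxE.
  have := wedge_proportional i j l k f1 g1 f2 g2; rewrite !tofrac_cminor !mxE E1 mul0r xl mulr0 subr0.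
  move/esym/eqP; rewrite mulf_eq0 (negPf A0) orbF mulf_eq0 (negPf l0) => /eqP //.
have sub x y : phi x = phi y -> phi (x - y) = 0.
  by move=> E; rewrite -scaleN1r phiD phiZ E scaleN1r subrr.
exists (fun _ => phi); split=> // U oU _; split.
- move=> x [hx kx] k q Uq; have hx' m : stalkO 0 q (x m 0) by exact: hx.
  rewrite mxE; case: eqP => _; last exact: sect_coef.
  by rewrite -[0]addr0; apply: stalkM.
- by move=> x y _ _.
- by move=> a x _ _.
- move=> x y [_ kx] [_ ky] /sub E; apply/eqP; rewrite -subr_eq0; apply/eqP.
  by apply: ker E; rewrite mulmxBr kx ky subrr.
move=> z hz; exists (z 0 0 *: tomx s + z 1 0 *: tomx v).
  split; last first.
    by rewrite mulmxDr -!scalemxAr jacobianE -!map_mxM ks kv map_mx0 !scaler0 addr0.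
  move=> k q Uq; rewrite !mxE; apply: stalkD.
    have z0 : stalkO 0 q (z 0 0) by exact: (hz 0 q Uq).
    by rewrite -[src_deg 0 k]addr0; apply: stalkM.
  have z1 : stalkO (- d%:Z) q (z 1 0) by exact: (hz 1 q Uq).
  rewrite -[src_deg 0 k]/0 -(addNr d%:Z); apply: stalkM => //.
  by apply: stalk_hom; have := hv k; rewrite /src add0r.
apply/matrixP => k m; rewrite ord1 mxE; have [->|->] := ord2P k; rewrite /= !mxE.
  by rewrite vl tofrac0; exact: (comb_div _ _ l0).
have H : tofrac (s i 0) * tofrac (v j 0) - tofrac (s j 0) * tofrac (v i 0) =
    tofrac (A i j) by rewrite -wv /wedge tofracB !tofracM.
exact: (wedge_comb_div _ _ A0 H).
Qed.

(** The global section [(1, 0)] of the split sheaf has a preimage, nonzero because the isomorphism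
    is additive. *)
Lemma iso_const_section : sheaf_iso (sectT f g 0) (sect_sum split_deg) ->
  exists s, kernel_section f g 0 s.
Proof.
move=> [phi [iso _]]; have [q0 _] := zero_point K.
have oW : zopen (@whole K).
  by move=> p _; exists 1, 0%N; split=> //; [apply: dhomog1 | apply: point_proper].
have [_ phiD _ _ surj] := iso (@whole K) oW (ex_intro _ q0 I).
have T0 : sectT f g 0 (@whole K) 0.
  by split; [move=> j q _; rewrite mxE; apply: stalk0 | rewrite mulmx0].
have phi0 : phi (@whole K) 0 = 0.
  have := phiD 0 0 T0 T0; rewrite addr0 => /eqP.
  by rewrite -subr_eq0 opprD addrA subrr sub0r oppr_eq0 => /eqP.
have [|x hx xE] := surj (\col_k (k == 0)%:R).
  move=> k q _; rewrite mxE; case: eqP => _; last exact: stalk0.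
  by rewrite -tofrac1; apply/stalk_hom/homZ1.
apply/global_sectT; exists x => //.
apply: contra_eq_neq xE => ->; rewrite phi0; apply/eqP => /matrixP/(_ 0 0).
by rewrite !mxE eqxx => /eqP; rewrite eq_sym oner_eq0.
Qed.

End SheafIso.

(** * The slope *)

(** Six times the Hilbert polynomial of R; the factor keeps the values integral. *)
Definition hilb3 (x : int) : int := (x + 1) * (x + 2) * (x + 3).

Lemma dim_dhomog (K : fieldType) n :
  6 * (\dim {:dhomog 4 K n})%:Z = hilb3 n%:Z.
Proof.
have -> : \dim {:dhomog 4 K n} = 'C(n + 3, n) by rewrite dimvf.
have E : ('C(n + 3, n) * 6 = (n + 1) * (n + 2) * (n + 3))%N.
  have C3 : 'C(n + 3, n) = 'C(n + 3, 3).
    by rewrite -[in RHS](@bin_sub (n + 3) 3) ?leq_addl // addnK.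
  have := bin_ffact (n + 3) 3; rewrite -C3 => E.
  rewrite -[6%N]/(3`!) E !ffactnS ffactn0 muln1 addn3 /=; lia.
by rewrite /hilb3; lia.
Qed.

(** The vanishing sum of the shifts cancels the quadratic terms, and the slope is three times the
    sum of their squares. *)
Lemma hilb3_slope (df dg e t : int) :
  hilb3 (df + t) + hilb3 (dg + t) + hilb3 (t - e) + hilb3 (t + e - (df + dg)) =
  4 * hilb3 t + 6 * (df ^+ 2 + dg ^+ 2 + df * dg - e * (df + dg - e)) * t +
  (hilb3 df + hilb3 dg + hilb3 (- e) + hilb3 (e - (df + dg)) - 4 * hilb3 0).
Proof. rewrite /hilb3; ring. Qed.

Lemma affine_slope_le (q r c c' : int) (t0 : nat) :
  (forall t : nat, (t0 <= t)%N -> q * t%:Z + c <= r * t%:Z + c') -> q <= r.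
Proof.
move=> H; rewrite leNgt; apply/negP => lt.
have := H (t0 + `|c' - c|.+1)%N (leq_addr _ _); move: lt; nia.
Qed.

Section Slope.
Variable K : fieldType.
Local Notation R := {mpoly K[4]}.
Implicit Types (t : nat).

Variables (f g : R) (df dg : nat).
Hypotheses (hf : f \is (df.+1).-homog) (hg : g \is (dg.+1).-homog).
Hypothesis hnormal : normal f g df dg.
Variables (m c : int).
Hypothesis mE : forall t, euler_charQ f g df dg t (m * t + c).

Local Notation A := (cminor (grad f) (grad g)).
Local Notation JM := (jacR f g).
Local Notation D t := (\dim (lker (linfun (@jac_t K f g df dg t)))).
Local Notation d := (df + dg)%N.
Local Notation m0 := (df ^ 2 + dg ^ 2 + df * dg)%N.

Lemma dim_kernel_large : exists t0, forall t, (t0 <= t)%N ->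
  6 * (m * t%:Z + c) + 4 * hilb3 t%:Z =
  hilb3 (df%:Z + t%:Z) + hilb3 (dg%:Z + t%:Z) + 6 * (D t)%:Z.
Proof.
have [t0 h] := euler_char_large hf hg; exists t0 => t /h/(_ _ (mE t))[N ->].
have -> : \dim {:{ffun 'I_4 -> dhomog 4 K t}} = (4 * \dim {:dhomog 4 K t})%N.
  by rewrite !dimvf /dim /= card_ord.
have -> : \dim {:(dhomog 4 K (df + t) * dhomog 4 K (dg + t))%type} =
  (\dim {:dhomog 4 K (df + t)} + \dim {:dhomog 4 K (dg + t)})%N by rewrite !dimvf.
have := dim_dhomog K t; have := dim_dhomog K (df + t); have := dim_dhomog K (dg + t).
rewrite !PoszD; lia.
Qed.

Section LeastDegree.
Variables (e : nat) (s : 'cV[R]_4).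
Hypotheses (hs : kernel_section f g e s) (ed : (e <= d)%N).
Hypothesis emin : forall (e' : nat) s', kernel_section f g e' s' -> (e <= e')%N.

Let cs := min_section_coprime hs emin.

Lemma slope_le : m <= m0%:Z - (e * (d - e))%N%:Z.
Proof.
have [t0 h] := dim_kernel_large; have [i [j nz]] := cminor_neq0 hnormal.
suff : 6 * m <= 6 * (m0%:Z - (e * (d - e))%N%:Z) by lia.
apply: (@affine_slope_le _ _ (6 * c) (hilb3 df%:Z + hilb3 dg%:Z + hilb3 (- e%:Z) +
  hilb3 (e%:Z - (df%:Z + dg%:Z)) - 4 * hilb3 0) (t0 + d)) => t ht.
have ta : (t - e + e = t)%N by lia.
have tb : (t + e - d + d = t + e)%N by lia.
have := dim_kernel_le hf hg hnormal hs cs ta tb nz.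
have := dim_dhomog K (t - e); have := dim_dhomog K (t + e - d).
have -> : (t - e)%N%:Z = t%:Z - e%:Z by lia.
have -> : (t + e - d)%N%:Z = t%:Z + e%:Z - (df%:Z + dg%:Z) by lia.
have /h : (t0 <= t)%N by lia.
have := hilb3_slope df dg e t.
have -> : m0%:Z - (e * (d - e))%N%:Z =
  df%:Z ^+ 2 + dg%:Z ^+ 2 + df%:Z * dg%:Z - e%:Z * (df%:Z + dg%:Z - e%:Z).
  have E : (d - e)%N%:Z = df%:Z + dg%:Z - e%:Z by lia.
  by rewrite -!mulnn !(PoszD, PoszM) E !expr2.
lia.
Qed.

End LeastDegree.

(** The section of degree 0 and its complement span enough of the kernel to bound its dimension from
    below by the value that was an upper bound for [e = 0]. *)
Lemma slope_ge s : kernel_section f g 0 s -> m0%:Z <= m.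
Proof.
move=> hs; have [t0 h] := dim_kernel_large; have [i [j nz]] := cminor_neq0 hnormal.
have [v [_ [hv kv wv _ _]]] := const_complement hf hg hs.
suff : 6 * m0%:Z <= 6 * m by lia.
apply: (@affine_slope_le _ _ (hilb3 df%:Z + hilb3 dg%:Z + hilb3 (- 0) +
  hilb3 (0 - (df%:Z + dg%:Z)) - 4 * hilb3 0) (6 * c) (t0 + d)) => t ht.
have ta : (t + 0 = t)%N by lia.
have tb : (t - d + d = t)%N by lia.
have := dim_kernel_ge hf hg (e := 0) hs ta nz tb hv kv wv.
have := dim_dhomog K t; have := dim_dhomog K (t - d).
have -> : (t - d)%N%:Z = t%:Z + 0 - (df%:Z + dg%:Z) by lia.
have /h : (t0 <= t)%N by lia.
have := hilb3_slope df dg 0 t; rewrite mul0r !subr0.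
have -> : m0%:Z = df%:Z ^+ 2 + dg%:Z ^+ 2 + df%:Z * dg%:Z.
  by rewrite -!mulnn !(PoszD, PoszM) !expr2.
move: (hilb3 (- 0)) (hilb3 (0 - _)) => z1 z2; lia.
Qed.

Lemma zero_ideal1_section (e : nat) s : kernel_section f g e s -> e = d ->
  zero_ideal f g s 1 -> exists s', kernel_section f g 0 s'.
Proof.
move=> [hs ks s0] ed [v kv wv]; have [i [j nz]] := cminor_neq0 hnormal.
exists (compv src 0 v); split; first exact: vhom_compv.
  rewrite -(compvM (bhom_jacR hf hg)) kv.
  by apply/matrixP => k l; rewrite !mxE piZ0.
have hsk k : homZ d%:Z (s k 0) by have := hs k; rewrite /src add0r ed.
apply: contra_neq nz => E.
(* Were the component of degree 0 zero, comparing components of degree [d] in [s /\ v = A] would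
   give [A i j = 0]. *)
have v0 k : piZ 0 (v k 0) = 0.
  by have := congr1 (fun x : 'cV[R]_4 => x k 0) E; rewrite !mxE /src addr0.
rewrite -(piZ_id (homZ_cminor hf hg i j)) -[A i j]mul1r -wv /wedge.
rewrite -[d%:Z]addr0 -mulN1r piZD (piZM _ _ (hsk i)) mulrA mulN1r.
by rewrite (piZM _ _ (homZN (hsk j))) !v0 !mulr0 addr0.
Qed.

End Slope.

Lemma max_slope_section (K : closedFieldType) (f g : {mpoly K[4]}) df dg (c : int) :
  f \is (df.+1).-homog -> g \is (dg.+1).-homog -> normal f g df dg ->
  (forall t, euler_charQ f g df dg t
     ((df ^ 2 + dg ^ 2 + df * dg)%N%:Z * t + c)) ->
  exists s, kernel_section f g 0 s.
Proof.
move=> hf hg hn hE; have [e [s [hs ed emin]]] := min_section hf hg hn.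
have cs : coprime_family (fun j => s j 0) := min_section_coprime hs emin.
have ede : (e * (df + dg - e) = 0)%N.
  have := slope_le hf hg hn hE hs ed emin; move: (e * _)%N => z; lia.
have [e0|e0] := eqVneq e 0%N; first by exists s; move: hs; rewrite e0.
have {ede}ed : e = (df + dg)%N by move/eqP: ede; rewrite muln_eq0 (negPf e0); lia.
have [_ ks s0] := hs; apply: (zero_ideal1_section hf hg hn hs ed).
apply: (unit_ideal ks s0 cs) => y w yw.
have [t0 h] := dim_kernel_large hf hg hE; have [i [j nz]] := cminor_neq0 hn.
pose k : int := hilb3 df%:Z + hilb3 dg%:Z + hilb3 (- e%:Z) +
  hilb3 (e%:Z - (df%:Z + dg%:Z)) - 4 * hilb3 0.
(* As [e = d], the slopes agree and the defect [dim R_(t - e) + dim R_t - dim S_t] is the constant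
   [(k - 6 c) / 6], at most [C]. The choice of [t] ensures [C <= t], so there are enough binary
   forms of degree [t]. *)
pose C := absz (k - 6 * c)%R; pose t := (t0 + e + C)%N.
exists t.
have ta : (t - e + e = t)%N by lia.
have tb : (t + (df + dg) = t + e)%N by lia.
apply: (zero_ideal_bform hf hg hn hs cs ta tb nz yw (C := C)); first by lia.
have := dim_dhomog K (t - e); have := dim_dhomog K t.
have -> : (t - e)%N%:Z = t%:Z - e%:Z by lia.
have /h : (t0 <= t)%N by lia.
have := hilb3_slope df dg e t; rewrite -/k.
have -> : t%:Z + e%:Z - (df%:Z + dg%:Z) = t by lia.
have -> : df%:Z ^+ 2 + dg%:Z ^+ 2 + df%:Z * dg%:Z - e%:Z * (df%:Z + dg%:Z - e%:Z) =
  (df ^ 2 + dg ^ 2 + df * dg)%N%:Z.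
  rewrite -!mulnn !(PoszD, PoszM) !expr2; have -> : e%:Z = df%:Z + dg%:Z by lia.
  by rewrite subrr mulr0 subr0.
lia.
Qed.

Theorem theoremA (K : closedFieldType) (char0 : [pchar K] =i pred0)
  (df dg : nat) (f g : {mpoly K[4]})
  (hf : f \is (df.+1).-homog) (hg : g \is (dg.+1).-homog)
  (hfg : alg_independent f g)
  (hnormal : normal f g df dg)
  (m : int) (hm : is_mult f g df dg m) :
  let d : nat := (df + dg)%N in
  let m0 : nat := (df ^ 2 + dg ^ 2 + df * dg)%N in
  [/\ exists2 e : int, is_indeg f g e & e <= d%:Z,
      m <= m0%:Z
    & [<-> m = m0%:Z;
           is_indeg f g 0;
           compressible f g;
           sheaf_iso (sectT f g 0)
             (sect_sum (fun i : 'I_2 => if i == 0 then 0 else - d%:Z))]].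
Proof.
move=> d m0; have [c mE] := hm.
have [e [s [hs ed emin]]] := min_section hf hg hnormal.
have mle : m <= m0%:Z.
  by have := slope_le hf hg hnormal mE hs ed emin; rewrite -/m0; lia.
split=> //.
  exists e%:Z => //; split; first by apply/global_sectT; exists s.
  move=> k /global_sectT[s' hs']; have k0 := kernel_section_ge0 hs'.
  by move: hs'; rewrite -[k]gez0_abs // lez_nat => /emin.
tfae.
- move=> mm0; apply/is_indeg0; apply: (max_slope_section (c := c) hf hg hnormal).
  by move=> t; have := mE t; rewrite mm0.
- by move/is_indeg0; apply: (compressible_kernel char0 f g).2.
- by move/(compressible_kernel char0 f g) => [s' hs']; apply: const_section_iso hs'.
- move/iso_const_section => [s' /(slope_ge hf hg hnormal mE) mge].
  by apply/eqP; rewrite eq_le mle.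
Qed.
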